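(* The monomial ideals in $H_{2,n}$ are in bijection with trees $T$ having $n+1$ unlabeled vertices and $n$ edges, labeled $1,\dots,n$, each edge directed; the bijection sends $T$ to $I_T$. In particular there are exactly $2^n(n+1)^{n-2}$ monomial ideals in $H_{2,n}$. Two such monomial ideals $I_T,I_{T'}$ are joined by an edge of the graph of $H_{2,n}$ if and only if $T'$ is obtained from $T$ by one of the following operations: (1) move any subset of the subtrees attached at a vertex to an adjacent vertex (along the connecting edge); (2) swap two edges that meet at a bivalent vertex, preserving their orientations.
   Context: Over an algebraically closed field $K$, let $X=\begin{bmatrix}x_1&\cdots&x_n\\ y_1&\cdots&y_n\end{bmatrix}$, $K[X]$ $\mathbb{Z}^n$-graded by $\deg x_i=\deg y_i=e_i$. $H_{2,n}$ is the multigraded Hilbert scheme of $\mathbb{Z}^n$-homogeneous ideals $I$ with $\dim_K(K[X]/I)_u=u_1+\cdots+u_n+1$ for all $u\in\mathbb{N}^n$. For a tree $T$ as described and distinct $i,j\in\{1,\dots,n\}$, set $z_{ij}=x_j$ if the directed edge $j$ points away from edge $i$ (i.e. the tail of $j$ is the endpoint of $j$ closer to edge $i$), and $z_{ij}=y_j$ otherwise; then $I_T=\langle z_{ij}z_{ji}: 1\le i<j\le n\rangle$ (so the generator for $\{i,j\}$ is $y_iy_j$ if $i,j$ point toward each other, $x_ix_j$ if they point away from each other, $y_ix_j$ if $i$ points toward $j$ but not conversely, $x_iy_j$ if $j$ points toward $i$ but not conversely). The graph of $H_{2,n}$ has the monomial ideals in $H_{2,n}$ as vertices, with an edge between two monomial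 ideals whenever some ideal in $H_{2,n}$ has exactly these two as its initial monomial ideals (over all term orders). *)

(* Defs.v *)
From HB Require Import structures.
From mathcomp Require Import all_boot all_order all_algebra.
Set Implicit Arguments. Unset Strict Implicit. Unset Printing Implicit Defensive.
Import GRing.Theory.

(* a monomial prod x_i^(m.1 i) y_i^(m.2 i) *)
Definition mon (n : nat) := ({ffun 'I_n -> nat} * {ffun 'I_n -> nat})%type.

Definition mmul n (a b : mon n) : mon n :=
  ([ffun i => a.1 i + b.1 i], [ffun i => a.2 i + b.2 i]).
Definition mdvd n (a b : mon n) : bool :=
  [forall i, (a.1 i <= b.1 i) && (a.2 i <= b.2 i)].
Definition mquo n (b a : mon n) : mon n :=
  ([ffun i => b.1 i - a.1 i], [ffun i => b.2 i - a.2 i]).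
Definition mone n : mon n := ([ffun => 0%N], [ffun => 0%N]).
Definition mdeg n (m : mon n) : {ffun 'I_n -> nat} := [ffun i => m.1 i + m.2 i].
Definition xvar n (j : 'I_n) : mon n := ([ffun i => (i == j) : nat], [ffun => 0%N]).
Definition yvar n (j : 'I_n) : mon n := ([ffun => 0%N], [ffun i => (i == j) : nat]).

Section Poly.
Variables (K : closedFieldType) (n : nat).
Local Open Scope ring_scope.

(* elements of K[X] are coefficient functions with finite support *)
Definition pol := mon n -> K.
Definition is_poly (f : pol) : Prop :=
  exists s : seq (mon n), forall m, f m != 0 -> m \in s.

Definition pzero : pol := fun _ => 0.
Definition padd (f g : pol) : pol := fun m => f m + g m.
Definition psub (f g : pol) : pol := fun m => f m - g m.
Definition mono (m : mon n) : pol := fun m' => if m' == m then 1 else 0.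
Definition term_mul (c : K) (m : mon n) (f : pol) : pol :=
  fun m' => if mdvd m m' then c * f (mquo m' m) else 0.
Definition comb (cs : seq K) (fs : seq pol) : pol :=
  fun m => \sum_(p <- zip cs fs) p.1 * p.2 m.

(* ideals of K[X]: nonempty subsets of polynomials closed under addition
   and under multiplication by elements of K[X]; since every polynomial is
   a finite sum of terms c*m, closure under multiplication by terms is
   used. *)
Definition is_ideal (I : pol -> Prop) : Prop :=
  [/\ forall f, I f -> is_poly f,
      I pzero,
      forall f g, I f -> I g -> I (padd f g) &
      forall c m f, I f -> I (term_mul c m f)].

Definition gen (S : pol -> Prop) : pol -> Prop :=
  fun f => forall J, is_ideal J -> (forall g, S g -> J g) -> J f.

Definition same_ideal (I J : pol -> Prop) : Prop := forall f, I f <-> J f.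

Definition homog (u : {ffun 'I_n -> nat}) (f : pol) : Prop :=
  forall m, f m != 0 -> mdeg m = u.
Definition hcomp (u : {ffun 'I_n -> nat}) (f : pol) : pol :=
  fun m => if mdeg m == u then f m else 0.
Definition is_homog_ideal (I : pol -> Prop) : Prop :=
  is_ideal I /\ forall f u, I f -> I (hcomp u f).

Definition monomial_ideal (I : pol -> Prop) : Prop :=
  is_ideal I /\
  exists S : mon n -> Prop, same_ideal I (gen (fun g => exists m, S m /\ g = mono m)).

(* dim_K (K[X]/I)_u = d : the classes of the d elements of fs form a basis
   of (K[X]/I)_u = K[X]_u / I_u *)
Definition indep_mod (I : pol -> Prop) (fs : seq pol) : Prop :=
  forall cs : seq K, size cs = size fs -> I (comb cs fs) -> all (fun c => c == 0) cs.
Definition span_mod (I : pol -> Prop) u (fs : seq pol) : Prop :=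
  forall f, is_poly f -> homog u f ->
    exists cs : seq K, size cs = size fs /\ I (psub f (comb cs fs)).
Definition quot_dim (I : pol -> Prop) (u : {ffun 'I_n -> nat}) (d : nat) : Prop :=
  exists fs : seq pol, [/\ size fs = d,
    forall i, (i < size fs)%N -> is_poly (nth pzero fs i) /\ homog u (nth pzero fs i),
    indep_mod I fs & span_mod I u fs].

Definition in_H (I : pol -> Prop) : Prop :=
  is_homog_ideal I /\ forall u : {ffun 'I_n -> nat}, quot_dim I u (\sum_(i < n) u i).+1.

Definition term_order (lt : mon n -> mon n -> Prop) : Prop :=
  [/\ forall a, ~ lt a a,
      forall a b c, lt a b -> lt b c -> lt a c,
      forall a b, a <> b -> lt a b \/ lt b a,
      forall a b c, lt a b -> lt (mmul a c) (mmul b c) &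
      forall a, a <> mone n -> lt (mone n) a].

Definition lead_mon (lt : mon n -> mon n -> Prop) (f : pol) (m : mon n) : Prop :=
  f m != 0 /\ forall m', f m' != 0 -> m' <> m -> lt m' m.

Definition init_ideal (lt : mon n -> mon n -> Prop) (I : pol -> Prop) : pol -> Prop :=
  gen (fun g => exists f m, [/\ I f, lead_mon lt f m & g = mono m]).

Definition H_edge (M1 M2 : pol -> Prop) : Prop :=
  [/\ in_H M1 /\ monomial_ideal M1, in_H M2 /\ monomial_ideal M2,
      ~ same_ideal M1 M2 &
      exists I, [/\ in_H I,
        forall lt, term_order lt ->
          same_ideal (init_ideal lt I) M1 \/ same_ideal (init_ideal lt I) M2,
        exists lt, term_order lt /\ same_ideal (init_ideal lt I) M1 &
        exists lt, term_order lt /\ same_ideal (init_ideal lt I) M2]].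

End Poly.

(* Trees with n+1 (unlabeled) vertices and n directed edges labeled   *)
(* 1..n. A representative uses vertex set 'I_(n+1); edge j is the      *)
(* pair (tail, head). Trees are considered up to vertex relabeling.   *)

Definition dgraph n := 'I_n -> 'I_n.+1 * 'I_n.+1.

Definition adj_wo n (e : dgraph n) (k : option 'I_n) : rel 'I_n.+1 :=
  fun v w => [exists j, (Some j != k) && ((e j == (v, w)) || (e j == (w, v)))].

Definition is_tree n (e : dgraph n) : Prop :=
  (forall j, (e j).1 != (e j).2) /\ forall v, connect (adj_wo e None) ord0 v.

Definition tree_iso n (e e' : dgraph n) : Prop :=
  exists s : 'I_n.+1 -> 'I_n.+1, injective s /\ forall j, e' j = (s (e j).1, s (e j).2).

(* z_ij : x_j if edge j points away from edge i (its tail is the endpoint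
   of j closer to edge i, i.e. in the same component of T - j as edge i),
   and y_j otherwise *)
Definition zvar n (e : dgraph n) (i j : 'I_n) : mon n :=
  if connect (adj_wo e (Some j)) (e j).1 (e i).1 then xvar j else yvar j.

Definition I_T (K : closedFieldType) n (e : dgraph n) : pol K n -> Prop :=
  gen (fun g => exists i j : 'I_n, (i < j)%N /\ g = mono K (mmul (zvar e i j) (zvar e j i))).

Arguments I_T K {n} e.

Definition incident n (e : dgraph n) (v : 'I_n.+1) (j : 'I_n) : bool :=
  ((e j).1 == v) || ((e j).2 == v).

(* operation (1): at vertex v, the subtrees hanging off the edges in S
   (edges at v other than the edge k joining v to w) are moved to w *)
Definition repl n (v w x : 'I_n.+1) := if x == v then w else x.
Definition move_op n (e e' : dgraph n) : Prop :=
  exists (v w : 'I_n.+1) (k : 'I_n) (S : pred 'I_n),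
    [/\ (e k == (v, w)) || (e k == (w, v)),
        forall j, S j -> j != k /\ incident e v j &
        forall j, e' j = if S j then (repl v w (e j).1, repl v w (e j).2) else e j].

(* operation (2): v bivalent with edges a (other end p) and b (other end q);
   the path p -a- v -b- q becomes p -b- v -a- q, each edge keeping its
   orientation along the path (from the p side to the q side) *)
Definition other_end n (e : dgraph n) (j : 'I_n) (v : 'I_n.+1) :=
  if (e j).1 == v then (e j).2 else (e j).1.
Definition swap_op n (e e' : dgraph n) : Prop :=
  exists (v : 'I_n.+1) (a b : 'I_n),
    let p := other_end e a v in
    let q := other_end e b v in
    let f x := if x == p then v else if x == v then q else x in
    let g x := if x == q then v else if x == v then p else x in
    [/\ a != b,
        forall j, incident e v j = (j == a) || (j == b) &
        forall j, e' j = if j == a then (f (e a).1, f (e a).2)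
                         else if j == b then (g (e b).1, g (e b).2) else e j].

Definition tree_move n (e e' : dgraph n) : Prop := move_op e e' \/ swap_op e e'.

(* Main.v *)
Require Import Defs.
From mathcomp Require Import all_boot all_order all_algebra.
From mathcomp Require Import boolp zify.
Import GRing.Theory.
Set Implicit Arguments. Unset Strict Implicit. Unset Printing Implicit Defensive.

(* A monomial ideal of H_{2,n} contains exactly one monomial z_ij z_ji in each degree e_i + e_j,
   so it is recorded by bits b i j, with z_ij = x_j iff b i j.  Raising one degree u_i by one adds
   at most one standard monomial, and always exactly one iff for distinct i, j, k
   either b i j = b k j or b i k = b j k.  These [tree_sys] are the position data ("on which side
   of edge j does edge i lie") of the trees: the vertices are the n + 1 pure standard monomials
   of degree (1,...,1), and flipping the sign of one variable gives the edges.  Choosing a root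
   vertex turns a tree system into a rooted forest on the set of edges, whence the count.

   An ideal with exactly two initial ideals has, in each degree e_i + e_j where they differ, a
   binomial generator, and comparing weight orders forces all these binomials to have the same
   exponent difference; it involves one edge (subtrees slide along it) or two (they are swapped).
   Conversely, the binomial ideal of such a pair vanishes on a tree of rational curves, one for
   each edge (for a swap the two curves merge into a conic); evaluating on these curves shows
   that the standard monomials of both ideals stay independent modulo it. *)

(** * Monomials and ideals *)

(** A monomial ideal of the Hilbert scheme is generated by its quadrics because the quadrics alone
    already cut the quotient down to the prescribed dimension: the bound of one new standard
    monomial per degree step holds for every table [b], and the condition on triples decides whether
    it is attained. In the count, a tree system has n + 1 possible roots, the sides of the root are
    2^n free bits, and the forests number (n + 1)^(n - 1). The ideal joining two neighbours is
    defined by vanishing conditions instead of generators: independence of the standard monomials is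
    read off from these conditions, spanning comes from dividing by the binomials that satisfy them,
    and no S-pair has to be reduced. Any term order directs all the binomials alike, since they
    share one exponent difference, so no third initial ideal can occur. For the operations on trees,
    the sides of an edge are characterised locally, by their values at its two ends and constancy
    along all other edges; positions after an operation are found by guessing the new side function
    and checking it edge by edge. *)

Section Monomials.
Variable n : nat.
Implicit Types (m a c : mon n) (i j k : 'I_n) (p q : bool).

Definition expo m j p := (if p then m.1 else m.2) j.
Definition pvar j p : mon n := if p then xvar j else yvar j.

Lemma monP a c : (forall j p, expo a j p = expo c j p) -> a = c.
Proof.
case: a c => [a1 a2] [c1 c2] E; congr pair; apply/ffunP=> j.
  exact: (E j true). exact: (E j false).
Qed.

Lemma expo_mmul a c j p : expo (mmul a c) j p = expo a j p + expo c j p.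
Proof. by case: p; rewrite /expo /= ffunE. Qed.

Lemma expo_mquo a c j p : expo (mquo a c) j p = expo a j p - expo c j p.
Proof. by case: p; rewrite /expo /= ffunE. Qed.

Lemma expo_mone j p : expo (mone n) j p = 0.
Proof. by case: p; rewrite /expo /= ffunE. Qed.

Lemma expo_pvar i j p q : expo (pvar j p) i q = (i == j) && (p == q).
Proof. by case: p; case: q; rewrite /expo /pvar /= !ffunE ?andbT ?andbF. Qed.

Lemma mdegE m j : mdeg m j = expo m j true + expo m j false.
Proof. by rewrite /mdeg ffunE. Qed.

Lemma mdegEp m j p : mdeg m j = expo m j p + expo m j (~~ p).
Proof. by rewrite mdegE; case: p => //=; rewrite addnC. Qed.

Lemma mdvdP a c : reflect (forall j p, expo a j p <= expo c j p) (mdvd a c).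
Proof.
apply: (iffP forallP) => [H j p | H j].
  by case/andP: (H j); case: p.
by apply/andP; split; [exact: (H j true) | exact: (H j false)].
Qed.

Lemma mdvdm m : mdvd m m.
Proof. by apply/mdvdP. Qed.

Lemma mdvd_trans a m c : mdvd a m -> mdvd m c -> mdvd a c.
Proof. by move=> /mdvdP h /mdvdP g; apply/mdvdP=> j p; apply: leq_trans (g j p). Qed.

Lemma mdvd_mmulr a c : mdvd a (mmul a c).
Proof. by apply/mdvdP=> j p; rewrite expo_mmul leq_addr. Qed.

Lemma mmulC a c : mmul a c = mmul c a.
Proof. by apply: monP => j p; rewrite !expo_mmul addnC. Qed.

Lemma mquoK a c : mdvd a c -> mmul (mquo c a) a = c.
Proof. by move/mdvdP=> h; apply: monP => j p; rewrite expo_mmul expo_mquo subnK. Qed.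

Lemma mmulK a c : mquo (mmul c a) a = c.
Proof. by apply: monP => j p; rewrite expo_mquo expo_mmul addnK. Qed.

Lemma mdeg_mmul a c : mdeg (mmul a c) = [ffun i => mdeg a i + mdeg c i].
Proof. by apply/ffunP=> j; rewrite [RHS]ffunE !mdegE !expo_mmul; lia. Qed.

Lemma mdeg_pvar j p : mdeg (pvar j p) = [ffun i => (i == j) : nat].
Proof. by apply/ffunP=> i; rewrite [RHS]ffunE mdegE !expo_pvar; case: p; case: eqP. Qed.

(** Given the multidegree, a monomial is determined by its x-exponents; the bound [\sum_i u i] on
    each of them makes the function type finite. *)
Definition mons (u : {ffun 'I_n -> nat}) : seq (mon n) :=
  [seq ([ffun i => val (v i)], [ffun i => u i - v i]) : mon n
    | v : {ffun 'I_n -> 'I_(\sum_i u i).+1} <- enum {ffun 'I_n -> 'I_(\sum_i u i).+1}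
    & [forall i, v i <= u i]].

Lemma mem_mons u m : (m \in mons u) = (mdeg m == u).
Proof.
apply/mapP/eqP => [[a] | <-].
  rewrite mem_filter => /andP[/forallP h _] ->; apply/ffunP=> i.
  by rewrite !ffunE /= subnKC.
have lt i : m.1 i < (\sum_i mdeg m i).+1.
  by rewrite ltnS (bigD1 i) //= {1}(mdegE m i : mdeg m i = m.1 i + _) -addnA leq_addr.
exists [ffun i => Ordinal (lt i)].
  rewrite mem_filter mem_enum andbT; apply/forallP=> i.
  by rewrite !ffunE /= leq_addr.
apply: monP => j []; rewrite /expo /= !ffunE //=.
by rewrite addKn.
Qed.

Lemma mons_uniq u : uniq (mons u).
Proof.
rewrite map_inj_in_uniq; first by rewrite filter_uniq // enum_uniq.
move=> a c _ _ [/ffunP E _]; apply/ffunP=> i; apply: val_inj.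
by have := E i; rewrite !ffunE.
Qed.

Lemma mem_mdeg m : m \in mons (mdeg m).
Proof. by rewrite mem_mons. Qed.

End Monomials.

Section Ideals.
Variables (K : closedFieldType) (n : nat).
Implicit Types (m : mon n) (f g : pol K n) (I J : pol K n -> Prop).
Local Open Scope ring_scope.

Definition pscale (c : K) f : pol K n := fun m => c * f m.
Definition psum (A : Type) (s : seq A) (F : A -> pol K n) : pol K n :=
  fun m => \sum_(x <- s) F x m.

Lemma is_poly0 : is_poly (@pzero K n).
Proof. by exists [::] => m; rewrite /pzero eqxx. Qed.

Lemma is_polyD f g : is_poly f -> is_poly g -> is_poly (padd f g).
Proof.
move=> [s hs] [t ht]; exists (s ++ t) => m; rewrite /padd mem_cat => h.
case: (eqVneq (f m) 0) => [e|/hs -> //]; case: (eqVneq (g m) 0) => [e'|/ht ->].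
  by rewrite e e' addr0 eqxx in h.
by rewrite orbT.
Qed.

Lemma is_poly_term c m f : is_poly f -> is_poly (term_mul c m f).
Proof.
move=> [s hs]; exists [seq mmul m' m | m' <- s] => m'; rewrite /term_mul.
case: ifP => [d h|]; last by rewrite eqxx.
apply/mapP; exists (mquo m' m); last by rewrite mquoK.
by apply: hs; apply: contraNneq h => ->; rewrite mulr0.
Qed.

Lemma is_poly_mono m : is_poly (mono K m).
Proof.
by exists [:: m] => m'; rewrite /mono inE; case: (m' == m) => //; rewrite eqxx.
Qed.

Lemma poly_ideal : is_ideal (@is_poly K n).
Proof.
split=> //; [exact: is_poly0 | exact: is_polyD | move=> c m f; exact: is_poly_term].
Qed.

Lemma mono_neq0 m m' : (mono K m m' != 0) = (m' == m).
Proof. by rewrite /mono; case: (m' == m); rewrite ?oner_eq0 ?eqxx. Qed.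

Section InIdeal.
Variable I : pol K n -> Prop.
Hypothesis idI : is_ideal I.

Lemma ideal0 : I (@pzero K n). Proof. by case: idI. Qed.
Lemma idealD f g : I f -> I g -> I (padd f g). Proof. by case: idI => _ _ h _; apply: h. Qed.
Lemma idealT c m f : I f -> I (term_mul c m f). Proof. by case: idI => _ _ _; apply. Qed.

Lemma idealZ c f : I f -> I (pscale c f).
Proof.
move=> /(idealT c (mone n)); congr (I _); apply: funext => m.
rewrite /term_mul /pscale ifT; last by apply/mdvdP=> j p; rewrite expo_mone.
by congr (_ * f _); apply: monP => j p; rewrite expo_mquo expo_mone subn0.
Qed.

Lemma idealB f g : I f -> I g -> I (psub f g).
Proof.
move=> hf /(idealZ (-1)) hg; move: (idealD hf hg); congr (I _); apply: funext => m.
by rewrite /padd /pscale /psub mulN1r.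
Qed.

Lemma ideal_psum (A : eqType) (s : seq A) F : {in s, forall x, I (F x)} -> I (psum s F).
Proof.
elim: s => [_|x s IH h].
  have -> : psum [::] F = @pzero K n by apply: funext => m; rewrite /psum big_nil.
  exact: ideal0.
have -> : psum (x :: s) F = padd (F x) (psum s F).
  by apply: funext => m; rewrite /psum big_cons.
apply: idealD; first by apply: h; rewrite inE eqxx.
by apply: IH => y ys; apply: h; rewrite inE ys orbT.
Qed.

Lemma ideal_mono_dvd m m' : I (mono K m) -> mdvd m m' -> I (mono K m').
Proof.
move=> /(idealT 1 (mquo m' m)) h d; move: h; congr (I _); apply: funext => a.
rewrite /term_mul /mono mul1r; case: ifP => da.
  congr (if _ then _ else _); apply/eqP/eqP => [e | ->].
    by rewrite -(mquoK da) e mmulC mquoK.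
  by apply: monP => j p; rewrite !expo_mquo subKn //; move/mdvdP: d; apply.
case: eqP => // ea; case/negP: da; rewrite ea; apply/mdvdP=> j p.
by rewrite expo_mquo leq_subr.
Qed.
End InIdeal.

Lemma poly_expand f (s : seq (mon n)) : uniq s -> (forall m, f m != 0 -> m \in s) ->
  f = psum s (fun m => pscale (f m) (mono K m)).
Proof.
move=> us hs; apply: funext => m; rewrite /psum /pscale /mono.
case: (boolP (m \in s)) => ms.
  rewrite (bigD1_seq m) //= eqxx mulr1 big1 ?addr0 // => a /negbTE h.
  by rewrite eq_sym h mulr0.
rewrite big_seq big1 => [|a a_s].
  by apply/eqP; apply: contraNT ms => /hs.
by case: eqP => [e|]; rewrite ?mulr0 //; rewrite e a_s in ms.
Qed.

Lemma poly_supp f : is_poly f -> exists2 s, uniq s & forall m, f m != 0 -> m \in s.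
Proof.
by case=> s hs; exists (undup s) => [|m /hs]; rewrite ?undup_uniq ?mem_undup.
Qed.

Lemma poly_ind_mono I f : is_ideal I -> is_poly f ->
  (forall m, f m != 0 -> I (mono K m)) -> I f.
Proof.
move=> idI /poly_supp[s us hs] h; rewrite (poly_expand us hs).
apply: ideal_psum => // m _; case: (eqVneq (f m) 0) => [->|/h]; last exact: idealZ.
move: (ideal0 idI); congr (I _); apply: funext => a.
by rewrite /pscale mul0r.
Qed.

Lemma gen_incl (S : pol K n -> Prop) f : S f -> gen S f.
Proof. by move=> Sf J _; apply. Qed.

Definition upclosed (U : mon n -> Prop) := forall m m', U m -> mdvd m m' -> U m'.

(** Describing a monomial ideal by supports turns membership into a condition on single
    monomials. *)
Definition monoI (U : mon n -> Prop) : pol K n -> Prop :=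
  fun f => is_poly f /\ forall m, f m != 0 -> U m.

Lemma monoI_ideal U : upclosed U -> is_ideal (monoI U).
Proof.
move=> hU; split=> [f [] // | | f g [pf hf] [pg hg] | c m f [pf hf]].
- by split=> [|m]; [exact: is_poly0 | rewrite /pzero eqxx].
- split=> [|m]; first exact: is_polyD.
  rewrite /padd; case: (eqVneq (f m) 0) => [-> | /hf //].
  by rewrite add0r => /hg.
- split=> [|m']; first exact: is_poly_term.
  rewrite /term_mul; case: ifP => [d|]; last by rewrite eqxx.
  case: (eqVneq (f (mquo m' m)) 0) => [->|/hf h _]; first by rewrite mulr0 eqxx.
  by apply: hU h _; rewrite -{2}(mquoK d) mdvd_mmulr.
Qed.

Lemma monoI_mono U m : monoI U (mono K m) <-> U m.
Proof.
split=> [[_ h] | h]; first by apply: h; rewrite mono_neq0.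
by split=> [|m']; [exact: is_poly_mono | rewrite mono_neq0 => /eqP ->].
Qed.

Lemma gen_mono (S : mon n -> Prop) :
  gen (fun g => exists m, S m /\ g = mono K m) = monoI (fun m => exists2 s, S s & mdvd s m).
Proof.
apply: funext => f; apply: propext; split=> [h | [pf hf] J idJ hJ].
  apply: h.
    by apply: monoI_ideal => m m' [s Ss d] d'; exists s => //; apply: mdvd_trans d'.
  by move=> g [m [Sm ->]]; apply/monoI_mono; exists m => //; exact: mdvdm.
apply: poly_ind_mono => // m /hf[s Ss d]; apply: ideal_mono_dvd d => //.
by apply: hJ; exists s.
Qed.

Lemma monomial_monoI U : upclosed U -> monomial_ideal (monoI U).
Proof.
move=> hU; split; first exact: monoI_ideal.
exists U => f; rewrite gen_mono; split=> -[pf h]; split=> // m /h.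
  by move=> Um; exists m => //; exact: mdvdm.
by case=> s Us; apply: hU.
Qed.

Lemma monomialP I : monomial_ideal I -> exists2 U, upclosed U & I = monoI U.
Proof.
case=> idI [S h]; exists (fun m => exists2 s, S s & mdvd s m).
  by move=> m m' [s Ss d] d'; exists s => //; apply: mdvd_trans d'.
by apply: funext => f; apply: propext; rewrite (h f) gen_mono.
Qed.

Lemma monoI_inj U V : same_ideal (monoI U) (monoI V) -> forall m, U m <-> V m.
Proof. by move=> h m; have := h (mono K m); rewrite !monoI_mono. Qed.

Lemma same_idealP I J : same_ideal I J <-> I = J.
Proof.
by split=> [h | -> //]; apply: funext => f; apply: propext.
Qed.

Lemma is_poly_hcomp u f : is_poly f -> is_poly (hcomp u f).
Proof.
by case=> s h; exists s => m; rewrite /hcomp; case: ifP => _; [exact: h | rewrite eqxx].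
Qed.

Lemma monoI_homog U : upclosed U -> is_homog_ideal (monoI U).
Proof.
move=> hU; split=> [|f u [pf h]]; first exact: monoI_ideal.
split=> [|m]; first exact: is_poly_hcomp.
by rewrite /hcomp; case: ifP => _; [exact: h | rewrite eqxx].
Qed.

Lemma comb_mono (cs : seq K) (B : seq (mon n)) m : size cs = size B -> uniq B ->
  comb cs [seq mono K m | m <- B] m = if m \in B then nth 0 cs (index m B) else 0.
Proof.
rewrite /comb => sz uB; elim: B cs sz uB => [|a B IH] [|c cs] //=.
  by rewrite big_nil.
case=> sz /andP[aB uB]; rewrite big_cons IH //= inE /mono eq_sym.
case: (eqVneq a m) => [<-|ne] /=; first by rewrite (negbTE aB) mulr1 addr0.
by rewrite mulr0 add0r.
Qed.

Lemma comb_supp (cs : seq K) (B : seq (mon n)) m : size cs = size B -> uniq B ->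
  comb cs [seq mono K m | m <- B] m != 0 -> m \in B.
Proof. by move=> sz uB; rewrite comb_mono //; case: ifP => //; rewrite eqxx. Qed.

Lemma quot_dim_basis I u (B : seq (mon n)) :
  uniq B -> (forall m, m \in B -> mdeg m = u) ->
  (forall f, I f -> (forall m, f m != 0 -> m \in B) -> forall m, f m = 0) ->
  (forall f, is_poly f -> homog u f ->
     exists2 g, forall m, g m != 0 -> m \in B & I (psub f g)) ->
  quot_dim I u (size B).
Proof.
move=> uB dB ind spn; exists [seq mono K m | m <- B]; split.
- by rewrite size_map.
- move=> i; rewrite size_map => lt; rewrite (nth_map (mone n)) //; split.
    exact: is_poly_mono.
  by move=> m; rewrite mono_neq0 => /eqP ->; apply: dB; apply: mem_nth.
- move=> cs; rewrite size_map => sz Ic; apply/(all_nthP 0) => i lt.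
  have iB : (i < size B)%N by rewrite -sz.
  have := ind _ Ic (fun m => comb_supp sz uB) (nth (mone n) B i).
  by rewrite comb_mono // mem_nth // index_uniq // => ->.
- move=> f pf hf; have [g gB Ig] := spn f pf hf.
  exists [seq g m | m <- B]; rewrite !size_map; split=> //.
  move: Ig; congr (I _); apply: funext => m; congr (_ - _).
  rewrite comb_mono ?size_map //; case: ifP => mB.
    by rewrite (nth_map (mone n)) ?index_mem // nth_index.
  by apply/eqP; apply: contraFT mB => /gB.
Qed.

(** The basis in [quot_dim] consists of arbitrary polynomials. Their coefficient matrix on the
    monomials outside [U] is row free by independence and row full by spanning, hence square. *)
Lemma quot_dim_mono U u (B : seq (mon n)) d :
  uniq B -> (forall m, m \in B <-> mdeg m = u /\ ~ U m) ->
  quot_dim (monoI U) u d -> size B = d.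
Proof.
move=> uB hB [fs [sz hom ind spn]].
pose A : 'M[K]_(size fs, size B) := \matrix_(i, j) nth (@pzero K n) fs i (nth (mone n) B j).
have combE (cs : seq K) m : size cs = size fs ->
    comb cs fs m = \sum_(i < size fs) nth 0 cs i * nth (@pzero K n) fs i m.
  move=> sc; rewrite /comb (big_nth (0, @pzero K n)) size_zip sc minnn big_mkord.
  by apply: eq_bigr => i _; rewrite nth_zip.
have rf : row_free A.
  rewrite -kermx_eq0; apply/eqP/row_matrixP => r; rewrite row0.
  set v := row r _; have : v *m A = 0 by rewrite -row_mul mulmx_ker row0.
  move=> vA.
  have /ind : size [seq v 0 i | i <- enum 'I_(size fs)] = size fs.
    by rewrite size_map size_enum_ord.
  set cs := map _ _ => h.
  have szc : size cs = size fs by rewrite size_map size_enum_ord.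
  have csE (i : 'I_(size fs)) : nth 0 cs i = v 0 i.
    by rewrite (nth_map i) ?size_enum_ord // nth_ord_enum.
  have /h /allP hz : monoI U (comb cs fs).
    split.
      have -> : comb cs fs = psum (enum 'I_(size fs)) (fun i => pscale (nth 0 cs i) (nth (@pzero K n) fs i)).
        by apply: funext => m; rewrite combE // /psum big_enum.
      apply: (ideal_psum poly_ideal) => i _; apply: (idealZ poly_ideal).
      by case: (hom i (ltn_ord i)).
    move=> m nz; apply: contrapT => nU.
    have dm : mdeg m = u.
      move: nz; rewrite combE // => nz; apply: contrapT => nd; case/eqP: nz.
      rewrite big1 // => i _; case: (hom i (ltn_ord i)) => _ /(_ m) hm.
      by case: (eqVneq (nth (@pzero K n) fs i m) 0) => [->|/hm //]; rewrite mulr0.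
    have mB : m \in B by apply/hB.
    have lt : (index m B < size B)%N by rewrite index_mem.
    case/eqP: nz; rewrite combE //; move/matrixP/(_ 0 (Ordinal lt)): vA.
    rewrite !mxE => e; rewrite -[RHS]e; apply: eq_bigr => i _; rewrite csE !mxE.
    by rewrite /= nth_index.
  apply/rowP=> i; have /eqP : nth 0 cs i == 0 by apply: hz; rewrite mem_nth // szc.
  by rewrite csE => ->; rewrite [RHS]mxE.
have rF : row_full A.
  have exE (j : 'I_(size B)) : exists v : 'rV[K]_(size fs), v *m A = delta_mx 0 j.
    have jB : nth (mone n) B j \in B by apply: mem_nth.
    have [dj _] := (hB _).1 jB.
    have [|cs [sc [_ hc]]] := spn (mono K (nth (mone n) B j)) (@is_poly_mono _).
      by move=> m; rewrite mono_neq0 => /eqP ->.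
    exists (\row_i nth 0 cs i); apply/rowP=> l; rewrite !mxE eqxx /=.
    have lB : nth (mone n) B l \in B by apply: mem_nth.
    have [_ nU] := (hB _).1 lB.
    have /eqP : psub (mono K (nth (mone n) B j)) (comb cs fs) (nth (mone n) B l) = 0.
      by apply/eqP; case: eqP => // /eqP /hc.
    rewrite /psub subr_eq0 combE // => /eqP e.
    under eq_bigr => i _ do rewrite !mxE.
    by rewrite -e /mono nth_uniq // -val_eqE; case: ifP.
  have [W hW] := choice exE.
  rewrite -sub1mx; apply/row_subP => j; apply/submxP; exists (W j).
  by rewrite hW row1.
by rewrite -sz; move: rf rF; rewrite /row_free /row_full => /eqP -> /eqP.
Qed.

End Ideals.

(** * Standard monomials of a tree system *)

Section Std.
Variables (n : nat) (b : 'I_n -> 'I_n -> bool).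
Implicit Types (m : mon n) (i j k : 'I_n) (p q : bool) (u : {ffun 'I_n -> nat}).

(** If [i] and [k] lie on different sides of [j], then [j] lies between them, so [i] and [j] are on
    the same side of [k]. *)
Definition tree_sys := forall i j k, i != j -> i != k -> j != k ->
  (b i j == b k j) || (b i k == b j k).

Definition std m := [forall i, forall j,
  (i != j) ==> ~~ ((0 < expo m j (b i j)) && (0 < expo m i (b j i)))].

Definition qgen i j : mon n := mmul (pvar j (b i j)) (pvar i (b j i)).

Lemma stdP m : reflect
  (forall i j, i != j -> 0 < expo m j (b i j) -> 0 < expo m i (b j i) -> False) (std m).
Proof.
apply: (iffP forallP) => [h i j ij h1 h2 | h i].
  by have /forallP/(_ j)/implyP/(_ ij) := h i; rewrite h1 h2.
by apply/forallP=> j; apply/implyP=> ij; apply/negP=> /andP[]; exact: h ij.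
Qed.

Lemma qgen_dvd i j m : i != j ->
  mdvd (qgen i j) m = (0 < expo m j (b i j)) && (0 < expo m i (b j i)).
Proof.
move=> ij; have ji : j != i by rewrite eq_sym.
apply/mdvdP/andP => [h | [h1 h2] l p].
  split; [have := h j (b i j) | have := h i (b j i)];
  rewrite expo_mmul !expo_pvar !eqxx /=; last by lia.
  by rewrite (negbTE ji) addn0.
rewrite expo_mmul !expo_pvar; case: (eqVneq l j) => [->|_].
  by rewrite (negbTE ji) addn0 /=; case: eqP => // <-.
by rewrite add0n; case: (eqVneq l i) => [->|_] //=; case: eqP => // <-.
Qed.

Lemma std_dvd m m' : std m' -> mdvd m m' -> std m.
Proof.
move=> /stdP h /mdvdP d; apply/stdP=> i j ij h1 h2.
by apply: (h i j ij); [apply: leq_trans (d _ _) | apply: leq_trans (d _ _)].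
Qed.

Lemma nstd_up : upclosed (fun m => ~~ std m).
Proof. by move=> m m' h d; apply: contra h => /std_dvd; apply. Qed.

Lemma nstdP m : reflect (exists i j, (i < j) /\ mdvd (qgen i j) m) (~~ std m).
Proof.
apply: (iffP idP) => [| [i [j [ij]]]]; last first.
  have ne : i != j by rewrite -val_eqE; case: ltngtP ij.
  rewrite qgen_dvd // => /andP[h1 h2]; apply/negP=> /stdP h.
  exact: (h i j ne h1 h2).
rewrite negb_forall => /existsP[i]; rewrite negb_forall => /existsP[j].
rewrite negb_imply negbK => /andP[ij h].
have [lt|lt|e] := ltngtP i j.
- by exists i, j; rewrite qgen_dvd.
- by exists j, i; rewrite qgen_dvd 1?eq_sym // andbC.
- by case/eqP: ij; apply: val_inj.
Qed.

(* The one standard monomial of degree [u + e_i] that is not of the form [grow i m] below. *)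
Definition gen_pt u i : mon n :=
  ([ffun j => if j == i then (u i).+1 else if b i j then 0 else u j],
   [ffun j => if j == i then 0 else if b i j then u j else 0]).

Lemma expo_gen_pt u i j p : expo (gen_pt u i) j p =
  if j == i then (if p then (u i).+1 else 0) else if p == b i j then 0 else u j.
Proof.
by rewrite /expo /gen_pt; case: p; rewrite /= ffunE; case: eqP => // _; case: (b i j).
Qed.

Definition incr_deg u i : {ffun 'I_n -> nat} := [ffun j => u j + (j == i)].

Definition stdl u := [seq m <- mons u | std m].

Lemma mem_stdl u m : (m \in stdl u) = std m && (mdeg m == u).
Proof. by rewrite mem_filter mem_mons. Qed.

Lemma stdl_uniq u : uniq (stdl u).
Proof. by rewrite filter_uniq // mons_uniq. Qed.

Lemma mdeg_incr_deg u i p m : mdeg m = u -> mdeg (mmul m (pvar i p)) = incr_deg u i.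
Proof. by move=> <-; rewrite mdeg_mmul mdeg_pvar; apply/ffunP=> j; rewrite !ffunE. Qed.

(** Under [tree_sys] this maps the standard monomials of degree [u] injectively to those of degree
    [u + e_i]. The preference for [y_i] is why [gen_pt] carries a pure power of [x_i]. *)
Definition grow i m := if std (mmul m (pvar i false)) then mmul m (pvar i false)
                       else mmul m (pvar i true).

Lemma std_mulvar m i p : std m -> 0 < expo m i p -> std (mmul m (pvar i p)).
Proof.
move=> /stdP h hp; apply/stdP=> j k jk; rewrite !expo_mmul !expo_pvar => h1 h2.
apply: (h j k jk).
  by move: h1; case: eqP => [->|] /=; [case: eqP => [<-|]|]; rewrite ?addn0.
by move: h2; case: eqP => [->|] /=; [case: eqP => [<-|]|]; rewrite ?addn0.
Qed.

(** A standard monomial divisible by [y_i] grows from its quotient by [y_i], one without [y_i] from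
    its quotient by [x_i], unless exchanging one [x_i] for [y_i] keeps it standard; then only
    [gen_pt] is left. *)
Lemma stdl_incr_deg_sub u i : {subset stdl (incr_deg u i) <= gen_pt u i :: [seq grow i m | m <- stdl u]}.
Proof.
move=> m; rewrite mem_stdl inE => /andP[sm /eqP dm].
case: (boolP (0 < expo m i false)) => [h|].
  apply/orP; right; apply/mapP; exists (mquo m (pvar i false)).
    rewrite mem_stdl; apply/andP; split.
      by apply: std_dvd sm _; apply/mdvdP=> j p; rewrite expo_mquo leq_subr.
    apply/eqP/ffunP=> j; have /ffunP/(_ j) := dm; rewrite !mdegE !expo_mquo !expo_pvar ffunE.
    by move: h; case: eqP => [->|] /=; lia.
  have dv : mdvd (pvar i false) m.
    by apply/mdvdP=> j p; rewrite expo_pvar; case: eqP => [->|] //=; case: p.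
  by rewrite /grow mquoK // sm.
rewrite -eqn0Ngt => /eqP h0.
have h1 : expo m i true = (u i).+1.
  by have /ffunP/(_ i) := dm; rewrite mdegE h0 ffunE eqxx; lia.
have dv : mdvd (pvar i true) m.
  by apply/mdvdP=> j p; rewrite expo_pvar; case: eqP => [->|] //=; case: p; rewrite //= h1.
pose m0 := mquo m (pvar i true).
have m0E : mmul m0 (pvar i true) = m by rewrite mquoK.
case: (boolP (std (mmul m0 (pvar i false)))) => s0; last first.
  apply/orP; right; apply/mapP; exists m0; last by rewrite /grow (negbTE s0).
  rewrite mem_stdl; apply/andP; split.
    by apply: std_dvd sm _; rewrite -m0E mdvd_mmulr.
  apply/eqP/ffunP=> j; have /ffunP/(_ j) := dm; rewrite -{1}m0E mdeg_mmul mdeg_pvar !ffunE.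
  exact: addIn.
apply/orP; left; apply/eqP; apply: monP => j p; rewrite expo_gen_pt.
case: eqP => [->|/eqP ji]; first by case: p.
have hz : expo m j (b i j) = 0.
  apply/eqP; rewrite eqn0Ngt; apply/negP=> hj.
  have hj' q : 0 < expo (mmul m0 (pvar i q)) j (b i j).
    by move: hj; rewrite -m0E !expo_mmul !expo_pvar (negbTE ji).
  have sq q : std (mmul m0 (pvar i q)) by case: q; rewrite ?m0E.
  (* The product by the variable of sign [b j i] contains [z_ji] and is standard, so [z_ij] cannot
     occur in [m]. *)
  have := sq (b j i) => /stdP/(_ i j); rewrite eq_sym ji hj' expo_mmul expo_pvar !eqxx addn1.
  by apply.
case: eqP => [-> //|/eqP pb].
have /ffunP/(_ j) := dm; rewrite (mdegEp m j p) ffunE (negbTE ji) addn0 => <-.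
by move: hz; case: p pb; case: (b i j) => //= _ ->; rewrite addn0.
Qed.

Lemma size_stdl0 : size (stdl [ffun => 0]) = 1.
Proof.
suff : perm_eq (stdl [ffun => 0]) [:: mone n] by move/perm_size.
apply: uniq_perm; rewrite ?stdl_uniq // => m; rewrite mem_stdl inE.
apply/andP/eqP => [[_ /eqP/ffunP d] | ->].
  apply: monP => j p; rewrite expo_mone; have := d j; rewrite (mdegEp m j p) ffunE; lia.
split; first by apply/stdP=> i j _; rewrite expo_mone.
by apply/eqP/ffunP=> j; rewrite mdegE !expo_mone !ffunE.
Qed.

Lemma sum_incr_deg u i : \sum_j incr_deg u i j = (\sum_j u j).+1.
Proof.
under eq_bigr => j _ do rewrite ffunE.
rewrite big_split /= -addn1; congr addn.
rewrite (bigD1 i) //= eqxx big1 // => j /negbTE -> //.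
Qed.

Lemma mdeg_ind (P : {ffun 'I_n -> nat} -> Prop) :
  P [ffun => 0] -> (forall u i, P u -> P (incr_deg u i)) -> forall u, P u.
Proof.
move=> P0 PS u; move: {2}(\sum_j u j) (erefl (\sum_j u j)) => d.
elim: d u => [|d IH] u.
  move/eqP; rewrite sum_nat_eq0 => /forallP h; suff -> : u = [ffun => 0] by [].
  by apply/ffunP=> j; rewrite ffunE; apply/eqP; exact: (h j).
move=> e; have /existsP[i hi] : [exists i, 0 < u i].
  apply: contraPT e; rewrite negb_exists => /forallP h.
  by rewrite big1 // => j _; apply/eqP; rewrite eqn0Ngt.
pose v : {ffun 'I_n -> nat} := [ffun j => u j - (j == i)].
have uE : u = incr_deg v i.
  by apply/ffunP=> j; rewrite !ffunE subnK //; case: eqP => [->|].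
by rewrite uE; apply/PS/IH; move: e; rewrite uE sum_incr_deg; case.
Qed.

Lemma size_stdl_le u : size (stdl u) <= (\sum_j u j).+1.
Proof.
elim/mdeg_ind: u => [|u i IH]; first by rewrite size_stdl0.
rewrite sum_incr_deg; apply: leq_trans (uniq_leq_size (stdl_uniq _) (@stdl_incr_deg_sub u i)) _.
by rewrite /= size_map ltnS.
Qed.

Lemma std_gen_pt u i : tree_sys -> std (gen_pt u i).
Proof.
move=> C; apply/stdP=> j k jk; rewrite !expo_gen_pt.
have [ki|ki] := eqVneq k i; have [ji|ji] := eqVneq j i.
- by rewrite ki ji eqxx in jk.
- by rewrite ki eqxx.
- by rewrite ji eqxx.
move: (C i k j); rewrite !(eq_sym i) ki ji eq_sym jk => /(_ isT isT isT).
by rewrite ![b i _ == _]eq_sym => /orP[] ->.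
Qed.

(** If neither [x_i] nor [y_i] can be added, each is blocked by a variable of [m], belonging to
    edges [j] and [j'] on opposite sides of [i]. Then [tree_sys] identifies these variables as
    [z_j'j] and [z_jj'], whose product divides no standard monomial. *)
Lemma tree_sys_grow m i : tree_sys -> std m -> std (grow i m).
Proof.
move=> C sm; rewrite /grow; case: ifP => // /negbT.
move=> nf; apply/stdP => j k jk h1 h2; case/negP: nf; apply/stdP => j' k' jk' h1' h2'.
move: h1 h2 h1' h2'; rewrite !expo_mmul !expo_pvar.
wlog ki : j k jk / k = i.
  move=> H h1 h2; case: (eqVneq k i) => [ki|ki]; first exact: (H j k).
  case: (eqVneq j i) => [ji|ji].
    by apply: (H k j _ ji h2 h1); rewrite eq_sym.
  by have := stdP _ sm j k jk; rewrite (negbTE ki) (negbTE ji) !addn0 in h1 h2; move/(_ h1 h2).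
wlog ki' : j' k' jk' / k' = i.
  move=> H h1 h2 h1' h2'; case: (eqVneq k' i) => [ki'|ki']; first exact: (H j' k').
  case: (eqVneq j' i) => [ji|ji].
    by apply: (H k' j' _ ji h1 h2 h2' h1'); rewrite eq_sym.
  by have := stdP _ sm j' k' jk'; rewrite (negbTE ki') (negbTE ji) !addn0 in h1' h2'; move/(_ h1' h2').
subst k k'; rewrite eqxx (negbTE jk) (negbTE jk') !addn0 /= => h1 h2 h1' h2'.
have bj : b j i = true.
  case e : (b j i) h1 => // h1; case: (stdP _ sm j i jk); rewrite ?e //.
  by move: h1; rewrite /= addn0.
have bj' : b j' i = false.
  case e : (b j' i) h1' => // h1'; case: (stdP _ sm j' i jk'); rewrite ?e //.
  by move: h1'; rewrite /= addn0.
have jj : j != j' by apply/eqP=> e; rewrite e bj' in bj.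
have := C j i j' jk jj; rewrite eq_sym jk' bj bj' /= => /(_ isT) /eqP e1.
have := C j' i j jk'; rewrite eq_sym jj eq_sym jk bj bj' /= => /(_ isT isT) /eqP e2.
by apply: (stdP _ sm j j' jj); rewrite ?e1 ?e2.
Qed.

Lemma size_stdl u : tree_sys -> size (stdl u) = (\sum_j u j).+1.
Proof.
move=> C; elim/mdeg_ind: u => [|u i IH]; first by rewrite size_stdl0 big1 // => j; rewrite ffunE.
suff /perm_size : perm_eq (stdl (incr_deg u i)) (gen_pt u i :: [seq grow i m | m <- stdl u]).
  by rewrite /= size_map IH sum_incr_deg.
have std_grow m : std m -> 0 < expo m i false -> grow i m = mmul m (pvar i false).
  by move=> sm h; rewrite /grow std_mulvar.
apply: uniq_perm; rewrite ?stdl_uniq //=.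
  apply/andP; split.
    (* [gen_pt] has no [y_i], so it could only be [m x_i]; but it contains no [z_ij], so by
       [tree_sys] the monomial [m y_i] would be standard too and [grow] would have chosen it. *)
    apply/mapP=> -[m]; rewrite mem_stdl => /andP[sm /eqP dm].
    rewrite /grow; case: ifP => [_|/negP h] e.
      by have := expo_mmul m (pvar i false) i false; rewrite -e expo_gen_pt expo_pvar !eqxx; lia.
    apply: h; have -> : mmul m (pvar i false) = mmul (mquo (gen_pt u i) (pvar i true)) (pvar i false).
      by rewrite e mmulK.
    apply/stdP=> j k jk; rewrite !expo_mmul !expo_mquo !expo_pvar !expo_gen_pt.
    case: (eqVneq k i) => [ki|ki]; case: (eqVneq j i) => [ji|ji] /=.
    - by rewrite ki ji eqxx in jk.
    - by rewrite ki eqxx.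
    - by rewrite ji eqxx.
    rewrite !subn0 !addn0.
    move: (C i k j); rewrite !(eq_sym i) ki ji eq_sym jk => /(_ isT isT isT).
    by rewrite ![b i _ == _]eq_sym => /orP[] ->.
  rewrite map_inj_in_uniq ?stdl_uniq // => m m'; rewrite !mem_stdl.
  move=> /andP[sm _] /andP[sm' _].
  have inj q : mmul m (pvar i q) = mmul m' (pvar i q) -> m = m'.
    by move=> e; rewrite -(mmulK (pvar i q) m) e mmulK.
  rewrite {1}/grow; case: ifP => h.
    rewrite /grow; case: ifP => h'; first exact: inj.
    (* Mixed case: [m y_i = m' x_i] puts a [y_i] into [m'], so [m' y_i] is standard as well. *)
    move=> e; case/negP: h'; apply: std_mulvar => //.
    have := expo_mmul m (pvar i false) i false; rewrite e expo_mmul !expo_pvar !eqxx /=; lia.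
  rewrite /grow; case: ifP => h'; last exact: inj.
  move=> e; case/negP: h; apply: std_mulvar => //.
  have := expo_mmul m (pvar i true) i false; rewrite e expo_mmul !expo_pvar !eqxx /=; lia.
move=> m; apply/idP/idP => [/stdl_incr_deg_sub //|]; rewrite inE => /orP[/eqP ->|].
  rewrite mem_stdl std_gen_pt //=; apply/eqP/ffunP=> j.
  rewrite mdegE !expo_gen_pt ffunE; case: eqP => [->|_]; first by rewrite addn0 addn1.
  by case: (b i j); rewrite /= ?addn0.
case/mapP=> m0; rewrite mem_stdl => /andP[sm /eqP dm] ->.
rewrite mem_stdl tree_sys_grow //=; apply/eqP; rewrite /grow.
by case: ifP => _; apply: mdeg_incr_deg.
Qed.

(** If some [gen_pt] were not standard, only grown monomials would be left and the count would not
    rise. *)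
Lemma tree_sys_of_size : (forall u, size (stdl u) = (\sum_j u j).+1) -> tree_sys.
Proof.
move=> H.
have sg u i : std (gen_pt u i).
  apply: contraT => ns; have : size (stdl (incr_deg u i)) <= size (stdl u).
    rewrite -(size_map (grow i) (stdl u)); apply: uniq_leq_size; first exact: stdl_uniq.
    move=> m ms; have := stdl_incr_deg_sub ms; rewrite inE => /orP[/eqP e|//].
    by move: ms; rewrite e mem_stdl (negbTE ns).
  by rewrite !H sum_incr_deg ltnn.
(* Degree [e_j + e_k] suffices: there [gen_pt] has the variables of signs opposite to [b i j] and
   [b i k], and its standardness is the condition on [i], [j], [k]. *)
move=> i j k ij ik jk; have := sg [ffun l => (l == j) || (l == k) : nat] i.
move/stdP/(_ j k jk); rewrite !expo_gen_pt ![_ == i]eq_sym (negbTE ij) (negbTE ik) !ffunE !eqxx !orbT /=.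
rewrite ![b _ _ == b i _]eq_sym.
by case: (b i k == b j k); case: (b i j == b k j) => // /(_ isT isT).
Qed.

End Std.

Section Generators.
Variable n : nat.
Implicit Types (b : 'I_n -> 'I_n -> bool) (i j k l : 'I_n) (p q : bool).

Lemma nstd_qgen b i j : i != j -> ~~ std b (qgen b i j).
Proof.
move=> ij; apply/negP=> /stdP/(_ i j ij).
have : mdvd (qgen b i j) (qgen b i j) by exact: mdvdm.
by rewrite qgen_dvd // => /andP[h1 h2] /(_ h1 h2).
Qed.

Lemma nstd_pair b i j p q : i != j -> ~~ std b (mmul (pvar j p) (pvar i q)) ->
  p = b i j /\ q = b j i.
Proof.
move=> ij /nstdP[k [l [kl]]]; have ne : k != l by rewrite -val_eqE; case: ltngtP kl.
have ji : j != i by rewrite eq_sym.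
rewrite qgen_dvd // !expo_mmul !expo_pvar.
have [kj|kj] := eqVneq k j; have [lj|lj] := eqVneq l j; rewrite ?andbF //=.
- by move: ne; rewrite kj lj eqxx.
- have [li|li] := eqVneq l i => //; rewrite kj li (negbTE ji) /= !add0n addn0.
  by rewrite !lt0b => /andP[/eqP ? /eqP].
- have [ki|ki] := eqVneq k i => //; rewrite ?andbF // ki lj (negbTE ji) /= addn0.
  by rewrite !lt0b => /andP[/eqP ? /eqP].
- have [ki|ki] := eqVneq k i; have [li|li] := eqVneq l i; rewrite ?andbF //=.
  by move: ne; rewrite ki li eqxx.
Qed.

End Generators.

Lemma eq_std n (b b' : 'I_n -> 'I_n -> bool) m :
  (forall i j, i != j -> b i j = b' i j) -> std b m = std b' m.
Proof.
move=> E; apply: eq_forallb => i; apply: eq_forallb => j.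
by case: eqVneq => //= ij; rewrite !E // eq_sym.
Qed.

(** * Monomial ideals given by tree systems *)

Section SysIdeal.
Variables (K : closedFieldType) (n : nat).
Implicit Types (b : 'I_n -> 'I_n -> bool).

Definition sys_ideal b : pol K n -> Prop := monoI (fun m => ~~ std b m).

Lemma sys_ideal_monomial b : monomial_ideal (sys_ideal b).
Proof. exact: monomial_monoI (@nstd_up _ b). Qed.

Lemma sys_ideal_in_H b : tree_sys b -> in_H (sys_ideal b).
Proof.
move=> C; split; first exact: monoI_homog (@nstd_up _ b).
move=> u; rewrite -(size_stdl u C).
have hom := monoI_homog K (@nstd_up _ b).
apply: quot_dim_basis.
- exact: stdl_uniq.
- by move=> m; rewrite mem_stdl => /andP[_ /eqP].
- move=> f [_ h] hs m; apply/eqP; apply: contraT => nz.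
  by have := h _ nz; have := hs _ nz; rewrite mem_stdl => /andP[-> _].
- move=> f pf hf; exists (fun m => if std b m then f m else 0%R).
    move=> m; case: ifP => [sm nz|]; last by rewrite eqxx.
    by rewrite mem_stdl sm; apply/eqP/hf.
  split=> [|m]; rewrite /psub.
    by case: pf => s hs; exists s => m; case: ifP => _ h; apply: hs; move: h;
      rewrite ?subrr ?eqxx ?subr0.
  by case: ifP => //; rewrite subrr eqxx.
Qed.

(** In degree [e_i + e_j] there are four monomials but the quotient has dimension 3, so one of them
    lies in the ideal. The quadrics so chosen leave at most the prescribed number of standard
    monomials; hence they generate the whole ideal, and the equality of counts gives [tree_sys]. *)
Lemma in_H_sys_ideal (I : pol K n -> Prop) : in_H I -> monomial_ideal I ->
  exists2 b, tree_sys b & I = sys_ideal b.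
Proof.
move=> [_ hd] /monomialP[U hU eI]; subst I.
have cnt u : size [seq m <- mons u | `[< ~ U m >]] = (\sum_j u j).+1.
  apply: quot_dim_mono (hd u); first by rewrite filter_uniq ?mons_uniq.
  move=> m; rewrite mem_filter mem_mons; split=> [/andP[/asboolP h /eqP ->] //|].
  by case=> -> h; rewrite eqxx andbT; apply/asboolP.
pose P (i j : 'I_n) (pq : bool * bool) := i != j -> U (mmul (pvar j pq.1) (pvar i pq.2)).
have exE (ij : 'I_n * 'I_n) : exists pq, P ij.1 ij.2 pq.
  case: ij => i j; rewrite /P /=; apply: contrapT => nh.
  have [ij nU] : i != j /\ forall p q, ~ U (mmul (pvar j p) (pvar i q)).
    have ij : i != j by apply: contrapT => h; apply: nh; exists (true, true).
    by split=> // p q h; apply: nh; exists (p, q).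
  pose u : {ffun 'I_n -> nat} := [ffun l => (l == i) + (l == j)].
  pose L := [seq mmul (pvar j pq.1) (pvar i pq.2) | pq <- enum {: bool * bool}].
  have uL : uniq L.
    have ji : j != i by rewrite eq_sym.
    rewrite map_inj_uniq ?enum_uniq // => -[p q] [p' q'] /= e.
    move: (congr1 (fun m => expo m j p) e) (congr1 (fun m => expo m i q) e); clear e.
    rewrite /= !expo_mmul !expo_pvar !eqxx (negbTE ij) (negbTE ji) /=.
    by case: p p' => -[]; case: q q' => -[].
  have : size L <= size [seq m <- mons u | `[< ~ U m >]].
    apply: uniq_leq_size => // m /mapP[[p q] _ ->] /=; rewrite mem_filter mem_mons.
    apply/andP; split; first by apply/asboolP.
    by rewrite mdeg_mmul !mdeg_pvar; apply/eqP/ffunP=> l; rewrite !ffunE addnC.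
  rewrite cnt size_map -cardE card_prod card_bool.
  under eq_bigr => l _ do rewrite ffunE.
  have one (k : 'I_n) : \sum_l (l == k : nat) = 1.
    by rewrite (bigD1 k) //= eqxx big1 // => l /negbTE ->.
  by rewrite big_split /= !one.
have [F hF] := choice exE.
(* Only the choices for [i < j] are used, so that [b i j] and [b j i] come from the same
   monomial. *)
pose b (i j : 'I_n) := if (i < j) then (F (i, j)).1 else (F (j, i)).2.
have nU m : ~~ std b m -> U m.
  move/nstdP=> [i [j [ij d]]]; apply: hU d.
  have := hF (i, j); rewrite /P /= /qgen /b ij ltnNge (ltnW ij) /=; apply.
  by rewrite -val_eqE; case: ltngtP ij.
have subs u : {subset [seq m <- mons u | `[< ~ U m >]] <= stdl b u}.
  move=> m; rewrite mem_filter mem_mons mem_stdl => /andP[/asboolP h ->].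
  by rewrite andbT; apply: contraT => /nU.
have us u : uniq [seq m <- mons u | `[< ~ U m >]] by rewrite filter_uniq ?mons_uniq.
have szle u : size (stdl b u) <= size [seq m <- mons u | `[< ~ U m >]].
  by rewrite cnt size_stdl_le.
have eqs u := uniq_min_size (us u) (@subs u) (szle u).
have C : tree_sys b by apply: tree_sys_of_size => u; case: (eqs u) => <- _; rewrite cnt.
exists b => //; congr monoI; apply: funext => m; apply: propext; split; last exact: nU.
move=> Um; apply/negP=> sm.
have : m \in stdl b (mdeg m) by rewrite mem_stdl sm eqxx.
by case: (eqs (mdeg m)) => _ <-; rewrite mem_filter => /andP[/asboolP].
Qed.

Lemma sys_ideal_inj b b' : sys_ideal b = sys_ideal b' -> forall i j, i != j -> b i j = b' i j.
Proof.
move=> e i j ij; have h := monoI_inj ((same_idealP _ _).2 e).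
by have /nstd_pair[] := (h _).1 (nstd_qgen b ij).
Qed.

Lemma sys_ideal_eq b b' : (forall i j, i != j -> b i j = b' i j) -> sys_ideal b = sys_ideal b'.
Proof. by move=> E; congr monoI; apply: funext => m; rewrite (eq_std _ E). Qed.

End SysIdeal.

Arguments sys_ideal K {n} b.

(** * Tree systems and trees *)

Section Vertices.
Variables (n : nat) (b : 'I_n -> 'I_n -> bool).
Implicit Types (i j k : 'I_n) (s : {ffun 'I_n -> bool}).

(* A vertex is encoded by the side of every edge it lies on ([true]: the tail side). *)
Definition vtx s := [forall i, forall j, (i != j) ==> (s i == b j i) || (s j == b i j)].

Lemma vtxP s : reflect (forall i j, i != j -> (s i == b j i) || (s j == b i j)) (vtx s).
Proof.
apply: (iffP forallP) => [h i j ij | h i].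
  by have /forallP/(_ j)/implyP/(_ ij) := h i.
by apply/forallP=> j; apply/implyP; exact: h.
Qed.

(** The end of edge [i] on its side [p]: relative to every other edge it lies where [i] lies. *)
Definition eend i p : {ffun 'I_n -> bool} := [ffun j => if j == i then p else b i j].

Lemma eendE i p j : eend i p j = if j == i then p else b i j.
Proof. by rewrite ffunE. Qed.

Hypothesis C : tree_sys b.

Lemma eend_vtx i p : vtx (eend i p).
Proof.
apply/vtxP=> j k jk; rewrite !eendE.
have [ji|ji] := eqVneq j i; first by rewrite -ji (eq_sym k) (negbTE jk) eqxx orbT.
have [ki|ki] := eqVneq k i; first by rewrite ki eqxx.
by move: (@C i k j); rewrite !(eq_sym i) ki ji eq_sym jk orbC; apply.
Qed.

(** Edge [j] contributes the variable of sign opposite to [s j]; this turns [vtx] into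
    standardness. *)
Definition vmon s : mon n := ([ffun j => (~~ s j : nat)], [ffun j => (s j : nat)]).

Lemma expo_vmon s j p : expo (vmon s) j p = (p != s j).
Proof. by rewrite /expo /vmon; case: p; rewrite /= ffunE //; case: (s j). Qed.

Lemma std_vmon s : std b (vmon s) = vtx s.
Proof.
apply: eq_forallb => i; apply: eq_forallb => j; case: eqVneq => //= _.
by rewrite !expo_vmon !lt0b negb_and !negbK orbC ![s _ == _]eq_sym.
Qed.

Lemma card_vtx : #|[set s | vtx s]| = n.+1.
Proof.
have <- : size (stdl b [ffun => 1]) = n.+1.
  rewrite size_stdl //; under eq_bigr => j _ do rewrite ffunE.
  by rewrite sum1_card card_ord.
rewrite cardE -(size_map vmon); apply: perm_size; apply: uniq_perm.
- rewrite map_inj_uniq ?enum_uniq // => s s' e; apply/ffunP=> j.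
  have := congr1 (fun m => expo m j true) e; rewrite /= !expo_vmon.
  by case: (s j); case: (s' j).
- exact: stdl_uniq.
move=> m; rewrite mem_stdl; apply/mapP/andP => [[s] | [sm /eqP/ffunP d]].
  rewrite mem_enum inE => vs ->; split; first by rewrite std_vmon.
  by apply/eqP/ffunP=> j; rewrite mdegE !expo_vmon ffunE; case: (s j).
pose s : {ffun 'I_n -> bool} := [ffun j => 0 < expo m j false].
have mE : m = vmon s.
  apply: monP => j p; rewrite expo_vmon /s ffunE; have := d j; rewrite mdegE ffunE.
  by case: p; case: (expo m j true) => [|[|?]]; case: (expo m j false) => [|[|?]].
by exists s => //; rewrite mem_enum inE -std_vmon -mE.
Qed.

(* [d j p] says that the variable [z_j] of sign [p] is present; [sep d i] are the edges
   [j] for which it is the sign forbidden on the component of edge [i]. *)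
Definition sep (d : 'I_n -> bool -> bool) i := [set j | (j != i) && d j (b i j)].

Section Separation.
Variable d : 'I_n -> bool -> bool.
Hypothesis hd : forall i j, i != j -> d j (b i j) -> d i (b j i) -> False.

(** If the sign at [k] is forbidden from [j] but not from [i], then [tree_sys] gives
    [b i j = b k j], and the signs present at [j] and [k] are forbidden from each other, against
    [hd]. *)
Lemma sep_trans i j : j \in sep d i -> sep d j \proper sep d i.
Proof.
rewrite inE => /andP[ji sj]; apply/properP; split; last first.
  by exists j; rewrite inE ?eqxx // ji.
apply/subsetP=> k; rewrite !inE => /andP[kj sk].
have ki : k != i by apply/eqP=> e; rewrite e in sk; exact: (hd ji sk sj).
rewrite ki; have := @C i j k; rewrite !(eq_sym i) ji ki eq_sym kj => /(_ isT isT isT).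
case/orP=> /eqP e; last by rewrite e.
by rewrite e in sj; case: (hd kj sj sk).
Qed.

(** Passing to a member of [sep d i] shrinks the set, so the descent stops. With [off s] it finds an
    edge at the vertex [s]; with the support of a standard monomial it finds a component of the
    curve. *)
Lemma sep_min i : exists2 j, sep d j = set0 & (j == i) || (j \in sep d i).
Proof.
have [k] := ubnP #|sep d i|; elim: k i => // k IH i; rewrite ltnS => le.
have [e|[j ji]] := set_0Vmem (sep d i); first by exists i; rewrite ?eqxx.
have pr := sep_trans ji; have [|l l0 lj] := IH j.
  by apply: leq_trans le; exact: proper_card.
exists l => //; case/orP: lj => [/eqP ->|lj]; first by rewrite ji orbT.
by rewrite (subsetP (proper_sub pr)) ?orbT.
Qed.

End Separation.

Definition off s j p := s j != p.

Lemma vtx_off s : vtx s -> forall i j, i != j -> off s j (b i j) -> off s i (b j i) -> False.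
Proof.
move=> vs i j ij /negbTE h1 /negbTE h2.
by have := vtxP _ vs i j ij; rewrite h1 h2.
Qed.

Lemma sep0_eend s i : sep (off s) i = set0 -> s = eend i (s i).
Proof.
move/setP=> h; apply/ffunP=> j; rewrite eendE; case: eqVneq => [-> //|ji].
by have := h j; rewrite !inE ji /= => /negbFE/eqP.
Qed.

(* Among the edges separating [s] from [s'], one that no other edge separates from [s] has [s] as
   an endpoint. *)
Lemma vtx_ind s s' (P : {ffun 'I_n -> bool} -> Prop) : vtx s -> vtx s' -> P s ->
  (forall i p, s i != s' i -> P (eend i p) -> P (eend i (~~ p))) -> P s'.
Proof.
move=> + vs'; have [k] := ubnP #|[set i | s i != s' i]|.
elim: k s => // k IH s; rewrite ltnS => le vs Ps step.
have [e|[i0 Di0]] := set_0Vmem [set i | s i != s' i].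
  suff <- : s = s' by [].
  apply/ffunP=> i; move/setP/(_ i): e; rewrite !inE; by move/negbFE/eqP.
have [i i0_ ii0] := sep_min (vtx_off vs) i0.
have Di : s i != s' i.
  case/orP: ii0 => [/eqP ->|]; first by rewrite inE in Di0.
  rewrite inE => /andP[ne si]; apply/negP=> /eqP e; rewrite inE in Di0.
  have := vtxP _ vs' _ _ ne; rewrite -e (negbTE si) /= => /eqP e0.
  by have := vtxP _ vs _ _ ne; rewrite (negbTE si) /= -e0 (negbTE Di0).
have sE := sep0_eend i0_.
apply: (IH (eend i (~~ s i))).
- apply: leq_trans le; apply: proper_card; apply/properP; split; last first.
    exists i; rewrite inE // eendE eqxx.
    by move: Di; case: (s i); case: (s' i).
  apply/subsetP=> j; rewrite !inE eendE; have [-> _ //|ji] := eqVneq j i.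
  by rewrite {1}sE eendE (negbTE ji).
- exact: eend_vtx.
- by apply: step => //; rewrite -sE.
move=> j p Dj; apply: step; move: Dj; rewrite eendE.
have [-> _ //|ji] := eqVneq j i.
by rewrite {1}sE eendE (negbTE ji).
Qed.

End Vertices.

Lemma connect_inv (T : finType) (r : rel T) (P : T -> Prop) x y :
  (forall x y, r x y -> P x -> P y) -> connect r x y -> P x -> P y.
Proof.
move=> h /connectP[p]; elim: p x => [|z p IH] x /=; first by move=> _ ->.
by case/andP=> xz pz e Px; apply: IH pz e _; apply: h xz Px.
Qed.

(** * Sides of the edges of a directed tree *)

Section Trees.
Variable n : nat.
Implicit Types (e : dgraph n) (i j k : 'I_n) (v w : 'I_n.+1).

Lemma adj_sym e (k : option _) : symmetric (adj_wo e k).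
Proof.
move=> v w; rewrite /adj_wo; apply: eq_existsb => j.
by rewrite [(e j == (v, w)) || _]orbC.
Qed.

Lemma conn_sym e (k : option _) : connect_sym (adj_wo e k).
Proof. exact: sym_connect_sym (@adj_sym e k). Qed.

Lemma adjP e (k : option _) v w : reflect (exists2 j, Some j != k & e j = (v, w) \/ e j = (w, v)) (adj_wo e k v w).
Proof.
apply: (iffP existsP) => [[j /andP[jk /orP h]] | [j jk h]]; exists j => //.
  by case: h => /eqP; [left | right].
by rewrite jk; apply/orP; case: h => ->; [left | right].
Qed.

Definition side e j v := connect (adj_wo e (Some j)) (e j).1 v.
Definition tsys e i j := side e j (e i).1.

Lemma adj_edge e (k : option _) j : Some j != k -> adj_wo e k (e j).1 (e j).2.
Proof. by move=> jk; apply/adjP; exists j => //; left; case: (e j). Qed.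

Lemma side_cross e i j : i != j -> side e j (e i).1 = side e j (e i).2.
Proof.
move=> ij; have a : adj_wo e (Some j) (e i).1 (e i).2 by apply: adj_edge.
apply/idP/idP=> h; apply: connect_trans h (connect1 _) => //.
by rewrite adj_sym.
Qed.

Definition connected_graph e := forall v, connect (adj_wo e None) ord0 v.

Lemma conn_all e v w : connected_graph e -> connect (adj_wo e None) v w.
Proof. by move=> h; apply: connect_trans (h w); rewrite conn_sym. Qed.

(* Exploring from [ord0], each new vertex uses up a new edge. *)
Lemma disconnect e j : ~ (forall v, connect (adj_wo e (Some j)) ord0 v).
Proof.
move=> conn.
pose inner (B : {set 'I_n.+1}) := [set i | (i != j) && ((e i).1 \in B) && ((e i).2 \in B)].
have grow (k : nat) : k <= n -> exists B : {set 'I_n.+1}, [/\ ord0 \in B, #|B| = k.+1 & k <= #|inner B|].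
  elim: k => [_|k IH kn]; first by exists [set ord0]; rewrite inE eqxx cards1.
  have [B [B0 cB kB]] := IH (ltnW kn).
  have [x [y [xB yB axy]]] : exists x y, [/\ x \in B, y \notin B & adj_wo e (Some j) x y].
    (* Otherwise [B] would be closed under adjacency, hence everything, but it has only k + 1 <= n
       of the n + 1 vertices. *)
    apply: contrapT => no.
    have BT : B = setT.
      apply/setP=> y; rewrite inE; apply: (connect_inv (P := fun z => is_true (z \in B)) _ (conn y) B0) => x z xz xB.
      by apply: contrapT => zB; apply: no; exists x, z; split=> //; apply/negP.
    by move: cB; rewrite BT cardsT card_ord => -[]; lia.
  exists (y |: B); split; first by rewrite inE B0 orbT.
    by rewrite cardsU1 yB cB.
  case/adjP: axy => i ij ei; have {}ij : i != j by apply: contraNneq ij => ->.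
  apply: leq_trans (_ : #|i |: inner B| <= _).
    rewrite cardsU1; have -> : i \notin inner B.
      by rewrite inE ij /=; case: ei => -> /=; rewrite (negbTE yB) ?andbF.
    by [].
  apply: subset_leq_card; apply/subsetP=> l; rewrite !inE => /orP[/eqP ->|].
    by rewrite ij; case: ei => -> /=; rewrite eqxx xB ?orbT.
  by case/andP=> /andP[-> ->] ->; rewrite !orbT.
have [B [_ _ le]] := grow n (leqnn n).
suff : #|inner B| < n by lia.
rewrite -[X in _ < X]card_ord -cardsT; apply: proper_card; apply/properP.
by split; [exact: subsetT | exists j; rewrite ?inE ?eqxx].
Qed.

Lemma side_tail e j : side e j (e j).1.
Proof. exact: connect0. Qed.

Lemma side_head e j : connected_graph e -> side e j (e j).2 = false.
Proof.
move=> conn; apply/negP=> h; apply: (@disconnect e j) => v.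
apply: connect_sub (conn v) => x y /adjP[i _ ei].
have [ij|ij] := eqVneq i j.
  rewrite ij in ei; case: ei => ei; move: h; rewrite /side ei //=.
  by rewrite conn_sym.
by apply: connect1; apply/adjP; exists i.
Qed.

(** Local conditions that characterise [side], so that the sides in a modified graph can be found by
    guessing and checking. *)
Definition is_side e (t : 'I_n -> 'I_n.+1 -> bool) := forall j,
  [/\ t j (e j).1 = true, t j (e j).2 = false & forall i, i != j -> t j (e i).1 = t j (e i).2].

Lemma side_is_side e : connected_graph e -> is_side e (side e).
Proof.
by move=> conn j; split; [exact: side_tail | exact: side_head | move=> i; exact: side_cross].
Qed.

Lemma is_side_adj e t j v w : is_side e t -> adj_wo e (Some j) v w -> t j v = t j w.
Proof.
move=> st /adjP[i ij ei]; have [_ _ /(_ i)] := st j.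
have -> : i != j by apply: contraNneq ij => ->.
by move=> /(_ isT); case: ei => -> /=.
Qed.

(** Without [j] every vertex is still connected to the tail or to the head of [j], and [t j] is
    constant along the remaining edges. *)
Lemma side_uniq e t : connected_graph e -> is_side e t -> forall j v, side e j v = t j v.
Proof.
move=> conn st j v; have [t1 t2 _] := st j.
have inv x : connect (adj_wo e (Some j)) x v -> t j v = t j x.
  move=> c; apply: (connect_inv (P := fun y => t j y = t j x) _ c erefl) => y z yz <-.
  by rewrite (is_side_adj st yz).
apply/idP/idP => [/inv -> //|tv].
have : side e j v \/ connect (adj_wo e (Some j)) (e j).2 v.
  apply: (connect_inv (P := fun v => side e j v \/ connect (adj_wo e (Some j)) (e j).2 v) _
    (conn_all (e j).1 v conn)); last by left; exact: side_tail.
  move=> x y /adjP[i _ ei] hx; have [ij|ij] := eqVneq i j.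
    by rewrite -ij /side; case: ei => -> /=; [right | left]; exact: connect0.
  have xy : connect (adj_wo e (Some j)) x y by apply: connect1; apply/adjP; exists i.
  by case: hx => hx; [left | right]; apply: connect_trans hx xy.
by case=> // /inv; rewrite tv t2.
Qed.

Definition vec e v : {ffun 'I_n -> bool} := [ffun j => side e j v].

(** Walking along an edge other than [i] and [j] changes neither coordinate, and at an end of [i]
    the position relative to [j] is that of [i] itself. *)
Lemma vec_vtx e v : connected_graph e -> vtx (tsys e) (vec e v).
Proof.
move=> conn; apply/vtxP=> i j ij; rewrite !ffunE.
apply: (connect_inv (P := fun v => (side e i v == tsys e j i) || (side e j v == tsys e i j)) _
  (conn_all (e i).1 v conn)); last by apply/orP; right.
move=> x y /adjP[k _ ek].
have key w : (w == (e k).1) || (w == (e k).2) -> k != i -> side e i w = tsys e k i.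
  by move=> /orP[] /eqP -> ki; rewrite /tsys // -side_cross.
have key' w : (w == (e k).1) || (w == (e k).2) -> k != j -> side e j w = tsys e k j.
  by move=> /orP[] /eqP -> ki; rewrite /tsys // -side_cross.
have yk : (y == (e k).1) || (y == (e k).2) by case: ek => -> /=; rewrite eqxx ?orbT.
have xk : (x == (e k).1) || (x == (e k).2) by case: ek => -> /=; rewrite eqxx ?orbT.
have [ki|ki] := eqVneq k i.
  by rewrite (key' y yk) ki ?eqxx ?orbT.
have [kj|kj] := eqVneq k j.
  by rewrite (key y yk) kj ?eqxx // eq_sym.
by rewrite !key // !key'.
Qed.

Lemma vec_tail e i : vec e (e i).1 = eend (tsys e) i true.
Proof.
by apply/ffunP=> j; rewrite !ffunE; case: eqVneq => // ->; rewrite side_tail.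
Qed.

Lemma vec_head e i : connected_graph e -> vec e (e i).2 = eend (tsys e) i false.
Proof.
move=> conn; apply/ffunP=> j; rewrite !ffunE; case: eqVneq => [->|ji].
  exact: side_head.
by rewrite -side_cross // eq_sym.
Qed.

Lemma tsys_tree_sys e : connected_graph e -> tree_sys (tsys e).
Proof.
move=> conn i j k ij ik jk.
by have /vtxP/(_ j k jk) := vec_vtx (e i).1 conn; rewrite !ffunE.
Qed.

Lemma vec_onto e s : connected_graph e -> vtx (tsys e) s -> exists v, s = vec e v.
Proof.
move=> conn vs; apply: (vtx_ind (P := fun s => exists v, s = vec e v)
  (tsys_tree_sys conn) (vec_vtx ord0 conn) vs); first by exists ord0.
move=> i p _ _; exists (if p then (e i).2 else (e i).1).
by case: p; rewrite ?vec_head ?vec_tail.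
Qed.

(** The n + 1 vertices are mapped onto the n + 1 vectors satisfying [vtx]. *)
Lemma vec_inj e : connected_graph e -> injective (vec e).
Proof.
move=> conn; apply: in2T; apply/image_injP.
have -> : #|[seq vec e x | x in 'I_n.+1]| = #|[set s | vtx (tsys e) s]|.
  apply: eq_card => s; rewrite inE; apply/imageP/idP => [[v _ ->] | vs].
    exact: vec_vtx.
  by have [v ->] := vec_onto conn vs; exists v.
by rewrite card_vtx ?card_ord //; exact: tsys_tree_sys.
Qed.

Lemma tsys_iso e e' : connected_graph e -> connected_graph e' ->
  (forall i j, i != j -> tsys e i j = tsys e' i j) -> tree_iso e e'.
Proof.
move=> conn conn' E.
have Ee i p : eend (tsys e) i p = eend (tsys e') i p.
  by apply/ffunP=> j; rewrite !eendE; case: eqVneq => // ji; rewrite E // eq_sym.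
have vE s : vtx (tsys e) s = vtx (tsys e') s.
  apply: eq_forallb => i; apply: eq_forallb => j; case: eqVneq => //= ij.
  by rewrite !E // eq_sym.
have exE v : exists w, vec e' w = vec e v.
  have [|w ->] := @vec_onto e' (vec e v) conn'; last by exists w.
  by rewrite -vE vec_vtx.
have [s hs] := choice exE; exists s; split=> [v w svw | j].
  by apply: (vec_inj conn); rewrite -!hs svw.
have s1 : s (e j).1 = (e' j).1 by apply: (vec_inj conn'); rewrite hs !vec_tail Ee.
have s2 : s (e j).2 = (e' j).2 by apply: (vec_inj conn'); rewrite hs !vec_head ?Ee.
by rewrite s1 s2; case: (e' j).
Qed.

Lemma iso_tsys e e' : connected_graph e -> connected_graph e' -> tree_iso e e' ->
  tsys e =2 tsys e'.
Proof.
move=> conn conn' [s [sI se]] i j.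
have st : is_side e (fun j v => side e' j (s v)).
  move=> k; have [t1 t2 t3] := side_is_side conn' k; rewrite se /= in t1 t2.
  by split=> // l lk; have := t3 l lk; rewrite se.
by rewrite /tsys (side_uniq conn st) se.
Qed.

(** The vertices are the vectors satisfying [vtx], numbered by an enumeration, and edge [i] joins
    its two ends [eend b i]. Connectedness is [vtx_ind], and coordinate [j] of a vertex is its side
    of [j]. *)
Lemma exists_tree b : tree_sys b ->
  exists2 e : dgraph n, is_tree e & forall i j, i != j -> tsys e i j = b i j.
Proof.
move=> C; pose V := enum [set s | vtx b s].
have sV : size V = n.+1 by rewrite -cardE card_vtx.
pose phi (v : 'I_n.+1) := nth [ffun => false] V v.
pose psi s : 'I_n.+1 := inord (index s V).
have phiK v : psi (phi v) = v.
  by apply: val_inj; rewrite /= inordK ?index_uniq ?sV ?enum_uniq.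
have psiK s : vtx b s -> phi (psi s) = s.
  move=> vs; have sm : s \in V by rewrite mem_enum inE.
  by rewrite /phi /= inordK ?nth_index // -sV index_mem.
have vphi v : vtx b (phi v).
  by have : phi v \in V; [apply: mem_nth; rewrite sV | rewrite mem_enum inE].
pose e : dgraph n := fun i => (psi (eend b i true), psi (eend b i false)).
have pe i p : phi (psi (eend b i p)) = eend b i p by rewrite psiK ?eend_vtx.
have conn : connected_graph e.
  move=> v; rewrite -(phiK v).
  apply: (vtx_ind C (P := fun s => connect (adj_wo e None) ord0 (psi s)) (vphi ord0) (vphi v)).
    by rewrite phiK.
  move=> i p _ h; apply: connect_trans h (connect1 _); apply/adjP; exists i => //.
  by case: p; [left | right].
have st : is_side e (fun j v => phi v j).
  move=> j; rewrite /e /= !pe !eendE eqxx; split=> // i ij.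
  by rewrite !pe !eendE eq_sym (negbTE ij).
exists e.
  split=> // j; apply/eqP=> h; have := congr1 (fun v => phi v j) h.
  by rewrite /e /= !pe !eendE eqxx.
by move=> i j ij; rewrite /tsys (side_uniq conn st) /e /= pe eendE eq_sym (negbTE ij).
Qed.

End Trees.

Lemma I_T_sys_ideal (K : closedFieldType) n (e : dgraph n) : I_T K e = sys_ideal K (tsys e).
Proof.
have -> : @I_T K n e = gen (fun g => exists m,
    (exists i j : 'I_n, i < j /\ m = qgen (tsys e) i j) /\ g = mono K m).
  congr gen; apply: funext => g; apply: propext; split.
    by move=> [i [j [ij ->]]]; eexists; split; [exists i, j; split; [exact: ij | reflexivity] |].
  by move=> [_ [[i [j [ij ->]]] ->]]; exists i, j.
rewrite gen_mono; congr monoI; apply: funext => m; apply: propext; split.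
  by move=> [_ [i [j [ij ->]]] d]; apply/nstdP; exists i, j.
by move/nstdP=> [i [j [ij d]]]; exists (qgen (tsys e) i j) => //; exists i, j.
Qed.

(** * Counting tree systems *)

Section Acyclic.
Variable T : finType.
Implicit Types (A B Q S : {set T}) (f g h : {ffun T -> T}) (x y z : T).

(** No nonempty part of [A] is mapped into itself; as [A] is finite, this says that every orbit
    leaves [A]. *)
Definition acyclic A f := [forall B : {set T},
  (B \subset A) && (B != set0) ==> [exists x in B, f x \notin B]].

(* Rooted forests on the node set [A] with roots attached to [Q], as parent maps. *)
Definition forest_maps A Q := [set f : {ffun T -> T} |
  [forall x, if x \in A then f x \in A :|: Q else f x == x] && acyclic A f].

Lemma acyclicP A f : reflect (forall B, B \subset A -> B != set0 -> exists2 x, x \in B & f x \notin B)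
  (acyclic A f).
Proof.
apply: (iffP forallP) => [H B BA B0 | H B].
  by have /implyP := H B; rewrite BA B0 => /(_ isT)/exists_inP.
by apply/implyP=> /andP[BA B0]; apply/exists_inP; exact: H.
Qed.

Lemma forest_mapsP A Q f : reflect
  [/\ forall x, x \in A -> f x \in A :|: Q, forall x, x \notin A -> f x = x & acyclic A f]
  (f \in forest_maps A Q).
Proof.
rewrite inE; apply: (iffP andP) => [[/forallP h a] | [h1 h2 a]]; split=> //.
- by move=> x xA; have := h x; rewrite xA.
- by move=> x /negbTE xA; have := h x; rewrite xA => /eqP.
- by apply/forallP=> x; case: ifP => [/h1 //|/negbT/h2 ->].
Qed.

(** Arbitrary maps from [S] into [Q], not necessarily surjective; the identity outside [S] makes
    each of them a single element of the function type. *)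
Definition onto_maps S Q := [set g : {ffun T -> T} |
  g \in family (fun x => if x \in S then mem Q else mem (pred1 x))].

Lemma card_onto_maps S Q : #|onto_maps S Q| = #|Q| ^ #|S|.
Proof.
rewrite cardsE card_family foldrE big_map big_enum /=.
rewrite (eq_bigr (fun x => if x \in S then #|Q| else 1)); last first.
  by move=> x _; case: ifP => _ //; rewrite card1.
by rewrite -big_mkcond prod_nat_const.
Qed.

Definition root_set A Q f := [set x in A | f x \in Q].

(** A forest with root set [S] is an arbitrary attachment of [S] to [Q] together with a forest on
    the remaining nodes whose roots are attached to [S]. *)
Lemma card_root_fibre A Q S : [disjoint A & Q] -> S \subset A ->
  #|[set f in forest_maps A Q | root_set A Q f == S]| = #|Q| ^ #|S| * #|forest_maps (A :\: S) S|.
Proof.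
move=> dAQ SA; rewrite -card_onto_maps -cardsX.
have AnQ x : x \in A -> x \in Q = false by move=> xA; rewrite (disjointFr dAQ).
pose glue (gh : {ffun T -> T} * {ffun T -> T}) : {ffun T -> T} :=
  [ffun x => if x \in S then gh.1 x else gh.2 x].
have onP g : g \in onto_maps S Q ->
    (forall x, x \in S -> g x \in Q) /\ (forall x, x \notin S -> g x = x).
  rewrite inE => /familyP h; split=> x xS; have := h x; first by rewrite xS.
  by rewrite (negbTE xS) => /eqP.
rewrite -(@card_in_imset _ _ glue); last first.
  move=> [g h] [g' h']; rewrite !inE /= => /andP[gP hP] /andP[gP' hP'] /ffunP e.
  have {gP}[g1 g2] := onP g ltac:(by rewrite inE).
  have {gP'}[g1' g2'] := onP g' ltac:(by rewrite inE).
  have {hP}/forest_mapsP[_ h2 _] : h \in forest_maps (A :\: S) S by rewrite inE.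
  have {hP'}/forest_mapsP[_ h2' _] : h' \in forest_maps (A :\: S) S by rewrite inE.
  congr pair; apply/ffunP=> x; have := e x; rewrite !ffunE /=; case: (boolP (x \in S)) => xS //.
  - by rewrite g2 ?g2'.
  - by rewrite h2 ?h2' // inE xS.
apply: eq_card => f; apply/idP/imsetP => [|[[g h] ghX ->]].
  rewrite inE => /andP[/forest_mapsP[f1 f2 fa] /eqP fS].
  have inS x : x \in A -> (x \in S) = (f x \in Q) by rewrite -fS inE => ->.
  exists ([ffun x => if x \in S then f x else x], [ffun x => if x \in S then x else f x]); last first.
    by apply/ffunP=> x; rewrite /glue !ffunE /=; case: (x \in S).
  rewrite inE /=; apply/andP; split.
    rewrite inE; apply/familyP=> x; rewrite ffunE; case: ifP => xS; last by rewrite inE.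
    by rewrite -inS ?xS // (subsetP SA).
  apply/forest_mapsP; split=> [x|x|].
  - rewrite !inE ffunE => /andP[xS xA]; rewrite (negbTE xS).
    have := f1 x xA; rewrite inE -inS // (negbTE xS) orbF => ->; by case: (f x \in S).
  - rewrite !inE ffunE negb_and negbK; case: ifP => //= _ xA; exact: f2.
  apply/acyclicP=> B BA B0; have /acyclicP/(_ B) := fa.
  case=> //; first by apply: subset_trans BA _; exact: subsetDl.
  move=> x xB fx; exists x => //; rewrite ffunE; case: ifP => // xS.
  by have := subsetP BA x xB; rewrite inE xS.
move: ghX; rewrite in_setX => /andP[/onP[g1 g2] /forest_mapsP[h1 h2 ha]].
have gl x : glue (g, h) x = if x \in S then g x else h x by rewrite ffunE.
have hA x : x \in A -> x \notin S -> h x \in A.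
  move=> xA xS; have := h1 x; rewrite inE xS xA => /(_ isT); rewrite !inE.
  by case/orP=> [/andP[] //|/(subsetP SA)].
rewrite inE; apply/andP; split; last first.
  apply/eqP/setP=> x; rewrite inE gl; case: (boolP (x \in S)) => xS.
    by rewrite g1 // (subsetP SA).
  by apply/andP=> -[xA]; rewrite AnQ // hA.
apply/forest_mapsP; split=> [x xA|x xA|].
- by rewrite gl inE; case: ifP => xS; [rewrite g1 // orbT | rewrite hA // xS].
- have xS : x \notin S by apply: contra xA; exact: (subsetP SA).
  by rewrite gl (negbTE xS) h2 // inE negb_and xA orbT.
(* A set that meets [S] leaves [A] at such a point; otherwise acyclicity of [h] applies. *)
apply/acyclicP=> B BA B0; case: (set_0Vmem (B :&: S)) => [e|[x]]; last first.
  rewrite inE => /andP[xB xS]; exists x => //; rewrite gl xS.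
  by apply/negP=> gB; have := g1 x xS; rewrite AnQ // (subsetP BA).
have nS x : x \in B -> x \notin S.
  by move=> xB; have /setP/(_ x) := e; rewrite !inE xB => /= ->.
have /acyclicP/(_ B) := ha; case=> //.
  by apply/subsetP=> x xB; rewrite inE nS // (subsetP BA).
by move=> x xB hx; exists x; rewrite // gl (negbTE (nS x xB)).
Qed.

Lemma sum_powerset A (F : nat -> nat) :
  \sum_(S in powerset A) F #|S| = \sum_(s < #|A|.+1) 'C(#|A|, s) * F s.
Proof.
rewrite (partition_big (fun S => inord #|S| : 'I_#|A|.+1) predT) //=.
apply: eq_bigr => s _; rewrite -(cards_draws A) -sum_nat_const.
apply: eq_big => [S|S]; last first.
  by rewrite inE => /andP[SA /eqP <-]; rewrite inordK // ltnS subset_leq_card.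
rewrite !inE; case: (boolP (S \subset A)) => //= SA.
by rewrite -val_eqE /= inordK // ltnS subset_leq_card.
Qed.

(** Cayley's formula q (c + q)^(c - 1) for forests, c = |A| and q = |Q|, multiplied by c + q to
    cover c = 0. In the recursion over root sets [S], the nodes [A :\: S] and targets [S] together
    always number c. *)
Lemma card_forest_maps A Q : [disjoint A & Q] ->
  #|forest_maps A Q| * (#|A| + #|Q|) = #|Q| * (#|A| + #|Q|) ^ #|A|.
Proof.
have [k] := ubnP #|A|; elim: k A Q => // k IH A Q; rewrite ltnS => le dAQ.
have [A0|[a aA]] := set_0Vmem A.
  rewrite A0 cards0 add0n muln1 -[RHS]mul1n; congr muln.
  apply/eqP/cards1P; exists [ffun x => x]; apply/setP=> f; rewrite in_set1.
  apply/forest_mapsP/eqP => [[_ h _] | ->].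
    by apply/ffunP=> x; rewrite h ?ffunE // inE.
  split=> [x|x _|]; rewrite ?inE ?ffunE //.
  by apply/acyclicP=> B; rewrite subset0 => ->.
set c := #|A|; set q := #|Q|.
have c0 : 0 < c by apply/card_gt0P; exists a.
have fib S : S \subset A -> #|forest_maps (A :\: S) S| * c = #|S| * c ^ (c - #|S|).
  move=> SA; have [S0|[s sS]] := set_0Vmem S.
    (* Without roots the whole of [A] would be mapped into itself. *)
    rewrite S0 cards0 mul0n setD0; apply/eqP; rewrite muln_eq0; apply/orP; left.
    rewrite cards_eq0; apply/eqP/setP=> f; rewrite in_set0; apply/negP.
    case/forest_mapsP=> h _ /acyclicP/(_ A (subxx A)).
    case=> [|x xA]; first by apply/set0Pn; exists a.
    by have := h x xA; rewrite setU0 => ->.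
  have cS : #|A :\: S| + #|S| = c by rewrite cardsDS // subnK // subset_leq_card.
  have := IH (A :\: S) S; rewrite cS cardsDS //; apply.
    apply: leq_trans le; rewrite ltn_subrL c0 andbT; apply/card_gt0P; by exists s.
  by rewrite -setI_eq0; apply/eqP/setP=> x; rewrite !inE; case: (x \in S); rewrite ?andbF.
have E : #|forest_maps A Q| * c = c * (q * (c + q) ^ c.-1).
  have -> : #|forest_maps A Q| = \sum_(S in powerset A) q ^ #|S| * #|forest_maps (A :\: S) S|.
    rewrite -sum1_card (partition_big (root_set A Q) (mem (powerset A))) /=; last first.
      by move=> f _; rewrite powersetE; apply/subsetP=> x; rewrite inE => /andP[].
    apply: eq_bigr => S; rewrite powersetE => SA; rewrite -card_root_fibre // -sum1_card.
    by apply: eq_bigl => f; rewrite inE.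
  rewrite big_distrl /=.
  rewrite (eq_bigr (fun S : {set T} => q ^ #|S| * (#|S| * c ^ (c - #|S|)))); last first.
    by move=> S; rewrite powersetE => SA; rewrite -mulnA fib.
  rewrite (sum_powerset A (fun s => q ^ s * (s * c ^ (c - s)))) -/c.
  rewrite big_ord_recl /= mul0n !muln0 add0n expnDn !big_distrr /= prednK //.
  apply: eq_bigr => s _; rewrite /fintype.bump /= add1n.
  have -> : c - s.+1 = c.-1 - s by lia.
  (* The absorption identity (s + 1) C(c, s + 1) = c C(c - 1, s) turns the sum into the binomial
     expansion of (c + q)^(c - 1). *)
  have := mul_bin_diag c s; set x := c ^ _ => e; rewrite expnS.
  by transitivity (s.+1 * 'C(c, s.+1) * (q * q ^ s * x)); [|rewrite -e]; lia.
have /eqP : c * #|forest_maps A Q| = c * (q * (c + q) ^ c.-1) by rewrite mulnC.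
rewrite eqn_pmul2l // => /eqP ->; rewrite -mulnA; congr muln.
by rewrite -expnSr prednK.
Qed.

End Acyclic.

(** * Forests as ancestor sets, and the number of tree systems *)

Section Forests.
Variable n : nat.
Implicit Types (i j k : 'I_n) (D : {ffun 'I_n -> {set 'I_n}}).

(* [D i] is the set of proper ancestors of [i]. *)
Definition forest D :=
  [/\ forall i j, j \in D i -> i \notin D j,
      forall i j, j \in D i -> D j \subset D i &
      forall i j k, j \in D i -> k \in D i -> j != k -> j \in D k \/ k \in D j].

Notation T := (option 'I_n).
(** [None] serves as the common parent of all roots, so a forest on the edges becomes a parent
    map. *)
Let A : {set T} := [set~ None].
Let Q : {set T} := [set None].
Implicit Types (f : {ffun T -> T}).

Definition ancestors f : {ffun 'I_n -> {set 'I_n}} :=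
  [ffun i => [set j | (j != i) && fconnect f (Some i) (Some j)]].

Section Ancestors.
Variable f : {ffun T -> T}.
Hypothesis fG : f \in forest_maps A Q.

Lemma forest_map_root : f None = None.
Proof. by have /forest_mapsP[_ -> //] := fG; rewrite !inE. Qed.

Lemma fconnect_root x : fconnect f None x -> x = None.
Proof. by move/iter_findex <-; elim: (findex _ _ _) => //= k ->; rewrite forest_map_root. Qed.

(** The nodes of a cycle through [x] and [y] would form a nonempty set mapped into itself. *)
Lemma fconnect_anti x y : fconnect f x y -> fconnect f y x -> x = y.
Proof.
move=> xy yx; apply/eqP; apply: contraT => ne.
have xN : x != None by apply: contraNneq ne => xN; rewrite xN in xy *; rewrite (fconnect_root xy).
pose B := [set z | fconnect f x z && fconnect f z x].
have /forest_mapsP[_ _ /acyclicP/(_ B)] := fG; case.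
- apply/subsetP=> z; rewrite !inE => /andP[_ zx]; apply: contraNneq xN => zN.
  by rewrite zN in zx; rewrite (fconnect_root zx).
- by apply/set0Pn; exists x; rewrite inE connect0.
move=> z; rewrite !inE => /andP[xz zx] /negP[].
rewrite (connect_trans xz (fconnect1 f z)) /=.
move: zx; rewrite fconnect_eqVf => /orP[/eqP zx|//]; rewrite zx.
by move: xy; rewrite fconnect_eqVf (negbTE ne) /= => h; apply: connect_trans h yx.
Qed.

Lemma in_ancestors i j : (j \in ancestors f i) = (j != i) && fconnect f (Some i) (Some j).
Proof. by rewrite ffunE inE. Qed.

Lemma ancestors_forest : forest (ancestors f).
Proof.
split=> [i j | i j | i j k]; rewrite !in_ancestors.
- case/andP=> ji ij; rewrite negb_and negbK; apply/orP; right; apply/negP=> ji'.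
  by have [e] := fconnect_anti ij ji'; rewrite e eqxx in ji.
- case/andP=> ji ij; apply/subsetP=> k; rewrite !in_ancestors => /andP[kj jk].
  rewrite (connect_trans ij jk) andbT; apply: contraNneq ji => ki.
  by rewrite ki in jk; have [->] := fconnect_anti ij jk.
case/andP=> _ /iter_findex ej /andP[_ /iter_findex ek] jk; rewrite (eq_sym k) jk /=.
rewrite -ej -ek; case: (leqP (findex f (Some i) (Some j)) (findex f (Some i) (Some k))) => [le|/ltnW le].
  by right; rewrite -(subnK le) iterD fconnect_iter.
by left; rewrite -(subnK le) iterD fconnect_iter.
Qed.

Lemma ancestors_None i : f (Some i) = None -> ancestors f i = set0.
Proof.
move=> e; apply/setP=> j; rewrite in_ancestors inE fconnect_eqVf e.
case: eqVneq => //= ji; apply/negP=> /orP[/eqP[/esym/eqP]|/fconnect_root //].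
by rewrite (negbTE ji).
Qed.

Lemma ancestors_Some i j : f (Some i) = Some j -> ancestors f i = j |: ancestors f j.
Proof.
move=> e; have ij : fconnect f (Some i) (Some j) by rewrite -e fconnect1.
have ne : j != i.
  apply/eqP=> ji; have /forest_mapsP[_ _ /acyclicP/(_ [set Some i])] := fG; case.
  - by apply/subsetP=> x; rewrite !inE => /eqP ->.
  - by apply/set0Pn; exists (Some i); rewrite inE.
  by move=> x; rewrite !inE => /eqP ->; rewrite e ji eqxx.
apply/setP=> k; rewrite in_setU1 !in_ancestors fconnect_eqVf e.
have [->|kj] := eqVneq k j; first by rewrite ne connect0 orbT.
have [->|ki] := eqVneq k i; last by rewrite /= (inj_eq (@Some_inj _)) eq_sym (negbTE ki).
apply/esym/negP=> ji; have [e'] := fconnect_anti ij ji.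
by rewrite e' eqxx in ne.
Qed.

End Ancestors.

(** The parent of [i] is the node which together with its own ancestors makes up the ancestors of
    [i]; two such nodes would be ancestors of each other. *)
Lemma ancestors_inj : {in forest_maps A Q &, injective ancestors}.
Proof.
move=> f g fG gG e; apply/ffunP=> -[i|]; last by rewrite !forest_map_root.
have [anti _ _] := ancestors_forest fG.
case ef : (f (Some i)) => [j|]; case eg : (g (Some i)) => [k|] //.
- have jD := ancestors_Some fG ef; have kD := ancestors_Some gG eg.
  congr Some; apply/eqP; apply: contraT => jk.
  have h1 : j \in ancestors f k.
    by have := setU11 j (ancestors f j); rewrite -jD e kD -e in_setU1 (negbTE jk).
  have h2 : k \in ancestors f j.
    by have := setU11 k (ancestors g k); rewrite -kD -e jD in_setU1 eq_sym (negbTE jk).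
  by rewrite (negbTE (anti _ _ h1)) in h2.
- have := setU11 j (ancestors f j); rewrite -(ancestors_Some fG ef) e (ancestors_None gG eg).
  by rewrite inE.
- have := setU11 k (ancestors g k); rewrite -(ancestors_Some gG eg) -e (ancestors_None fG ef).
  by rewrite inE.
Qed.

(** The parent is the nearest ancestor, the one with the most ancestors; as the ancestors of [i]
    form a chain, all the others lie above it. *)
Lemma ancestors_onto D : forest D -> exists2 f, f \in forest_maps A Q & D = ancestors f.
Proof.
move=> [anti trans chain].
pose par i : T := [pick j in D i | D i == j |: D j].
have parN i : par i = None -> D i = set0.
  rewrite /par; case: pickP => // no _; apply/eqP; apply: contraT => /set0Pn[j0 j0i].
  have [j ji jmax] := @arg_maxnP _ j0 (fun j => j \in D i) (fun j => #|D j|) j0i.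
  have := no j; rewrite ji /= => /negP[]; apply/eqP/setP=> k; rewrite in_setU1.
  apply/idP/orP => [ki|[/eqP -> //|]]; last exact: (subsetP (trans _ _ ji)).
  have [->|kj] := eqVneq k j; first by left.
  right; case: (chain i k j ki ji kj) => // jk.
  have : #|D j| < #|D k|.
    apply: proper_card; apply/properP; split; first exact: trans.
    by exists j => //; apply/negP=> jj; have := anti _ _ jj; rewrite jj.
  by have := jmax k ki; lia.
have parS i j : par i = Some j -> D i = j |: D j /\ #|D j| < #|D i|.
  rewrite /par; case: pickP => // k /andP[ki /eqP e] [<-]; split=> //.
  rewrite e cardsU1; suff -> : k \notin D k by [].
  by apply/negP=> kk; have := anti _ _ kk; rewrite kk.
pose f : {ffun T -> T} := [ffun x => if x is Some i then par i else None].
have fG : f \in forest_maps A Q.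
  apply/forest_mapsP; split=> [x _|x|].
  - by rewrite !inE; case: eqP.
  - by rewrite !inE negbK => /eqP ->; rewrite ffunE.
  apply/acyclicP=> B BA /set0Pn[[i0|] i0B]; last first.
    by have := subsetP BA _ i0B; rewrite !inE.
  have [i iB imin] := @arg_minnP _ i0 (fun i => Some i \in B) (fun i => #|D i|) i0B.
  exists (Some i) => //; rewrite ffunE; case e : (par i) => [j|].
    by apply/negP=> /imin; have [_] := parS _ _ e; lia.
  by apply/negP=> /(subsetP BA); rewrite !inE.
exists f => //; apply/ffunP=> i; have [m] := ubnP #|D i|.
elim: m i => // m IH i; rewrite ltnS => le; case e : (par i) => [j|].
  have [Di lt] := parS _ _ e; have fe : f (Some i) = Some j by rewrite ffunE.
  by rewrite (ancestors_Some fG fe) -IH //; apply: leq_trans le.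
by rewrite (parN _ e) ancestors_None // ffunE.
Qed.

Lemma card_forests : #|[set D | `[< forest D >]]| * n.+1 = n.+1 ^ n.
Proof.
have -> : [set D | `[< forest D >]] = ancestors @: forest_maps A Q.
  apply/setP=> D; rewrite inE; apply/asboolP/imsetP => [/ancestors_onto[f fG ->] | [f fG ->]].
    by exists f.
  exact: ancestors_forest.
rewrite (card_in_imset ancestors_inj).
have cA : #|A| = n by rewrite cardsC1 card_option card_ord.
have := @card_forest_maps _ A Q; rewrite cA cards1 addn1 mul1n; apply.
by rewrite disjoint_sym disjoints1 !inE.
Qed.

Definition sysof (b : {ffun 'I_n * 'I_n -> bool}) i j := b (i, j).

(** An edge has no position relative to itself; fixing the diagonal to [true] makes each ideal count
    once. *)
Definition normal_sys := [set b : {ffun 'I_n * 'I_n -> bool} |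
  [forall i, b (i, i)] && `[< tree_sys (sysof b) >]].

(* Choosing a root vertex [s] turns a tree system into a forest on the edges. *)
Lemma card_normal_sys : #|normal_sys| * n.+1 ^ 2 = 2 ^ n * n.+1 ^ n.
Proof.
pose R := [set bs : {ffun 'I_n * 'I_n -> bool} * {ffun 'I_n -> bool} |
  (bs.1 \in normal_sys) && vtx (sysof bs.1) bs.2].
have cR : #|R| = #|normal_sys| * n.+1.
  rewrite -sum1_card (partition_big fst (mem normal_sys)) /=; last first.
    by move=> [b s]; rewrite inE => /andP[].
  rewrite -sum_nat_const; apply: eq_bigr => b bN.
  move: (bN); rewrite inE => /andP[_ /asboolP C]; rewrite -(card_vtx C).
  rewrite -(card_imset _ (fun s s' (e : (b, s) = (b, s')) => congr1 snd e : s = s')) -sum1_card.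
  apply: eq_bigl => -[b' s]; rewrite inE /=; apply/andP/imsetP.
    by move=> [/andP[_ vs] /eqP eb]; exists s; rewrite ?inE -?eb.
  by move=> [s']; rewrite inE => vs [-> ->]; rewrite bN vs eqxx.
(* The ancestors of an edge are the edges separating it from the root [s]; together with [s] they
   determine [b] off the diagonal. *)
pose phi (bs : {ffun 'I_n * 'I_n -> bool} * {ffun 'I_n -> bool}) :=
  (bs.2, [ffun i => sep (sysof bs.1) (off bs.2) i]).
have phiI : {in R &, injective phi}.
  move=> [b s] [b' s']; rewrite !inE /= => /andP[/andP[/forallP bd _] _] /andP[/andP[/forallP bd' _] _].
  case=> <- /ffunP e; congr pair; apply/ffunP=> -[i j]; have [->|ij] := eqVneq i j.
    by rewrite bd bd'.
  have /setP/(_ j) := e i; rewrite !ffunE !inE eq_sym ij /= /off /sysof.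
  by case: (s j); case: (b (i, j)); case: (b' (i, j)).
have phiR : phi @: R = setX setT [set D | `[< forest D >]].
  apply/setP=> -[s D]; rewrite !inE /=; apply/imsetP/asboolP => [[[b s']] | [anti trans chain]].
    rewrite !inE /= => /andP[/andP[_ /asboolP C] vs] [_ ->]; split=> [i j|i j|i j k].
    - rewrite !ffunE !inE /off => /andP[ji sj]; rewrite negb_and !negbK eq_sym (negbTE ji) /=.
      by have := vtxP _ _ vs _ _ ji; rewrite (negbTE sj).
    - by rewrite !ffunE => /(sep_trans C (vtx_off vs))/proper_sub.
    rewrite !ffunE !inE /off => /andP[ji sj] /andP[ki sk] jk; rewrite jk (eq_sym k j) jk /=.
    have := C i j k; rewrite ![i == _]eq_sym => /(_ ji ki jk) /orP[] /eqP <-; first by left.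
    by right.
  (* Edge [i] lies on the root's side [s j] of [j] unless [j] is one of its ancestors. *)
  pose b : {ffun 'I_n * 'I_n -> bool} :=
    [ffun ij => (ij.1 == ij.2) || (s ij.2 (+) (ij.2 \in D ij.1))].
  have irr i : i \notin D i by apply/negP=> h; have := anti _ _ h; rewrite h.
  have bE i j : i != j -> sysof b i j = s j (+) (j \in D i).
    by rewrite /sysof ffunE /= => /negbTE ->.
  exists (b, s).
    rewrite !inE /=; apply/andP; split; first (apply/andP; split).
    - by apply/forallP=> i; rewrite ffunE eqxx.
    - apply/asboolP=> i j k ij ik jk.
      have kj0 : k != j by rewrite eq_sym.
      rewrite !bE // !(inj_eq (@addbI _)).
      case ji : (j \in D i); case jk' : (j \in D k); case ki : (k \in D i); case kj : (k \in D j) => //=.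
      + by case: (chain _ _ _ ji ki jk); rewrite ?jk' ?kj.
      + by rewrite (subsetP (trans _ _ ji) k kj) in ki.
      + by rewrite (subsetP (trans _ _ ki) j jk') in ji.
      + by have := anti _ _ jk'; rewrite kj.
    apply/vtxP=> i j ij; have ji0 : j != i by rewrite eq_sym.
    rewrite !bE //.
    case ji : (j \in D i); last by rewrite addbF eqxx orbT.
    by rewrite (negbTE (anti _ _ ji)) addbF eqxx.
  congr pair; apply/ffunP=> i; rewrite ffunE; apply/setP=> j; rewrite inE /off.
  have [->|ji] := eqVneq j i; first by rewrite (negbTE (irr i)).
  have ij : i != j by rewrite eq_sym.
  by rewrite bE //=; case: (s j); case: (j \in D i).
have cF : #|normal_sys| * n.+1 = 2 ^ n * #|[set D | `[< forest D >]]|.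
  rewrite -cR -(card_in_imset phiI) phiR cardsX cardsT card_ffun card_bool card_ord //.
by rewrite expnS expn1 mulnA cF -mulnA card_forests.
Qed.

End Forests.

Section Count.
Variables (K : closedFieldType) (n : nat).

Lemma normal_sys_mem (b : 'I_n -> 'I_n -> bool) : tree_sys b ->
  exists2 c, c \in normal_sys n & sys_ideal K b = sys_ideal K (sysof c).
Proof.
move=> C; exists [ffun ij => (ij.1 == ij.2) || b ij.1 ij.2]; last first.
  by apply: sys_ideal_eq => i j ij; rewrite /sysof ffunE /= (negbTE ij).
rewrite inE; apply/andP; split; first by apply/forallP=> i; rewrite ffunE eqxx.
apply/asboolP=> i j k ij ik jk; rewrite /sysof !ffunE /=.
by rewrite (eq_sym k) (negbTE ij) (negbTE ik) (negbTE jk) /=; apply: C.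
Qed.

Lemma count_ideals : exists s : seq (pol K n -> Prop),
  [/\ size s * n.+1 ^ 2 = 2 ^ n * n.+1 ^ n,
      forall i, i < size s -> in_H (nth (fun _ => False) s i) /\
        monomial_ideal (nth (fun _ => False) s i),
      forall i j, i < size s -> j < size s -> i <> j ->
        ~ same_ideal (nth (fun _ => False) s i) (nth (fun _ => False) s j) &
      forall I, in_H I -> monomial_ideal I ->
        exists2 i, i < size s & same_ideal I (nth (fun _ => False) s i)].
Proof.
pose V := enum (normal_sys n); pose b0 : {ffun 'I_n * 'I_n -> bool} := [ffun => true].
have VP i : i < size V -> nth b0 V i \in normal_sys n.
  by move=> lt; rewrite -mem_enum mem_nth.
have nthE i : i < size V -> nth (fun _ => False) [seq sys_ideal K (sysof b) | b <- V] i = sys_ideal K (sysof (nth b0 V i)).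
  by move=> lt; rewrite (nth_map b0).
exists [seq sys_ideal K (sysof b) | b <- V]; rewrite size_map; split.
- by rewrite -cardE card_normal_sys.
- move=> i lt; rewrite nthE //; split; last exact: sys_ideal_monomial.
  by apply: sys_ideal_in_H; have := VP _ lt; rewrite inE => /andP[_ /asboolP].
- move=> i j li lj ne; rewrite !nthE // => /same_idealP/sys_ideal_inj h; apply: ne.
  apply/eqP; rewrite -(nth_uniq b0 li lj (enum_uniq _)); apply/eqP/ffunP=> -[k l].
  have [->|kl] := eqVneq k l; last exact: h.
  have := VP _ li; have := VP _ lj; rewrite !inE => /andP[/forallP-> _] /andP[/forallP-> _] //.
move=> I IH Im; have [b C ->] := in_H_sys_ideal IH Im; have [c cN ->] := normal_sys_mem C.
have lt : index c V < size V by rewrite index_mem mem_enum.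
by exists (index c V) => //; rewrite nthE // nth_index ?mem_enum.
Qed.

End Count.

(** * Edges of the graph give related tree systems *)

Section Orders.
Variable n : nat.
Implicit Types (m a c : mon n) (i j k : 'I_n) (w : 'I_n -> bool -> nat).

Definition wt w m := \sum_j (w j true * expo m j true + w j false * expo m j false).

Lemma wt_mmul w a c : wt w (mmul a c) = wt w a + wt w c.
Proof. by rewrite /wt -big_split; apply: eq_bigr => j _; rewrite !expo_mmul !mulnDr addnACA. Qed.

Lemma wt_pvar w j p : wt w (pvar j p) = w j p.
Proof.
rewrite /wt (bigD1 j) //= big1 => [|i /negbTE ij].
  by rewrite !expo_pvar eqxx addn0; case: p; rewrite /= ?muln0 ?muln1 ?addn0.
by rewrite !expo_pvar ij /= !muln0.
Qed.

(** Breaking ties lexicographically makes every weight function, even one with zeros, yield a term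
    order. *)
Definition wlt w a c : Prop := wt w a < wt w c \/ wt w a = wt w c /\
  exists p : 'I_n * bool, expo a p.1 p.2 < expo c p.1 p.2 /\
    forall q : 'I_n * bool, enum_rank q < enum_rank p -> expo a q.1 q.2 = expo c q.1 q.2.

Lemma wlt_order w : term_order (wlt w).
Proof.
have lexT a c : a <> c -> exists2 p : 'I_n * bool, expo a p.1 p.2 != expo c p.1 p.2 &
    forall q : 'I_n * bool, enum_rank q < enum_rank p -> expo a q.1 q.2 = expo c q.1 q.2.
  move=> ac; have [p0 h0] : exists p : 'I_n * bool, expo a p.1 p.2 != expo c p.1 p.2.
    apply: contrapT => no; apply: ac; apply: monP => j p; apply/eqP; apply: contraT => h.
    by case: no; exists (j, p).
  have [p hp pmin] := @arg_minnP _ p0 (fun p : 'I_n * bool => expo a p.1 p.2 != expo c p.1 p.2)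
    (fun p : 'I_n * bool => enum_rank p) h0.
  exists p => // q lt; apply/eqP; apply: contraLR lt => /pmin; by rewrite -leqNgt.
split.
- by move=> a [|[_ [p []]]]; rewrite ltnn.
- move=> a c m [h1|[e1 [p [p1 p2]]]] [h2|[e2 [q [q1 q2]]]]; try by left; lia.
  right; split; first lia.
  have [lt|lt|e] := ltngtP (enum_rank p) (enum_rank q).
  + exists p; split; first by rewrite -q2.
    by move=> r lr; rewrite p2 // q2 //; apply: ltn_trans lt.
  + exists q; split; first by rewrite p2.
    by move=> r lr; rewrite p2 ?q2 //; apply: ltn_trans lt.
  + have e' : p = q by apply: enum_rank_inj; apply: val_inj.
    exists p; split; first by apply: ltn_trans p1 _; rewrite e'.
    by move=> r lr; rewrite p2 // q2 // -e'.
- move=> a c ac; have [lt|lt|e] := ltngtP (wt w a) (wt w c); first by left; left.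
    by right; left.
  have [p hp pl] := lexT a c ac.
  have [lt|lt|e'] := ltngtP (expo a p.1 p.2) (expo c p.1 p.2); last by rewrite e' eqxx in hp.
    by left; right; split=> //; exists p.
  by right; right; split=> //; exists p; split=> // q /pl.
- move=> a c m [h|[e [p [p1 p2]]]]; first by left; rewrite !wt_mmul ltn_add2r.
  right; split; first by rewrite !wt_mmul e.
  by exists p; split=> [|q /p2 eq]; rewrite !expo_mmul ?ltn_add2r ?eq.
move=> a a1; have [|e] := posnP (wt w a); last first.
  by left; apply: leq_trans e; rewrite ltnS /wt big1 // => j _; rewrite !expo_mone !muln0.
move=> wa; right; split; first by rewrite wa /wt big1 // => j _; rewrite !expo_mone !muln0.
have [p hp pl] := lexT a (mone n) a1.
exists p; split; first by move: hp; rewrite expo_mone lt0n.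
by move=> q /pl ->.
Qed.

Lemma wlt_wt w a c : wlt w a c -> wt w a <= wt w c.
Proof. by case=> [/ltnW //|[-> _]]. Qed.

End Orders.

Section Initial.
Variables (K : closedFieldType) (n : nat).
Implicit Types (m : mon n) (f g : pol K n) (I : pol K n -> Prop) (lt : mon n -> mon n -> Prop).
Local Open Scope ring_scope.

Lemma init_idealE lt I : init_ideal lt I =
  monoI (fun m => exists2 s, (exists2 f, I f & lead_mon lt f s) & mdvd s m).
Proof.
rewrite -(@gen_mono K n (fun s => exists2 f, I f & lead_mon lt f s)).
congr gen; apply: funext => g; apply: propext; split.
  by move=> [f [m [If lf ->]]]; exists m; split=> //; exists f.
by move=> [m [[f If lf] ->]]; exists f, m.
Qed.

Lemma lead_init lt I f m : I f -> lead_mon lt f m -> init_ideal lt I (mono K m).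
Proof. by move=> If lf; apply: gen_incl; exists f, m. Qed.

Lemma sys_ideal_mono b m : sys_ideal K b (mono K m) <-> ~~ std b m.
Proof. exact: (monoI_mono K (fun m => ~~ std b m) m). Qed.

End Initial.

Section Gens.
Variable n : nat.
Implicit Types (m s : mon n) (b : 'I_n -> 'I_n -> bool) (i j k l : 'I_n) (p q : bool).

Lemma qgenC b i j : qgen b i j = qgen b j i.
Proof. exact: mmulC. Qed.

Lemma pair_deg m i j : i != j -> mdeg m = mdeg (mmul (pvar j true) (pvar i true)) ->
  exists p q, m = mmul (pvar j p) (pvar i q).
Proof.
move=> ij /ffunP d; have ji : j != i by rewrite eq_sym.
exists (0 < expo m j true), (0 < expo m i true); apply: monP => k r.
have := d k; rewrite !mdegE !expo_mmul !expo_pvar.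
have [->|kj] := eqVneq k j.
  rewrite (negbTE ji) /=; case: r; case: (expo m j true) => [|[|?]] //=; lia.
have [->|ki] := eqVneq k i => /=.
  by case: r; case: (expo m i true) => [|[|?]] //=; lia.
by case: r; lia.
Qed.

Lemma mdeg_qgen b i j : mdeg (qgen b i j) = mdeg (mmul (pvar j true) (pvar i true)).
Proof. by rewrite !mdeg_mmul !mdeg_pvar. Qed.

(** The only quadric of [b] dividing [qgen b i j] is itself. Thus a leading monomial known only to
    divide a generator equals it. *)
Lemma qgen_min b s i j : i != j -> mdvd s (qgen b i j) -> ~~ std b s -> s = qgen b i j.
Proof.
move=> ij /mdvdP d /nstdP[k [l [kl dl]]].
have ne : k != l by rewrite -val_eqE; case: ltngtP kl.
have dd : mdvd (qgen b k l) (qgen b i j) by apply: mdvd_trans dl _; apply/mdvdP.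
have e : qgen b k l = qgen b i j.
  have : mdvd (qgen b k l) (mmul (pvar j (b i j)) (pvar i (b j i))) by [].
  have ji : j != i by rewrite eq_sym.
  rewrite qgen_dvd // !expo_mmul !expo_pvar.
  have [kj|kj] := eqVneq k j; have [lj|lj] := eqVneq l j; rewrite ?andbF //=.
  - by move: ne; rewrite kj lj eqxx.
  - by have [li|li] := eqVneq l i => // _; rewrite kj li qgenC.
  - by have [ki|ki] := eqVneq k i; rewrite ?andbF // ki lj.
  - have [ki|ki] := eqVneq k i; have [li|li] := eqVneq l i; rewrite ?andbF //=.
    by move: ne; rewrite ki li eqxx.
apply: monP => x p; apply/eqP; rewrite eqn_leq d /= -e; by move/mdvdP: dl.
Qed.

Lemma wt_qgen w b i j : wt w (qgen b i j) = w j (b i j) + w i (b j i).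
Proof. by rewrite wt_mmul !wt_pvar. Qed.

Lemma qgen_eq b b' i j : i != j -> (qgen b i j = qgen b' i j) <-> (b i j = b' i j /\ b j i = b' j i).
Proof.
move=> ij; split=> [e|[e1 e2]]; last by rewrite /qgen e1 e2.
by apply: nstd_pair => //; have := nstd_qgen b' ij; rewrite -e; exact.
Qed.

End Gens.

(** * Sign coherence of the changed generators *)

Section Related.
Variable n : nat.
Implicit Types (b : 'I_n -> 'I_n -> bool) (i j k l : 'I_n).

(* The two ways tree systems can be adjacent: some edges move from the side [q] of edge [k]
   to its other side, or the edges [k] and [l] are exchanged. *)
Definition rel_move b b' := exists k q, forall i j, i != j -> b i j != b' i j -> j = k /\ b i j = q.
Definition rel_swap b b' := exists k l, [/\ k != l, b' k l = ~~ b k l, b' l k = ~~ b l k &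
  forall i j, i != j -> (i, j) != (k, l) -> (i, j) != (l, k) -> b' i j = b i j].
Definition related b b' := rel_move b b' \/ rel_swap b b'.

Lemma related_sym b b' : related b b' -> related b' b.
Proof.
case=> [[k [q h]]|[k [l [kl e1 e2 h]]]]; [left; exists k, (~~ q) | right; exists k, l].
  move=> i j ij ne; have [|e1 e2] := h i j ij; first by rewrite eq_sym.
  by split=> //; rewrite -e2; move: ne; case: (b i j); case: (b' i j).
by split=> //; [rewrite e1 negbK | rewrite e2 negbK | move=> i j ij a c; rewrite h].
Qed.

Definition sign_coherent b b' := forall (w : 'I_n -> bool -> nat) i j k l, i != j -> k != l ->
  w j (b' i j) + w i (b' j i) < w j (b i j) + w i (b j i) ->
  w l (b k l) + w k (b l k) < w l (b' k l) + w k (b' l k) -> False.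

Lemma sign_coherent_key b b' i j k l : sign_coherent b b' -> i != j -> k != l ->
  b j i != b' j i -> (b k l != b' k l) || (b l k != b' l k) ->
  [/\ k = i, b l i != b' l i & b l i = b j i] \/ [/\ l = i, b k i != b' k i & b k i = b j i].
Proof.
move=> H ij kl cji.
have diag k' : k' != i -> b i k' != b' i k' \/ b k' i != b' k' i ->
    b k' i != b' k' i /\ b k' i = b j i.
  move=> ki c; have ik : i != k' by rewrite eq_sym.
  have [e|ne] := eqVneq (b k' i) (b' k' i).
    case: c => [c|]; last by rewrite e eqxx.
    (* Weight 3 on the old variable of [i] decides the pair [i, j] for [b]; on [i, k'] edge [i]
       contributes equally to both, and the unit weight decides for [b']. *)
    case: (H (fun x p => if x == i then 3 * (p == b j i) else (x == k') && (p == b' i k')) i j i k' ij ik).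
      rewrite !eqxx (eq_sym j i) (negbTE ij) /=.
      by rewrite (eq_sym (b' j i)) (negbTE cji); case: (_ && _); case: (_ && _).
    rewrite (negbTE ki) !eqxx /= (negbTE c) e; lia.
  split=> //; apply/eqP; apply: contraT => nb.
  case: (H (fun x p => (x == i) && (p == b j i)) i j i k' ij ik).
    by rewrite !eqxx (eq_sym j i) (negbTE ij) /= (eq_sym (b' j i)) (negbTE cji).
  rewrite (negbTE ki) !eqxx /= (negbTE nb).
  by move: ne nb; case: (b k' i); case: (b' k' i); case: (b j i).
have [ki|ki] := eqVneq k i.
  rewrite ki in kl *; move=> /orP c; left; have [] // := diag l; first by rewrite eq_sym.
have [li|li] := eqVneq l i.
  rewrite li in kl *; move=> c; right; have [] // := diag k => //.
  by apply/orP; rewrite orbC.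
move=> c; exfalso.
(* The pair [k, l] avoids [i]. Unit weights on its two [b']-variables favour [b'] there, while on
   [i, j] edge [j] collects at most one of them, less than 3. *)
apply: (H (fun x p => if x == i then 3 * (p == b j i) else
   ((x == l) && (p == b' k l)) + ((x == k) && (p == b' l k))) i j k l ij kl).
  rewrite !eqxx (eq_sym j i) (negbTE ij) (eq_sym (b' j i)) (negbTE cji) /=.
  have [jl|jl] := eqVneq j l; have [jk|jk] := eqVneq j k => /=; last by [].
  - by rewrite -jl jk eqxx in kl.
  - by do 2! case: (_ == _).
  - by do 2! case: (_ == _).
rewrite (negbTE ki) (negbTE li) !eqxx (negbTE kl) (eq_sym l) (negbTE kl) /=.
by move: c; case: (_ == _); case: (_ == _).
Qed.

(** If some edge [j2] also changes seen from [i], every changed pair contains both [i] and [j2], so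
    there is just one and the edges are swapped; otherwise only the variable of [i] ever changes. *)
Lemma related_of_sign b b' i j : i != j -> b j i != b' j i -> sign_coherent b b' -> related b b'.
Proof.
move=> ij cji H.
have key := @sign_coherent_key b b' i j _ _ H ij _ cji.
have [[j2 [ij2 c2]]|no] := pselect (exists j2, i != j2 /\ b i j2 != b' i j2).
  have ji2 : j2 != i by rewrite eq_sym.
  have key2 := @sign_coherent_key b b' j2 i _ _ H ji2 _ c2.
  have ji : j != i by rewrite eq_sym.
  have e2 : j2 = j.
    by case: (key2 j i ji); rewrite ?cji // => -[e]; rewrite ?e // in ji2 *; rewrite -e eqxx in ji2.
  subst j2; right; exists i, j; split=> //.
  - by move: c2; case: (b i j); case: (b' i j).
  - by move: cji; case: (b j i); case: (b' j i).
  move=> k l kl h1 h2; apply/eqP; rewrite eq_sym; apply: contraT => c.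
  have := key k l kl; rewrite c => /(_ isT) K1; have := key2 k l kl; rewrite c => /(_ isT) K2.
  case: K1 K2 => -[e _ _] [] [e' _ _]; rewrite ?e ?e' in kl h1 h2.
  - by rewrite -e e' eqxx in ij.
  - by rewrite eqxx in h1.
  - by rewrite eqxx in h2.
  - by rewrite -e e' eqxx in ij.
left; exists i, (b j i) => k l kl c.
case: (key k l kl); rewrite ?c // => -[e c' e'].
  by case: no; exists l; rewrite -e.
by rewrite e.
Qed.

End Related.

Section EdgeToRelated.
Variables (K : closedFieldType) (n : nat).
Implicit Types (m : mon n) (f g : pol K n) (I : pol K n -> Prop) (b : 'I_n -> 'I_n -> bool).
Local Open Scope ring_scope.

(** A weight concentrated on any monomial of the homogeneous part [f] makes it leading; it then lies
    in one of the two initial ideals, whose only monomial of that degree is the generator. *)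
Lemma edge_form I lt b b' i j : in_H I -> (i != j)%N ->
  (forall lt, term_order lt -> init_ideal lt I = sys_ideal K b \/ init_ideal lt I = sys_ideal K b') ->
  term_order lt -> init_ideal lt I = sys_ideal K b ->
  exists f, [/\ I f, f (qgen b i j) != 0 & forall m, f m != 0 -> m = qgen b i j \/ m = qgen b' i j].
Proof.
move=> [[idI homI] _] ij all olt e.
have : init_ideal lt I (mono K (qgen b i j)) by rewrite e sys_ideal_mono nstd_qgen.
rewrite init_idealE monoI_mono => -[s [f0 If0 [l1 l2]] ds].
have es : s = qgen b i j.
  apply: qgen_min => //; rewrite -(sys_ideal_mono K) -e; exact: (lead_init If0).
rewrite es in l1 l2; clear ds es s.
exists (hcomp (mdeg (qgen b i j)) f0); split.
- exact: homI.
- by rewrite /hcomp eqxx.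
have If := homI _ (mdeg (qgen b i j)) If0; set f := hcomp _ _ in If *.
move=> m fm; have dm m' : f m' != 0 -> mdeg m' = mdeg (qgen b i j).
  by rewrite /f /hcomp; case: (mdeg m' =P _) => // _; rewrite eqxx.
have [p [q mE]] : exists p q, m = mmul (pvar j p) (pvar i q).
  by apply: pair_deg => //; rewrite dm // mdeg_qgen.
pose w (x : 'I_n) r := ((x == j) && (r == p) + (x == i) && (r == q))%N.
have ji : j != i by rewrite eq_sym.
have lm : lead_mon (wlt w) f m.
  split=> // m' fm' ne; have [p' [q' mE']] : exists p q, m' = mmul (pvar j p) (pvar i q).
    by apply: pair_deg => //; rewrite dm // mdeg_qgen.
  left; rewrite mE mE' !wt_mmul !wt_pvar /w !eqxx (negbTE ij) (negbTE ji) /=.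
  have : (p' != p) || (q' != q).
    rewrite -negb_and; apply/negP=> /andP[/eqP ep /eqP eq]; apply: ne.
    by rewrite mE mE' ep eq.
  by case: eqP => //= _; case: eqP.
have := lead_init If lm; case: (all _ (wlt_order w)) => -> /sys_ideal_mono; rewrite mE => /nstd_pair [] // -> ->.
  by left.
by right.
Qed.

Lemma H_edge_related b b' : H_edge (sys_ideal K b) (sys_ideal K b') -> related b b'.
Proof.
move=> [_ _ ne [I [HI all [lt1 [o1 i1]] [lt2 [o2 i2]]]]].
have {}all lt : term_order lt -> init_ideal lt I = sys_ideal K b \/ init_ideal lt I = sys_ideal K b'.
  by case/all => /same_idealP ->; [left | right].
move: i1 i2 => /same_idealP i1 /same_idealP i2.
have {}ne : sys_ideal K b <> sys_ideal K b' by move=> h; apply: ne; apply/same_idealP.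
have all' lt (o : term_order lt) : init_ideal lt I = sys_ideal K b' \/ init_ideal lt I = sys_ideal K b.
  by case: (all lt o); [right | left].
(* If [w] prefers the generator of [c], the polynomial from [edge_form] has it as leading monomial,
   and the other ideal does not contain it. *)
have key c c' lt i j w : (i != j)%N ->
    (forall lt, term_order lt -> init_ideal lt I = sys_ideal K c \/ init_ideal lt I = sys_ideal K c') ->
    term_order lt -> init_ideal lt I = sys_ideal K c ->
    (w j (c' i j) + w i (c' j i) < w j (c i j) + w i (c j i))%N ->
    init_ideal (wlt w) I = sys_ideal K c.
  move=> ij allc ol el lw; have [f [If fz fs]] := edge_form HI ij allc ol el.
  have lf : lead_mon (wlt w) f (qgen c i j).
    by split=> // m' /fs[-> //|->] _; left; rewrite !wt_qgen.
  case: (allc _ (wlt_order w)) => // e; have := lead_init If lf.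
  rewrite e => /sys_ideal_mono/nstd_pair [] // e1 e2; move: lw; rewrite e1 e2 ltnn //.
have [i0 [j0 [ij0 c0]]] : exists i j, i != j /\ b j i != b' j i.
  apply: contrapT => no; apply: ne; apply: sys_ideal_eq => i j ij; apply/eqP; apply: contraT => c.
  by case: no; exists j, i; rewrite eq_sym.
apply: related_of_sign ij0 c0 _ => w i j k l ij kl h1 h2; apply: ne.
by rewrite -(key b b' lt1 i j w) // (key b' b lt2 k l w).
Qed.

End EdgeToRelated.

(** * The ideal joining two related tree systems *)

Section Components.
Variable n : nat.
Implicit Types (b : 'I_n -> 'I_n -> bool) (m t : mon n) (i j k l c : 'I_n).

(* Component [c] of the curve joining the two monomial points: the edges [j] whose position
   seen from [c] does not change are specialised to a coordinate point. *)
Definition alive b b' c m := [forall j, (j != c) && (b c j == b' c j) ==> (expo m j (b c j) == 0)].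

(* Exponent in a parameter of component [c]; when two edges are exchanged their components
   merge into one conic, parametrised by both. *)
Definition nu b b' c m := expo m c true +
  \sum_(j | [&& j != c, b c j != b' c j & b j c != b' j c]) expo m j (b j c (+) b c j).

Lemma aliveP b b' c m : reflect (forall j, j != c -> b c j = b' c j -> expo m j (b c j) = 0)
  (alive b b' c m).
Proof.
apply: (iffP forallP) => [h j jc e | h j].
  by have := h j; rewrite jc e eqxx => /eqP.
by apply/implyP=> /andP[jc /eqP e]; rewrite h.
Qed.

Lemma alive_mmul b b' c m t : alive b b' c (mmul m t) = alive b b' c m && alive b b' c t.
Proof.
apply/aliveP/andP => [h | [/aliveP h1 /aliveP h2] j jc e].
  by split; apply/aliveP => j jc e; have := h j jc e; rewrite expo_mmul; lia.
by rewrite expo_mmul h1 // h2.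
Qed.

Lemma nu_mmul b b' c m t : nu b b' c (mmul m t) = nu b b' c m + nu b b' c t.
Proof.
rewrite /nu expo_mmul addnACA -big_split; congr (_ + _).
by apply: eq_bigr => j _; rewrite expo_mmul.
Qed.

Lemma alive_sym b b' : alive b b' = alive b' b.
Proof.
apply: funext => c; apply: funext => m; apply: eq_forallb => j.
by case: eqVneq => //= _; rewrite (eq_sym (b' c j)); case: eqP => //= ->.
Qed.

Lemma nu_sym b b' : nu b b' = nu b' b.
Proof.
apply: funext => c; apply: funext => m; congr (_ + _); apply: eq_big => j.
  by rewrite (eq_sym (b c j)) (eq_sym (b j c)).
case/and3P=> _ h1 h2; congr (expo m j _); move: h1 h2.
by case: (b c j); case: (b' c j); case: (b j c); case: (b' j c).
Qed.

Lemma alive_qgen b b' b0 c i j : i != j -> alive b b' c (qgen b0 i j) =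
  ((j != c) && (b c j == b' c j) ==> (b c j != b0 i j)) &&
  ((i != c) && (b c i == b' c i) ==> (b c i != b0 j i)).
Proof.
move=> ij; have ji : j != i by rewrite eq_sym.
apply/aliveP/andP => [h | [/implyP h1 /implyP h2] x xc e].
  split; apply/implyP=> /andP[jc /eqP e]; have := h _ jc e; rewrite expo_mmul !expo_pvar eqxx.
    by rewrite (negbTE ji) addn0 eq_sym; case: eqP.
  by rewrite (negbTE ij) add0n eq_sym; case: eqP.
rewrite expo_mmul !expo_pvar; have [xj|xj] := eqVneq x j.
  rewrite xj in xc e *; rewrite (negbTE ji) addn0 /= eq_sym.
  by have := h1; rewrite xc e eqxx => /(_ isT)/negbTE ->.
have [xi|xi] := eqVneq x i => //; rewrite xi in xc e *; rewrite /= eq_sym add0n.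
by have := h2; rewrite xc e eqxx => /(_ isT)/negbTE ->.
Qed.

(** Every standard monomial is alive on some component, found by [sep_min] from its support. *)
Lemma std_component b m (i0 : 'I_n) : tree_sys b -> std b m ->
  exists c, forall j, j != c -> expo m j (b c j) = 0.
Proof.
move=> C /stdP sm; have [c c0 _] := sep_min C (d := fun j p => 0 < expo m j p) sm i0.
exists c => j jc; have /setP/(_ j) := c0; rewrite !inE jc /= => /negbT.
by rewrite -eqn0Ngt => /eqP.
Qed.

End Components.

(** * The vanishing ideal of the curve *)

Section EdgeIdeal.
Variables (K : closedFieldType) (n : nat).
Implicit Types (b : 'I_n -> 'I_n -> bool) (m t : mon n) (i j k l c : 'I_n).
Implicit Types (f g : pol K n) (lt : mon n -> mon n -> Prop).
Local Open Scope ring_scope.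

(** Vanishing on every component: there an alive monomial of degree [u] becomes the [nu]-th power of
    a parameter times a factor depending on [u] only, so coefficients with equal [u] and [nu] must
    cancel. *)
Definition edge_ideal b b' : pol K n -> Prop := fun f => is_poly f /\
  forall c u w, \sum_(m <- mons u | alive b b' c m && (nu b b' c m == w)) f m = 0.

Lemma edge_ideal_sym b b' : edge_ideal b b' = edge_ideal b' b.
Proof. by rewrite /edge_ideal alive_sym nu_sym. Qed.

Lemma sum_term_mul (P : pred (mon n)) (a : K) t f u : 
  \sum_(m <- mons u | P m) term_mul a t f m =
  if [forall j, (mdeg t j <= u j)%N] then
    a * \sum_(m <- mons [ffun j => (u j - mdeg t j)%N] | P (mmul m t)) f m else 0.
Proof.
rewrite /term_mul -big_mkcondr /=.
case: ifP => [/forallP le|/negbT]; last first.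
  rewrite negb_forall => /existsP[j]; rewrite -ltnNge => lt.
  rewrite big_seq_cond big1 // => m /andP[]; rewrite mem_mons => /eqP du /andP[_ /mdvdP d].
  by move: lt; rewrite -du !mdegE; have := d j true; have := d j false; lia.
rewrite big_distrr /= -[LHS]big_filter -[RHS]big_filter.
rewrite [RHS](eq_bigr (fun m => a * f (mquo (mmul m t) t))); last by move=> m _; rewrite mmulK.
rewrite -(big_map (fun m => mmul m t) predT (fun m => a * f (mquo m t))).
apply: perm_big; apply: uniq_perm; first by rewrite filter_uniq ?mons_uniq.
  rewrite map_inj_uniq ?filter_uniq ?mons_uniq // => m m' e.
  by rewrite -(mmulK t m) e mmulK.
move=> m; rewrite mem_filter mem_mons; apply/andP/mapP => [[/andP[Pm d] /eqP du]|[m0]].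
  exists (mquo m t); last by rewrite mquoK.
  rewrite mem_filter mquoK // Pm mem_mons; apply/eqP/ffunP=> j.
  have := congr1 (fun v : {ffun 'I_n -> nat} => v j) du; rewrite -{1}(mquoK d) mdeg_mmul !ffunE /= => <-.
  by rewrite addnK.
rewrite mem_filter mem_mons => /andP[Pm /eqP d] ->; rewrite Pm mmulC mdvd_mmulr; split=> //.
apply/eqP/ffunP=> j; have dj : mdeg m0 j = (u j - mdeg t j)%N by rewrite d ffunE.
by have := le j; move: dj; rewrite !mdegE !expo_mmul addnACA => -> /subnKC.
Qed.

Lemma edge_ideal_ideal b b' : is_ideal (edge_ideal b b').
Proof.
split=> [f [] // | | f g [pf hf] [pg hg] | a t f [pf hf]].
- by split=> [|c u w]; [exact: is_poly0 | rewrite big1].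
- by split=> [|c u w]; [exact: is_polyD | rewrite big_split /= hf hg addr0].
split=> [|c u w]; first exact: is_poly_term.
rewrite (sum_term_mul (fun m => alive b b' c m && (nu b b' c m == w))); case: ifP => // _.
have [alt|nalt] := boolP (alive b b' c t); last first.
  by rewrite big1 ?mulr0 // => m; rewrite alive_mmul (negbTE nalt) andbF.
have [le|gt] := leqP (nu b b' c t) w; last first.
  by rewrite big1 ?mulr0 // => m; rewrite nu_mmul => /andP[_ /eqP]; lia.
apply/eqP; rewrite mulf_eq0; apply/orP; right; apply/eqP.
apply: etrans (hf c [ffun j => (u j - mdeg t j)%N] (w - nu b b' c t)%N).
apply: eq_bigl => m; rewrite alive_mmul alt andbT nu_mmul; congr (_ && _).
by apply/eqP/eqP; lia.
Qed.

Lemma edge_ideal_homog b b' : is_homog_ideal (edge_ideal b b').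
Proof.
split=> [|f u [pf hf]]; first exact: edge_ideal_ideal.
split=> [|c v w]; first exact: is_poly_hcomp.
have [uv|uv] := eqVneq v u.
  apply: etrans (hf c v w); rewrite big_seq_cond [RHS]big_seq_cond; apply: eq_bigr => m.
  by rewrite mem_mons /hcomp uv => /andP[-> _].
rewrite big_seq_cond big1 // => m; rewrite mem_mons /hcomp => /andP[/eqP -> _].
by rewrite (negbTE uv).
Qed.

Lemma edge_ideal_dead b b' m : (forall c, ~~ alive b b' c m) -> edge_ideal b b' (mono K m).
Proof.
move=> h; split=> [|c u w]; first exact: is_poly_mono.
rewrite big1 // => m' /andP[am _]; rewrite /mono; case: (m' =P m) => // e.
by rewrite e (negbTE (h c)) in am.
Qed.

Lemma edge_ideal_diff b b' m m' : mdeg m = mdeg m' ->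
  (forall c, alive b b' c m = alive b b' c m') ->
  (forall c, alive b b' c m -> nu b b' c m = nu b b' c m') ->
  edge_ideal b b' (psub (mono K m) (mono K m')).
Proof.
move=> dm am nm; split=> [|c u w].
  by apply: (idealB (@poly_ideal K n)); exact: is_poly_mono.
have one a : \sum_(m <- mons u | alive b b' c m && (nu b b' c m == w)) mono K a m =
    if [&& mdeg a == u, alive b b' c a & nu b b' c a == w] then 1 else 0.
  rewrite /mono -big_mkcondr /= big_const_seq.
  case: ifP => [/and3P[du aa na]|/negP h].
    rewrite (@eq_in_count _ _ (pred1 a)) => [|x _ /=]; last first.
      by case: (x =P a) => [->|]; rewrite ?aa ?na ?andbF.
    by rewrite count_uniq_mem ?mons_uniq // mem_mons du /= addr0.
  rewrite (@eq_in_count _ _ pred0) ?count_pred0 // => x xu /=.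
  apply/negP=> /andP[/andP[ax nx] /eqP xa]; apply: h.
  by rewrite -xa ax nx !andbT; rewrite mem_mons in xu.
rewrite /psub sumrB !one dm -am; case: (boolP (alive b b' c m)) => [/nm ->|_]; first by rewrite subrr.
by rewrite !andbF subrr.
Qed.

(** The device for independence: a monomial of [f] whose image on a component is shared by no other
    has nothing to cancel against. *)
Lemma edge_ideal_single b b' f m c : edge_ideal b b' f -> alive b b' c m ->
  (forall m', f m' != 0 -> mdeg m' = mdeg m -> alive b b' c m' -> nu b b' c m' = nu b b' c m -> m' = m) ->
  f m = 0.
Proof.
move=> [_ hf] am h; apply: etrans (hf c (mdeg m) (nu b b' c m)); rewrite big_mkcond /=.
rewrite (bigD1_seq m) ?mem_mdeg ?mons_uniq //= am eqxx /= big_seq_cond big1 ?addr0 // => m'.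
rewrite mem_mons => /andP[/eqP d ne]; case: ifP => // /andP[am' /eqP nm'].
by apply/eqP; apply: contraNT ne => nz; apply/eqP; apply: h.
Qed.

End EdgeIdeal.

(** * Generators and independence modulo the vanishing ideal *)

Section RelatedIdeal.
Variables (K : closedFieldType) (n : nat) (b b' : 'I_n -> 'I_n -> bool).
Hypotheses (C : tree_sys b) (C' : tree_sys b') (R : related b b').
Implicit Types (m t : mon n) (i j k l c x : 'I_n).
Implicit Types (f g : pol K n) (lt : mon n -> mon n -> Prop).
Local Open Scope ring_scope.
Notation I := (edge_ideal (K := K) b b').

(** A move changes positions relative to one edge only; a swap changes one entry in each of two
    rows. *)
Lemma related_row c i j : c != i -> c != j -> i != j -> b c i != b' c i -> b c j = b' c j.
Proof.
move=> ci cj ij ne; apply/eqP; apply: contraT => ne'.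
case: R => [[k [q h]]|[k [l [kl e1 e2 h]]]].
  by have [ik _] := h c i ci ne; have [jk _] := h c j cj ne'; rewrite ik jk eqxx in ij.
have hi : ((c, i) == (k, l)) || ((c, i) == (l, k)).
  by apply: contraT; rewrite negb_or => /andP[h1 h2]; rewrite h // eqxx in ne.
have hj : ((c, j) == (k, l)) || ((c, j) == (l, k)).
  by apply: contraT; rewrite negb_or => /andP[h1 h2]; rewrite h // eqxx in ne'.
case/orP: hi => /eqP[ec ei]; case/orP: hj => /eqP[ec' ej].
- by rewrite ei ej eqxx in ij.
- by rewrite -ec ec' eqxx in kl.
- by rewrite -ec' ec eqxx in kl.
- by rewrite ei ej eqxx in ij.
Qed.

(** If [i] changes sides seen from [c], one of its two positions differs from [b j i], so [tree_sys]
    of that system gives [b c j = b i j]; by [related_row] this position does not change, so the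
    variable of [j] vanishes on [c]. If nothing changes, [tree_sys] suffices. *)
Lemma qgen_dead c i j : i != j -> b i j = b' i j -> b j i = b' j i ->
  ~~ alive b b' c (qgen b i j).
Proof.
move=> ij eij eji; rewrite alive_qgen //; have ji : j != i by rewrite eq_sym.
have [->|ci] := eqVneq c i; first by rewrite ji eij !eqxx.
have [->|cj] := eqVneq c j; first by rewrite eji !eqxx andbF.
rewrite /=.
have := C ci cj ij; have := C' ci cj ij; rewrite -eij -eji.
have := related_row ci cj ij.
have := related_row cj ci ji.
by case: (b c i); case: (b' c i); case: (b c j); case: (b' c j); case: (b i j); case: (b j i) => //=;
  do ?[move=> /(_ isT) // | move=> _].
Qed.

Lemma qgen_diff i j : i != j -> b i j != b' i j ->
  I (psub (mono K (qgen b i j)) (mono K (qgen b' i j))).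
Proof.
move=> ij ne; have ji : j != i by rewrite eq_sym.
apply: edge_ideal_diff; first by rewrite !mdeg_qgen.
  move=> c; rewrite !alive_qgen //.
  have [->|ci] := eqVneq c i.
    by rewrite ji (negbTE ne) eqxx.
  case: R => [[k [q h]]|[k [l [kl e1 e2 h]]]].
    have [jk _] := h i j ij ne; subst k.
    have eji : b j i = b' j i.
      by apply/eqP; apply: contraT => /(h j i ji)[e _]; rewrite e eqxx in ij.
    have [->|cj] := eqVneq c j; first by rewrite -eji !eqxx !andbF.
    rewrite -eji /=.
    have eci : b c i = b' c i.
      by apply/eqP; apply: contraT => /(h c i ci)[e _]; rewrite e eqxx in ij.
    have := C ci cj ij; have := C' ci cj ij; rewrite -eci -eji; move: ne.
    by case: (b c j); case: (b' c j); case: (b i j); case: (b' i j); case: (b c i); case: (b j i).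
  have hij : ((i, j) == (k, l)) || ((i, j) == (l, k)).
    by apply: contraT; rewrite negb_or => /andP[h1 h2]; rewrite h // eqxx in ne.
  have {e1 e2}[eij eji] : b' i j = ~~ b i j /\ b' j i = ~~ b j i.
    by case/orP: hij => /eqP[-> ->].
  have [->|cj] := eqVneq c j; first by rewrite eji; case: (b j i).
  have hc y : y != c -> b' c y = b c y.
    move=> yc; apply: h; first by rewrite eq_sym.
      by apply/eqP=> -[ck yl]; case/orP: hij => /eqP[ik jl]; [rewrite ck ik eqxx in ci | rewrite ck jl eqxx in cj].
    by apply/eqP=> -[ck yl]; case/orP: hij => /eqP[ik jl]; [rewrite ck jl eqxx in cj | rewrite ck ik eqxx in ci].
  have jc : j != c by rewrite eq_sym.
  have ic : i != c by rewrite eq_sym.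
  have := C ci cj ij; have := C' ci cj ij; rewrite !hc // eij eji !eqxx /=.
  by case: (b c i); case: (b c j); case: (b i j); case: (b j i).
move=> c; rewrite alive_qgen // => al.
case: R => [[k [q h]]|[k [l [kl e1 e2 h]]]].
  have [jk _] := h i j ij ne; subst k.
  have eji : b j i = b' j i.
    by apply/eqP; apply: contraT => /(h j i ji)[e _]; rewrite e eqxx in ij.
  have [cj|cj] := eqVneq c j.
    by move: al; rewrite cj ij -eji !eqxx andbF.
  have sum0 m : (\sum_(x | [&& x != c, b c x != b' c x & b x c != b' x c]) expo m x (b x c (+) b c x) = 0)%N.
    rewrite big1 // => x /and3P[xc _ nxc]; have [e _] := h x c xc nxc.
    by rewrite e eqxx in cj.
  by rewrite /nu !sum0 !addn0 !expo_mmul !expo_pvar (negbTE cj) /= -eji.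
have hij : ((i, j) == (k, l)) || ((i, j) == (l, k)).
  by apply: contraT; rewrite negb_or => /andP[h1 h2]; rewrite h // eqxx in ne.
have {e1 e2}[eij eji] : b' i j = ~~ b i j /\ b' j i = ~~ b j i.
  by case/orP: hij => /eqP[-> ->].
have {}h x y : x != y -> (x, y) != (i, j) -> (x, y) != (j, i) -> b' x y = b x y.
  by move=> xy; case/orP: hij => /eqP[-> ->] h1 h2; apply: h.
have sumE p q m : p != q -> b' p q = ~~ b p q -> b' q p = ~~ b q p ->
    (forall x, x != p -> x != q -> b' p x = b p x) ->
    (\sum_(x | [&& x != p, b p x != b' p x & b x p != b' x p]) expo m x (b x p (+) b p x)
     = expo m q (b q p (+) b p q))%N.
  move=> pq epq eqp hp; rewrite (big_pred1 q) // => x /=.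
  have [->|xq] := eqVneq x q; first by rewrite eq_sym pq epq eqp; case: (b p q); case: (b q p).
  by have [//|xp] := eqVneq x p; rewrite hp // eqxx.
have [ci|ci] := eqVneq c i.
  have hi x : x != i -> x != j -> b' i x = b i x.
    move=> xi xj; apply: h; first by rewrite eq_sym.
      by rewrite xpair_eqE (negbTE xj) andbF.
    by rewrite xpair_eqE (negbTE ij).
  subst c; rewrite /nu !(sumE i j _ ij eij eji hi).
  (* On the conic both generators have exponent 1, contributed by edge [i] in one of them and by
     edge [j] in the other. *)
  rewrite !expo_mmul !expo_pvar !eqxx (negbTE ij) (negbTE ji) /= eij eji.
  by case: (b i j); case: (b j i).
have [cj|cj] := eqVneq c j.
  have hj x : x != j -> x != i -> b' j x = b j x.
    move=> xj xi; apply: h; first by rewrite eq_sym.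
      by rewrite xpair_eqE (negbTE ji).
    by rewrite xpair_eqE (negbTE xi) andbF.
  subst c; rewrite /nu !(sumE j i _ ji eji eij hj).
  rewrite !expo_mmul !expo_pvar !eqxx (negbTE ij) (negbTE ji) /= eij eji.
  by case: (b i j); case: (b j i).
have hc y : y != c -> b' c y = b c y.
  by move=> yc; apply: h; rewrite ?xpair_eqE ?(negbTE ci) ?(negbTE cj) // eq_sym.
have jc : j != c by rewrite eq_sym.
have ic : i != c by rewrite eq_sym.
move: al; have := C ci cj ij; have := C' ci cj ij; rewrite jc ic !hc // eij eji !eqxx /=.
by case: (b c i); case: (b c j); case: (b i j); case: (b j i).
Qed.

Lemma qgen_pair i j : i != j -> I (mono K (qgen b i j)) /\ qgen b i j = qgen b' i j \/
  I (psub (mono K (qgen b i j)) (mono K (qgen b' i j))) /\ qgen b i j <> qgen b' i j.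
Proof.
move=> ij; have ji : j != i by rewrite eq_sym.
have [e1|ne] := eqVneq (b i j) (b' i j); last first.
  by right; split; [apply: qgen_diff | move/(qgen_eq b b' ij) => [e]; rewrite e eqxx in ne].
have [e2|ne] := eqVneq (b j i) (b' j i); last first.
  right; rewrite ![qgen _ i j]qgenC; split; first exact: qgen_diff.
  by move/(qgen_eq b b' ji) => [e]; rewrite e eqxx in ne.
left; split; last by apply/(qgen_eq b b' ij).
by apply: edge_ideal_dead => c; apply: qgen_dead.
Qed.

(** Each standard monomial is isolated on a component. Two cases are delicate: a component from
    which the moving edge changes sides, and the conic of a swap. *)
Lemma std_indep f : I f -> (forall m, f m != 0 -> std b m) -> forall m, f m = 0.
Proof.
move=> If sf.
(* A component that sees no change determines an alive monomial by its degree and its exponent of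
   [x_c]. *)
have row c m : (forall j, j != c -> b c j = b' c j) -> (forall j, j != c -> expo m j (b c j) = 0%N) ->
    f m = 0.
  move=> rc mc; apply: (edge_ideal_single (c := c) If).
    by apply/aliveP => j jc _; exact: mc.
  move=> m' _ /ffunP dm /aliveP am.
  have sum0 a : (\sum_(x | [&& x != c, b c x != b' c x & b x c != b' x c]) expo a x (b x c (+) b c x) = 0)%N.
    by rewrite big_pred0 // => x; case: eqVneq => //= xc; rewrite rc // eqxx.
  rewrite /nu !sum0 !addn0 => et; apply: monP => j p.
  have := dm j; rewrite !(mdegEp _ j p); have [->|jc] := eqVneq j c.
    by case: p => //=; rewrite et; lia.
  have := mc j jc; have := am j jc (rc j jc); case: (b c j); case: p => /=; lia.
move=> m; apply/eqP; apply: contraT => nz; have sm := sf m nz; case/eqP: nz.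
case: R => [[k [q h]]|[k [l [kl e1 e2 h]]]].
  have [c mc] := std_component k C sm.
  have rk j : j != k -> b k j = b' k j.
    by move=> jk; apply/eqP; apply: contraT => /(h k j); rewrite eq_sym => /(_ jk)[e _]; rewrite e eqxx in jk.
  have rc j : j != c -> j != k -> b c j = b' c j.
    by move=> jc jk; apply/eqP; apply: contraT => /(h c j); rewrite eq_sym => /(_ jc)[e _]; rewrite e eqxx in jk.
  have [ck|ck] := eqVneq c k; first by apply: (row c) => //; rewrite ck.
  apply: (edge_ideal_single (c := c) If); first by apply/aliveP=> j jc _; exact: mc.
  move=> m' nz' /ffunP dm /aliveP am.
  have sum0 a : (\sum_(x | [&& x != c, b c x != b' c x & b x c != b' x c]) expo a x (b x c (+) b c x) = 0)%N.
    rewrite big1 // => x /and3P[xc _ nxc]; have [e _] := h x c xc nxc.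
    by rewrite e eqxx in ck.
  rewrite /nu !sum0 !addn0 => et; have [z|pos] := posnP (expo m' k (b c k)).
    apply: monP => j p; have := dm j; rewrite !(mdegEp _ j p); have [->|jc] := eqVneq j c.
      by case: p => //=; rewrite et; lia.
    have := mc j jc; have : expo m' j (b c j) = 0%N.
      by have [->|jk] := eqVneq j k; [ | apply: am => //; apply: rc].
    case: (b c j); case: p => /=; lia.
  (* The competitor [m'] contains [z_ck]; being standard, it is alive on the component of [k], which
     sees no change, so its coefficient is already 0. *)
  have sm' := sf m' nz'; case/eqP: nz'; apply: (row k) => // j jk; apply/eqP; rewrite eqn0Ngt; apply/negP=> pj.
  have [jc|jc] := eqVneq j c.
    by rewrite jc in pj; exact: (stdP _ _ sm' c k ck pos).
  have := C ck (_ : c != j) (_ : k != j); rewrite eq_sym jc eq_sym jk => /(_ isT isT).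
  have [e|ne] := eqVneq (b k j) (b c j); first by move: pj; rewrite e am // rc.
  rewrite orbF => /eqP e.
  by apply: (stdP _ _ sm' k j _ pj); rewrite -?e // eq_sym.
have rc c j : c != k -> c != l -> j != c -> b c j = b' c j.
  by move=> ck cl jc; rewrite h ?xpair_eqE ?(negbTE ck) ?(negbTE cl) // eq_sym.
have rk j : j != k -> j != l -> b k j = b' k j.
  by move=> jk jl; rewrite h ?xpair_eqE ?(negbTE jl) ?(negbTE kl) ?andbF // eq_sym.
(* No other edge separates [k] from [l], so their components impose the same conditions on all other
   edges. *)
have kl_row j : j != k -> j != l -> b k j = b l j.
  move=> jk jl; have lj : l != j by rewrite eq_sym. have kj : k != j by rewrite eq_sym.
  have lk : l != k by rewrite eq_sym.
  have := C kl kj lj; have := C' kl kj lj; rewrite e1.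
  rewrite [b' j l]h // ?xpair_eqE ?(negbTE jk) ?(negbTE jl) // -rk //.
  rewrite [b' l j]h // ?xpair_eqE ?(negbTE jk) ?(negbTE jl) ?andbF //.
  by case: (b k l); case: (b j l); case: (b k j); case: (b l j).
have [c mc] := std_component k C sm.
have [ckl|ckl] := boolP ((c == k) || (c == l)); last first.
  by move: ckl; rewrite negb_or => /andP[ck cl]; apply: (row c) => // j jc; apply: rc.
have mk j : j != k -> j != l -> expo m j (b k j) = 0%N.
  by move=> jk jl; case/orP: ckl => /eqP e; rewrite e in mc; [exact: mc | rewrite kl_row // mc].
apply: (edge_ideal_single (c := k) If).
  apply/aliveP=> j jk e; apply: mk => //; apply: contra_eq_neq e => ->.
  by rewrite e1; case: (b k l).
have sumE a : (\sum_(x | [&& x != k, b k x != b' k x & b x k != b' x k]) expo a x (b x k (+) b k x)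
     = expo a l (b l k (+) b k l))%N.
  rewrite (big_pred1 l) // => x /=.
  have [->|xl] := eqVneq x l; first by rewrite eq_sym kl e1 e2; case: (b k l); case: (b l k).
  by have [//|xk] := eqVneq x k; rewrite rk // eqxx.
move=> m' nz' /ffunP dm /aliveP am; rewrite /nu !sumE => nue.
have sm' := stdP _ _ (sf m' nz') k l kl; have {}sm := stdP _ _ sm k l kl.
have zero (x y : nat) : (0 < x -> 0 < y -> False)%N -> (x = 0 \/ y = 0)%N.
  by case: x => [|x]; [left | case: y => [|y]; [right | move=> /(_ isT isT)]].
have {}sm' := zero _ _ sm'; have {}sm := zero _ _ sm.
have dk := dm k; have dl := dm l; rewrite !mdegE in dk dl.
(* Neither monomial contains both [z_kl] and [z_lk]; with the degrees in [k] and [l] fixed, [nu]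
   then determines these exponents. *)
have [kE lE] : (forall p, expo m' k p = expo m k p) /\ (forall p, expo m' l p = expo m l p).
  split=> -[]; move: sm sm' dk dl nue; case: (b k l); case: (b l k) => /=; lia.
apply: monP => j p; have [->|jk] := eqVneq j k; first exact: kE.
have [->|jl] := eqVneq j l; first exact: lE.
have := dm j; rewrite !(mdegEp _ j p).
have := mk j jk jl; have := am j jk (rk j jk jl); case: (b k j); case: p => /=; lia.
Qed.

End RelatedIdeal.

(** * The direction of the binomials under a term order *)

Section Positive.
Variable n : nat.
Implicit Types (b : 'I_n -> 'I_n -> bool) (lt : mon n -> mon n -> Prop) (i j k l : 'I_n).

Definition positive lt b b' := forall i j, i != j -> qgen b i j = qgen b' i j \/ lt (qgen b' i j) (qgen b i j).

(** For a move each binomial is, up to sign, a variable times [x_k - y_k]; for a swap there is a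
    single binomial. One comparison decides them all. *)
Lemma positive_or b b' lt : related b b' -> term_order lt ->
  positive lt b b' \/ positive lt b' b.
Proof.
move=> R [irr tr tot mulc one].
have col c c' k q : (forall i j, i != j -> c i j != c' i j -> j = k /\ c i j = q) ->
    lt (pvar k (~~ q)) (pvar k q) -> positive lt c c'.
  move=> h lk i j ij; have ji : j != i by rewrite eq_sym.
  have [e1|ne] := eqVneq (c i j) (c' i j); have [e2|ne'] := eqVneq (c j i) (c' j i).
  - by left; apply/qgen_eq.
  - right; have [ik e] := h j i ji ne'; rewrite /qgen -e1 ![mmul (pvar j _) _]mmulC.
    apply: mulc; rewrite ik in e ne' *; move: ne' lk; rewrite e.
    by case: q {e h}; case: (c' j k).
  - right; have [ik e] := h i j ij ne; rewrite /qgen -e2; apply: mulc.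
    rewrite ik in e ne *; move: ne lk; rewrite e.
    by case: q {e h}; case: (c' i k).
  by have [ik _] := h j i ji ne'; have [jk _] := h i j ij ne; rewrite ik jk eqxx in ij.
case: R => [[k [q h]]|[k [l [kl e1 e2 h]]]].
  have ne : pvar k (~~ q) <> pvar k q.
    move=> e; have := congr1 (fun m => expo m k q) e; rewrite /= !expo_pvar !eqxx.
    by case: q {h e}.
  case: (tot _ _ ne) => lk; [left; exact: col h lk | right].
  apply: (col _ _ k (~~ q)); last by rewrite negbK.
  move=> i j ij ne'; have [|jk e] := h i j ij; first by rewrite eq_sym.
  by split=> //; rewrite -e; move: ne'; case: (b i j); case: (b' i j).
have nkl : qgen b k l <> qgen b' k l.
  by move/(qgen_eq b b' kl) => [e _]; move: e1; rewrite -e; case: (b k l).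
have sw c c' : qgen c k l = qgen c' k l \/ lt (qgen c' k l) (qgen c k l) ->
    (forall i j, i != j -> (i, j) != (k, l) -> (i, j) != (l, k) -> c' i j = c i j) ->
    positive lt c c'.
  move=> hkl h' i j ij; have ji : j != i by rewrite eq_sym.
  have [[-> ->] //|h1] := eqVneq (i, j) (k, l).
  have [[-> ->]|h2] := eqVneq (i, j) (l, k); first by rewrite ![qgen _ l k]qgenC.
  left; apply/qgen_eq => //; rewrite h' // h' //.
    by apply: contra h2 => /eqP[-> ->].
  by apply: contra h1 => /eqP[-> ->].
case: (tot _ _ nkl) => lk; [right | left].
  by apply: sw => [|i j ij h1 h2]; [right | rewrite h].
by apply: sw => //; right.
Qed.

Lemma exists_positive b b' : related b b' ->
  (exists i j, i != j /\ b i j != b' i j) -> exists2 lt, term_order lt & positive lt b b'.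
Proof.
move=> R [i [j [ij ne]]]; pose w (k : 'I_n) q : nat := (k == j) && (q == b i j).
have ol := wlt_order w; exists (wlt w) => //.
case: (positive_or R ol) => // /(_ i j ij); rewrite qgen_eq // => -[[e _]|/wlt_wt].
  by rewrite e eqxx in ne.
rewrite !wt_qgen /w !eqxx (negbTE ij) /= eq_sym (negbTE ne) //.
Qed.

End Positive.

(** * Division and initial ideals *)

Section RelatedEdge.
Variables (K : closedFieldType) (n : nat) (b b' : 'I_n -> 'I_n -> bool).
Hypotheses (C : tree_sys b) (C' : tree_sys b') (R : related b b').
Implicit Types (m t : mon n) (i j k l c x : 'I_n).
Implicit Types (f g : pol K n).
Local Open Scope ring_scope.
Notation I := (edge_ideal (K := K) b b').

Section Division.
Variable lt : mon n -> mon n -> Prop.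
Hypotheses (ol : term_order lt) (pos : positive lt b b').

Let idI : is_ideal I := edge_ideal_ideal K b b'.

(** Division by the binomials; it terminates because only finitely many monomials share the degree
    of [m]. *)
Lemma mono_reduce m : exists g, [/\ I (psub (mono K m) g),
  forall m', g m' != 0 -> [/\ std b m', mdeg m' = mdeg m & m' = m \/ lt m' m] &
  std b m -> g = mono K m].
Proof.
have [irr tr tot mulc one] := ol.
pose below m := [seq m' <- mons (mdeg m) | `[< lt m' m >]].
have [d] := ubnP (size (below m)); elim: d m => // d IH m; rewrite ltnS => le.
have [sm|nsm] := boolP (std b m).
  exists (mono K m); split=> //.
    by move: (ideal0 idI); congr (I _); apply: funext => x; rewrite /psub subrr.
  by move=> m'; rewrite mono_neq0 => /eqP ->; split=> //; left.
have [i [j [ij dv]]] := nstdP _ _ nsm; have ne : i != j by rewrite -val_eqE; case: ltngtP ij.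
have mE : mmul (mquo m (qgen b i j)) (qgen b i j) = m by rewrite mquoK.
case: (qgen_pair K C C' R ne) => [[Ig _]|[Ig nee]].
  exists (@pzero K n); split.
  - have -> : psub (mono K m) (@pzero K n) = mono K m by apply: funext => x; rewrite /psub subr0.
    exact: ideal_mono_dvd Ig dv.
  - by move=> m'; rewrite /pzero eqxx.
  - by [].
pose m2 := mmul (mquo m (qgen b i j)) (qgen b' i j).
have Im : I (psub (mono K m) (mono K m2)).
  have := idealT idI 1 (mquo m (qgen b i j)) Ig; congr (I _); apply: funext => x.
  have tm (a : mon n) : term_mul 1 (mquo m (qgen b i j)) (mono K a) x = mono K (mmul (mquo m (qgen b i j)) a) x.
    rewrite /term_mul /mono mul1r; case: ifP => dx.
      congr (if _ then _ else _); apply/eqP/eqP => [<-|->]; first by rewrite mmulC mquoK.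
      by rewrite mmulC mmulK.
    by case: eqP => // e; rewrite e mdvd_mmulr in dx.
  rewrite -[in RHS]mE /psub -!tm /term_mul; case: ifP => _; first by rewrite mulrBr.
  by rewrite subrr.
have dm2 : mdeg m2 = mdeg m by rewrite /m2 mdeg_mmul mdeg_qgen -(mdeg_qgen b) -mdeg_mmul mE.
have l2 : lt m2 m.
  case: (pos ne) => [/nee //|h].
  by rewrite -mE /m2 ![mmul (mquo _ _) _]mmulC; apply: mulc.
have [|g [g1 g2 g3]] := IH m2.
  apply: leq_trans le; apply: (@uniq_leq_size _ (m2 :: below m2)) => [|m'].
    rewrite /= filter_uniq ?mons_uniq // andbT mem_filter negb_and.
    by apply/orP; left; apply/asboolP; exact: irr.
  rewrite inE !mem_filter !mem_mons dm2 => /orP[/eqP ->|/andP[/asboolP l' ->]].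
    by rewrite dm2 eqxx andbT; apply/asboolP.
  by rewrite andbT; apply/asboolP; exact: tr l2.
exists g; split.
- move: (idealD idI Im g1); congr (I _); apply: funext => x.
  by rewrite /padd /psub addrA subrK.
- by move=> m' /g2[s1 s2 s3]; split=> //; [rewrite s2 | right; case: s3 => [->|s3] //; apply: tr s3 l2].
- by [].
Qed.

Lemma edge_ideal_in_H : in_H I.
Proof.
split=> [|u]; first exact: edge_ideal_homog.
rewrite -(size_stdl u C); apply: quot_dim_basis.
- exact: stdl_uniq.
- by move=> m; rewrite mem_stdl => /andP[_ /eqP].
- move=> f If h; apply: (std_indep C C' R If) => m /h.
  by rewrite mem_stdl => /andP[].
move=> f pf hf; have [G hG] := choice mono_reduce.
have sf m : f m != 0 -> m \in mons u by rewrite mem_mons => /hf ->.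
exists (psum (mons u) (fun m => pscale (f m) (G m))).
  move=> m; apply: contraNT; rewrite mem_stdl => ns.
  rewrite /psum big_seq big1 // => m0; rewrite mem_mons => /eqP d0; rewrite /pscale.
  have [->|nz] := eqVneq (G m0 m) 0; first by rewrite mulr0.
  have [_ /(_ _ nz)[s1 s2 _] _] := hG m0.
  by rewrite s1 s2 d0 eqxx in ns.
have -> : psub f (psum (mons u) (fun m => pscale (f m) (G m))) =
    psum (mons u) (fun m => pscale (f m) (psub (mono K m) (G m))).
  apply: funext => x; rewrite /psub {1}(poly_expand (mons_uniq u) sf) /psum -sumrB.
  by apply: eq_bigr => m _; rewrite /pscale mulrBr.
by apply: (ideal_psum idI) => m _; apply: (idealZ idI); case: (hG m).
Qed.

(** Were a leading monomial [s] standard, dividing [f] would leave a combination [g] of standard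
    monomials in the ideal. All other terms reduce to monomials below [s], so [g] keeps the
    coefficient of [s], yet [g] is 0 by independence. *)
Lemma init_edge_ideal : init_ideal lt I = sys_ideal K b.
Proof.
have [irr tr tot mulc one] := ol.
rewrite init_idealE; congr monoI; apply: funext => m; apply: propext; split; last first.
  move=> /nstdP[i [j [ij dv]]]; have ne : i != j by rewrite -val_eqE; case: ltngtP ij.
  exists (qgen b i j) => //; case: (qgen_pair K C C' R ne) => [[Ig _]|[Ig nee]].
    exists (mono K (qgen b i j)) => //; split; first by rewrite mono_neq0.
    by move=> m'; rewrite mono_neq0 => /eqP ->.
  have {}l2 : lt (qgen b' i j) (qgen b i j) by case: (pos ne).
  exists (psub (mono K (qgen b i j)) (mono K (qgen b' i j))) => //; split.
    by rewrite /psub /mono eqxx; case: (_ =P qgen b' i j) => // _; rewrite subr0 oner_eq0.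
  move=> m'; rewrite /psub /mono; case: (m' =P qgen b i j) => // _; case: (m' =P qgen b' i j) => [-> //|_].
  by rewrite subrr eqxx.
move=> [s [f0 If0 [l1 l2]] dv]; apply: nstd_up dv; apply/negP=> ss.
have If := (edge_ideal_homog K b b').2 _ (mdeg s) If0.
set f := hcomp _ _ in If.
have fs : f s = f0 s by rewrite /f /hcomp eqxx.
have ff m' : f m' != 0 -> m' <> s -> lt m' s.
  by rewrite /f /hcomp; case: (mdeg m' == mdeg s) => [h ne|]; [exact: l2 | rewrite eqxx].
have [G hG] := choice mono_reduce.
have sf m' : f m' != 0 -> m' \in mons (mdeg s).
  by rewrite mem_mons /f /hcomp; case: (mdeg m' == mdeg s) => //; rewrite eqxx.
pose g := psum (mons (mdeg s)) (fun m => pscale (f m) (G m)).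
have Ig : I g.
  have Ifg : I (psub f g).
    have -> : psub f g = psum (mons (mdeg s)) (fun m => pscale (f m) (psub (mono K m) (G m))).
      apply: funext => x; rewrite /psub {1}(poly_expand (mons_uniq _) sf) /g /psum -sumrB.
      by apply: eq_bigr => m0 _; rewrite /pscale mulrBr.
    by apply: (ideal_psum idI) => m0 _; apply: (idealZ idI); case: (hG m0).
  move: (idealB idI If Ifg); congr (I _); apply: funext => x.
  by rewrite /psub opprB addrC subrK.
have gz : g s = 0.
  apply: (std_indep C C' R Ig) => m'; apply: contraNT => ns.
  rewrite /g /psum big1 // => m0 _; rewrite /pscale.
  have [->|nz] := eqVneq (G m0 m') 0; first by rewrite mulr0.
  by have [_ /(_ _ nz)[s1 _ _] _] := hG m0; rewrite s1 in ns.
move: gz; rewrite /g /psum (bigD1_seq s) ?mons_uniq ?mem_mdeg //= big1 ?addr0.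
  have [_ _ /(_ ss) ->] := hG s; rewrite /pscale /mono eqxx mulr1 fs => e.
  by rewrite e eqxx in l1.
move=> m0 ne; rewrite /pscale; have [->|nz0] := eqVneq (f m0) 0; first by rewrite mul0r.
have lm := ff m0 nz0 (elimN eqP ne).
have [->|nz] := eqVneq (G m0 s) 0; first by rewrite mulr0.
have [_ /(_ _ nz)[_ _ [e|l3]] _] := hG m0; first by rewrite e eqxx in ne.
by case: (irr s); apply: tr l3 lm.
Qed.

End Division.
End RelatedEdge.

Lemma related_H_edge (K : closedFieldType) n (b b' : 'I_n -> 'I_n -> bool) :
  tree_sys b -> tree_sys b' -> related b b' -> sys_ideal K b <> sys_ideal K b' -> H_edge (sys_ideal K b) (sys_ideal K b').
Proof.
move=> C C' R ne.
have [i [j [ij nij]]] : exists i j, i != j /\ b i j != b' i j.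
  apply: contrapT => no; apply: ne; apply: sys_ideal_eq => i j ij; apply/eqP; apply: contraT => c.
  by case: no; exists i, j.
have R' := related_sym R.
have [lt ol pl] : exists2 lt, term_order lt & positive lt b b'.
  by apply: exists_positive => //; exists i, j.
have [lt' ol' pl'] : exists2 lt, term_order lt & positive lt b' b.
  by apply: exists_positive => //; exists i, j; split=> //; rewrite eq_sym.
split; [by split; [exact: sys_ideal_in_H | exact: sys_ideal_monomial] |
        by split; [exact: sys_ideal_in_H | exact: sys_ideal_monomial] | by move/same_idealP |].
exists (edge_ideal b b'); split.
- exact: edge_ideal_in_H ol pl.
- move=> lt0 ol0; case: (positive_or R ol0) => p0; [left | right]; apply/same_idealP.
    exact: init_edge_ideal.
  by rewrite edge_ideal_sym; exact: init_edge_ideal.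
- by exists lt; split=> //; apply/same_idealP; exact: init_edge_ideal.
by exists lt'; split=> //; apply/same_idealP; rewrite edge_ideal_sym; exact: init_edge_ideal.
Qed.

(** * Operations on trees *)

Section Moves.
Variables (n : nat) (e : dgraph n).
Hypothesis conn : connected_graph e.
Implicit Types (i j k l a b : 'I_n) (v w x y p q : 'I_n.+1).

Lemma tsys_incident v i j : incident e v i -> i != j -> tsys e i j = side e j v.
Proof. by move=> /orP[] /eqP <- // ij; rewrite -side_cross. Qed.

Lemma connected_sub (e'' : dgraph n) :
  (forall i, connect (adj_wo e'' None) (e i).1 (e i).2) -> connected_graph e''.
Proof.
move=> h v; apply: connect_sub (conn v) => x y /adjP[i _ ei].
by have := h i; case: ei => -> //=; rewrite conn_sym.
Qed.

Lemma side_endpoint i v : sep (tsys e) (off (vec e v)) i = set0 -> incident e v i.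
Proof.
move=> /sep0_eend; set s := vec e v i; move: s => [] h; apply/orP; [left | right]; apply/eqP.
  by apply: (vec_inj conn); rewrite vec_tail.
by apply: (vec_inj conn); rewrite vec_head.
Qed.

(** * Moving subtrees along an edge *)

Section Move.
Variables (v w : 'I_n.+1) (k : 'I_n) (S : pred 'I_n) (e'' : dgraph n).
Hypothesis ek : (e k == (v, w)) || (e k == (w, v)).
Hypothesis SP : forall j, S j -> j != k /\ incident e v j.
Hypothesis e''E : forall j, e'' j = if S j then (repl v w (e j).1, repl v w (e j).2) else e j.

(** The vertices of the moved subtrees: some edge of [S] separates them from [v]. *)
Definition beyond x := [exists j, S j && (side e j x != side e j v)].

Let Sk : S k = false.
Proof. by apply/negP=> /SP[]; rewrite eqxx. Qed.

Let side_vw j : j != k -> side e j w = side e j v.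
Proof.
move=> jk; have kj : k != j by rewrite eq_sym.
by have := side_cross e kj; case/orP: ek => /eqP -> /=.
Qed.

Let side_repl j x : j != k -> side e j (repl v w x) = side e j x.
Proof. by move=> jk; rewrite /repl; case: eqP => // ->; exact: side_vw. Qed.

Let side_kw : side e k w = ~~ side e k v.
Proof.
have := side_tail e k; have := side_head k conn.
by case/orP: ek => /eqP -> /= -> ->.
Qed.

Let beyond_v : beyond v = false.
Proof. by apply/existsP=> -[j]; rewrite eqxx andbF. Qed.

Let beyond_w : beyond w = false.
Proof. by apply/existsP=> -[j /andP[/SP[jk _]]]; rewrite side_vw // eqxx. Qed.

Lemma move_connected : connected_graph e''.
Proof.
have vw : connect (adj_wo e'' None) v w.
  apply: connect1; apply/adjP; exists k => //; rewrite e''E Sk.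
  by case/orP: ek => /eqP; [left | right].
apply: connected_sub => i; have c := connect1 (@adj_edge _ e'' None i isT).
move: c; rewrite e''E; case: ifP => // /SP[ik iv] /=; rewrite /repl.
case: eqP => [->|_]; case: eqP => [->|_] c //.
- exact: connect_trans vw c.
- by apply: connect_trans c _; rewrite conn_sym.
Qed.

(** Only the sides of [k] change, and only for the vertices carried across it. *)
Definition move_side j x := if j == k then side e k x (+) beyond x else side e j x.

Let S_far i : S i -> exists x, [/\ x != v, (e i == (v, x)) || (e i == (x, v)) & beyond x].
Proof.
move=> Si; have [ik] := SP Si; have t1 := side_tail e i; have t2 := side_head i conn.
case/orP=> /eqP ev.
  have far : side e i (e i).2 != side e i v by rewrite t2 -ev t1.
  exists (e i).2; split; last by apply/existsP; exists i; rewrite Si.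
    by apply: contraNneq far => ->.
  by rewrite -ev -surjective_pairing eqxx.
have far : side e i (e i).1 != side e i v by rewrite t1 -ev t2.
exists (e i).1; split; last by apply/existsP; exists i; rewrite Si.
  by apply: contraNneq far => ->.
by rewrite -ev -surjective_pairing eqxx orbT.
Qed.

Let S_side i x : S i -> (e i == (v, x)) || (e i == (x, v)) -> side e k x = side e k v.
Proof.
move=> Si; have [ik _] := SP Si; have := side_cross e ik.
by move=> + /orP[] /eqP ei; rewrite ei.
Qed.

Lemma move_is_side : is_side e'' move_side.
Proof.
move=> j; rewrite /move_side e''E; have [jk|jk] := eqVneq j k.
  subst j; rewrite Sk; split.
  - rewrite side_tail; suff -> : beyond (e k).1 = false by [].
    by case/orP: ek => /eqP -> /=.
  - rewrite side_head //; suff -> : beyond (e k).2 = false by [].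
    by case/orP: ek => /eqP -> /=.
  move=> i ik; rewrite e''E; case: ifP => [Si|nSi].
    have [x [xv ei bx]] := S_far Si; have sx := S_side Si ei.
    have rx : repl v w x = x by rewrite /repl (negbTE xv).
    have rv : repl v w v = w by rewrite /repl eqxx.
    by case/orP: ei => /eqP -> /=; rewrite rx rv beyond_w bx sx side_kw; case: (side e k v).
  rewrite (side_cross e ik); congr (_ (+) _); apply: eq_existsb => l.
  case Sl : (S l) => //=; rewrite (side_cross e (j := l) (i := i)) //.
  by apply: contraFneq nSi => ->.
split.
- by case: ifP => _ /=; rewrite ?side_repl // side_tail.
- by case: ifP => _ /=; rewrite ?side_repl // side_head.
move=> i ij; rewrite e''E; case: ifP => _ /=; rewrite ?side_repl //; exact: side_cross.
Qed.

(** The alternative [S i] accounts for a moved edge with its tail at [v]: it is carried across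
    although [v] is not [beyond]. *)
Lemma tsys_move i j : i != j ->
  tsys e'' i j = if j == k then tsys e i k (+) (S i || beyond (e i).1) else tsys e i j.
Proof.
move=> ij; rewrite {1}/tsys (side_uniq move_connected move_is_side) /move_side e''E.
have [jk|jk] := eqVneq j k; last by case: ifP => _; rewrite /= ?side_repl.
subst j; case: ifP => [Si|nSi] //=.
have [x [xv ei bx]] := S_far Si; have sx := S_side Si ei.
have rx : repl v w x = x by rewrite /repl (negbTE xv).
have rv : repl v w v = w by rewrite /repl eqxx.
by rewrite /tsys; case/orP: ei => /eqP -> /=; rewrite ?rx ?rv ?beyond_w ?bx ?sx ?side_kw;
  case: (side e k v).
Qed.

Let incident_k : incident e v k.
Proof. by rewrite /incident; case/orP: ek => /eqP -> /=; rewrite eqxx ?orbT. Qed.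

Lemma beyond_side i : i != k -> S i || beyond (e i).1 -> tsys e i k = side e k v.
Proof.
move=> ik /orP[/SP[_ iv]|/existsP[j /andP[Sj far]]]; first exact: tsys_incident.
have [jk jv] := SP Sj; have /vtxP/(_ j k jk) := vec_vtx (e i).1 conn; rewrite !ffunE.
have kj : k != j by rewrite eq_sym.
by rewrite (tsys_incident incident_k kj) (negbTE far) (tsys_incident jv jk) => /eqP.
Qed.

Lemma move_related : rel_move (tsys e) (tsys e'').
Proof.
exists k, (side e k v) => i j ij; rewrite tsys_move //.
have [jk|_] := eqVneq j k; last by rewrite eqxx.
subst j; case: (boolP (S i || beyond (e i).1)) => [h _|_]; first by rewrite beyond_side.
by rewrite addbF eqxx.
Qed.

End Move.

(** * Swapping two edges at a bivalent vertex *)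

Section Swap.
Variables (v : 'I_n.+1) (a b : 'I_n) (e'' : dgraph n).
Let p := other_end e a v.
Let q := other_end e b v.
Let f x := if x == p then v else if x == v then q else x.
Let g x := if x == q then v else if x == v then p else x.
Hypothesis ab : a != b.
Hypothesis inc : forall j, incident e v j = (j == a) || (j == b).
Hypothesis e''E : forall j, e'' j = if j == a then (f (e a).1, f (e a).2)
                         else if j == b then (g (e b).1, g (e b).2) else e j.

Let other j : incident e v j -> (e j = (v, other_end e j v)) \/ (e j = (other_end e j v, v)).
Proof.
rewrite /incident /other_end; case: eqP => [ev _|_ /= /eqP ev]; [left | right];
  by rewrite -ev -surjective_pairing.
Qed.

Let ea : e a = (v, p) \/ e a = (p, v).
Proof. by apply: other; rewrite inc eqxx. Qed.

Let eb : e b = (v, q) \/ e b = (q, v).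
Proof. by apply: other; rewrite inc eqxx orbT. Qed.

Let ba : b != a. Proof. by rewrite eq_sym. Qed.

Let side_p j : side e j p = if j == a then ~~ side e a v else side e j v.
Proof.
case: eqVneq => [->|ja].
  by have := side_tail e a; have := side_head a conn; case: ea => -> /= -> ->.
have aj : a != j by rewrite eq_sym.
by have := side_cross e aj; case: ea => -> /=.
Qed.

Let side_q j : side e j q = if j == b then ~~ side e b v else side e j v.
Proof.
case: eqVneq => [->|jb].
  by have := side_tail e b; have := side_head b conn; case: eb => -> /= -> ->.
have bj : b != j by rewrite eq_sym.
by have := side_cross e bj; case: eb => -> /=.
Qed.

Let pv : (p == v) = false.
Proof. by apply/eqP=> h; have := side_p a; rewrite h eqxx; case: side. Qed.

Let qv : (q == v) = false.
Proof. by apply/eqP=> h; have := side_q b; rewrite h eqxx; case: side. Qed.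

Let pq : (p == q) = false.
Proof. by apply/eqP=> h; have := side_p a; rewrite h side_q (negbTE ab) eqxx; case: side. Qed.

Let fg : (f p = v) * (f v = q) * (g q = v) * (g v = p).
Proof. by rewrite /f /g !eqxx !(eq_sym v) pv qv. Qed.

(** After the swap [v] still lies between the two edges, but on the other side of each; no other
    vertex changes sides. *)
Definition swap_side j x := if (j == a) || (j == b) then
  (if x == v then ~~ side e j v else side e j x) else side e j x.

Let ends i : i != a -> i != b -> ((e i).1 == v = false) * ((e i).2 == v = false).
Proof.
move=> ia ib; have := inc i; rewrite (negbTE ia) (negbTE ib) /= /incident.
by move/negbT; rewrite negb_or => /andP[/negbTE -> /negbTE ->].
Qed.

Lemma swap_connected : connected_graph e''.
Proof.
have cvp : connect (adj_wo e'' None) v p.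
  apply: connect1; apply/adjP; exists b => //; rewrite e''E (negbTE ba) eqxx.
  by case: eb => -> /=; rewrite !fg; [right | left].
have cvq : connect (adj_wo e'' None) v q.
  apply: connect1; apply/adjP; exists a => //; rewrite e''E eqxx.
  by case: ea => -> /=; rewrite !fg; [right | left].
apply: connected_sub => i; have [->|ia] := eqVneq i a.
  by case: ea => -> //=; rewrite conn_sym.
have [->|ib] := eqVneq i b; first by case: eb => -> //=; rewrite conn_sym.
have := connect1 (@adj_edge _ e'' None i isT).
by rewrite e''E (negbTE ia) (negbTE ib).
Qed.

Let tE j : (swap_side j v = if (j == a) || (j == b) then ~~ side e j v else side e j v) *
  (swap_side j p = side e j p) * (swap_side j q = side e j q).
Proof. by rewrite /swap_side eqxx pv qv; case: ifP. Qed.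

Lemma swap_is_side : is_side e'' swap_side.
Proof.
have cross_a j : j != a -> swap_side j v = swap_side j q.
  by move=> ja; rewrite !tE side_q (negbTE ja) /=; case: eqP => // ->.
have cross_b j : j != b -> swap_side j v = swap_side j p.
  by move=> jb; rewrite !tE side_p (negbTE jb) orbF /=; case: eqP => // ->.
move=> j; have [ja|ja] := eqVneq j a; last have [jb|jb] := eqVneq j b.
- have := side_tail e a; have := side_head a conn; rewrite e''E ja eqxx /=.
  case: ea => -> /=; rewrite !fg !tE side_p side_q eqxx (negbTE ab) /=;
  case: (side e a v) => // _ _; split=> // i ia;
  rewrite e''E (negbTE ia); (have [ib|ib] := eqVneq i b; [by case: eb => -> /=; rewrite !fg cross_b |]);
  by rewrite /swap_side !ends // (side_cross e ia).
- have := side_tail e b; have := side_head b conn; rewrite e''E jb (negbTE ba) eqxx /=.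
  case: eb => -> /=; rewrite !fg !tE side_p side_q eqxx (negbTE ba) orbT /=;
  case: (side e b v) => // _ _; split=> // i ib;
  rewrite e''E; (have [ia|ia] := eqVneq i a; [by case: ea => -> /=; rewrite !fg cross_a |]);
  by rewrite (negbTE ib) /swap_side !ends // (side_cross e ib).
rewrite e''E (negbTE ja) (negbTE jb) /swap_side (negbTE ja) (negbTE jb) /=.
split; [exact: side_tail | exact: side_head | move=> i ij; rewrite e''E].
have sp := side_p j; have sq := side_q j; rewrite (negbTE ja) (negbTE jb) in sp sq.
have [ia|ia] := eqVneq i a; first by case: ea => -> /=; rewrite !fg sq.
have [ib|ib] := eqVneq i b; first by case: eb => -> /=; rewrite !fg sp.
exact: side_cross.
Qed.

Lemma tsys_swap i j : i != j -> tsys e'' i j =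
  if ((i, j) == (a, b)) || ((i, j) == (b, a)) then ~~ tsys e i j else tsys e i j.
Proof.
move=> ij; rewrite {1}/tsys (side_uniq swap_connected swap_is_side) e''E !xpair_eqE.
have [ia|ia] := eqVneq i a.
  subst i; rewrite (negbTE ab) orbF /= (@tsys_incident v _ _ _ ij) ?inc ?eqxx //.
  have ja : (j == a) = false by rewrite eq_sym (negbTE ij).
  have -> : swap_side j (f (e a).1) = swap_side j v.
    case: ea => -> /=; rewrite fg ?tE // side_q ja /=; by case: eqP => // ->.
  by rewrite tE ja.
have [ib|ib] := eqVneq i b; last by rewrite /swap_side !ends //; case: ifP.
subst i; rewrite /= (@tsys_incident v _ _ _ ij) ?inc ?eqxx ?orbT //.
have jb : (j == b) = false by rewrite eq_sym (negbTE ij).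
have -> : swap_side j (g (e b).1) = swap_side j v.
  case: eb => -> /=; rewrite fg ?tE // side_p jb orbF; by case: eqP => // ->.
by rewrite tE jb orbF.
Qed.

Lemma swap_related : rel_swap (tsys e) (tsys e'').
Proof.
exists a, b; split=> //.
- by rewrite tsys_swap // eqxx.
- by rewrite tsys_swap // eqxx orbT.
by move=> i j ij /negbTE h1 /negbTE h2; rewrite tsys_swap // h1 h2.
Qed.

End Swap.

Lemma tree_move_related (e'' : dgraph n) : tree_move e e'' ->
  connected_graph e'' /\ related (tsys e) (tsys e'').
Proof.
case=> [[v [w [k [S [ek SP E]]]]] | [v [a [b [ab inc E]]]]].
  by split; [exact: move_connected ek SP E | left; exact: move_related ek SP E].
by split; [exact: swap_connected ab inc E | right; exact: swap_related ab inc E].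
Qed.

(** The end [v] of [k] lies on the side [r] that edges leave, and [S] collects the edges at [v] that
    change. An edge separated from [v] by [j] changes together with [j], so whole subtrees move. *)
Lemma related_move (e' : dgraph n) : connected_graph e' -> rel_move (tsys e) (tsys e') ->
  exists2 e'' : dgraph n, tree_move e e'' & forall i j, i != j -> tsys e'' i j = tsys e' i j.
Proof.
move=> conn' [k [r h]]; have C := tsys_tree_sys conn; have C' := tsys_tree_sys conn'.
pose v := if r then (e k).1 else (e k).2; pose w := if r then (e k).2 else (e k).1.
have ek : (e k == (v, w)) || (e k == (w, v)).
  by rewrite /v /w; case: (r); rewrite -surjective_pairing eqxx ?orbT.
have side_kv : side e k v = r by rewrite /v; case: (r); rewrite ?side_tail ?side_head.
have vk : incident e v k by rewrite /incident /v; case: (r); rewrite eqxx ?orbT.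
pose S i := [&& i != k, incident e v i & tsys e i k != tsys e' i k].
pose e'' j := if S j then (repl v w (e j).1, repl v w (e j).2) else e j.
have SP j : S j -> j != k /\ incident e v j by case/and3P.
have e''E j : e'' j = if S j then (repl v w (e j).1, repl v w (e j).2) else e j by [].
exists e''; first by left; exists v, w, k, S.
have row i j : i != j -> j != k -> tsys e' i j = tsys e i j.
  by move=> ij jk; apply/eqP; apply: contraT; rewrite eq_sym => /(h i j ij)[ejk _]; rewrite ejk eqxx in jk.
have same i j : i != k -> j != k -> i != j -> side e j v != tsys e i j ->
    (tsys e i k != tsys e' i k) = (tsys e j k != tsys e' j k).
  move=> ik jk ij; have kj : k != j by rewrite eq_sym.
  rewrite -(tsys_incident vk kj) => ne; have ji : j != i by rewrite eq_sym.
  have := C i j k ij ik jk; have := C' i j k ij ik jk; rewrite (row i j) // (row k j) //.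
  rewrite (eq_sym (tsys e i j)) (negbTE ne) /=.
  by move=> /eqP -> /eqP ->.
move=> i j ij; rewrite (tsys_move ek SP e''E ij); have [jk|jk] := eqVneq j k; last by rewrite row.
subst j; suff -> : S i || beyond v S (e i).1 = (tsys e i k != tsys e' i k).
  by case: (tsys e i k); case: (tsys e' i k).
apply/orP/idP => [[/and3P[] //|/existsP[j /andP[Sj far]]]|ch].
  have [e0|ne] := eqVneq i j; first by case/and3P: Sj; rewrite -e0.
  have [jk jv] := SP j Sj; rewrite (same i j) //; first by case/and3P: Sj.
  by rewrite eq_sym.
have [_ er] := h i k ij ch.
(* [j] is the edge at [v] behind which [i] lies, or [i] itself. *)
have [j j0 ji] := sep_min C (vtx_off (vec_vtx v conn)) i.
have jv := side_endpoint j0; case/orP: ji => [/eqP ji|].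
  by left; rewrite /S -ji ji ij ch -ji jv.
rewrite inE /off ffunE => /andP[ji far]; right.
have jk : j != k by apply: contraNneq far => ->; rewrite side_kv er.
have ij' : i != j by rewrite eq_sym.
apply/existsP; exists j; rewrite /S jk jv -(same i j) // ch /=.
by rewrite eq_sym.
Qed.

(** An edge between [k] and [l] would violate one of the two tree conditions, as its position
    relative to [l] is fixed while that of [k] flips; so the facing ends of [k] and [l] coincide. A
    third edge at this vertex would violate [C']. *)
Lemma related_swap (e' : dgraph n) : connected_graph e' -> rel_swap (tsys e) (tsys e') ->
  exists2 e'' : dgraph n, tree_move e e'' & forall i j, i != j -> tsys e'' i j = tsys e' i j.
Proof.
move=> conn' [k [l [kl e1 e2 h]]]; have C := tsys_tree_sys conn; have C' := tsys_tree_sys conn'.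
have lk : l != k by rewrite eq_sym.
have vend i r : exists2 v, incident e v i & vec e v = eend (tsys e) i r.
  exists (if r then (e i).1 else (e i).2).
    by rewrite /incident; case: r; rewrite eqxx ?orbT.
  by case: r; rewrite ?vec_tail ?vec_head.
have [v vk vE] := vend k (tsys e l k); have [v' vl v'E] := vend l (tsys e k l).
have oth i j : i != j -> (i != k) && (i != l) || (j != k) && (j != l) -> tsys e' i j = tsys e i j.
  move=> ij hh; apply: h => //; rewrite xpair_eqE; apply: contraTN hh => /andP[/eqP -> /eqP ->];
  by rewrite !eqxx ?andbF.
have vv : v = v'.
  apply: (vec_inj conn); rewrite vE v'E; apply/ffunP=> j; rewrite !eendE.
  have [->|jk] := eqVneq j k; first by rewrite (negbTE kl).
  have [-> //|jl] := eqVneq j l.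
  have kj : k != j by rewrite eq_sym.
  have lj : l != j by rewrite eq_sym.
  have := C k l j kl kj lj; have := C' k l j kl kj lj.
  rewrite (oth j l) ?(oth k j) ?(oth l j) ?jk ?jl ?orbT // e1.
  by case: (tsys e k l); case: (tsys e k j); case: (tsys e l j); case: (tsys e j l).
subst v'.
have inc i : incident e v i = (i == k) || (i == l).
  apply/idP/orP => [iv|[/eqP -> //|/eqP -> //]].
  have [ik|ik] := eqVneq i k; first by left.
  have [il|il] := eqVneq i l; first by right.
  have sk : tsys e i k = tsys e l k.
    by rewrite (tsys_incident iv ik); have := congr1 (fun s : {ffun _} => s k) vE; rewrite ffunE eendE eqxx.
  have sl : tsys e i l = tsys e k l.
    by rewrite (tsys_incident iv il); have := congr1 (fun s : {ffun _} => s l) v'E; rewrite ffunE eendE eqxx.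
  have := C' i k l ik il kl; rewrite (oth i k) ?(oth i l) ?ik ?il ?orbT // e1 e2 sk sl.
  by case: (tsys e l k); case: (tsys e k l).
pose p := other_end e k v; pose q := other_end e l v.
pose f x := if x == p then v else if x == v then q else x.
pose g x := if x == q then v else if x == v then p else x.
pose e'' j := if j == k then (f (e k).1, f (e k).2)
              else if j == l then (g (e l).1, g (e l).2) else e j.
exists e''; first by right; exists v, k, l.
move=> i j ij; rewrite (tsys_swap kl inc (e'' := e'')) //.
case: ifP => [/orP[] /eqP[-> ->]|/negbT]; rewrite ?e1 ?e2 //.
by rewrite negb_or => /andP[h1 h2]; rewrite h.
Qed.

End Moves.

Theorem theorem4p2 (K : closedFieldType) (n : nat) :
  (* T |-> I_T lands in the monomial ideals of H_{2,n} *)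
  (forall e : dgraph n, is_tree e -> in_H (I_T K e) /\ monomial_ideal (I_T K e)) /\
  (* it is surjective onto them *)
  (forall I : pol K n -> Prop, in_H I -> monomial_ideal I ->
     exists e : dgraph n, is_tree e /\ same_ideal I (I_T K e)) /\
  (* and injective on trees up to isomorphism *)
  (forall e e' : dgraph n, is_tree e -> is_tree e' ->
     (same_ideal (I_T K e) (I_T K e') <-> tree_iso e e')) /\
  (* there are exactly 2^n (n+1)^(n-2) monomial ideals in H_{2,n} *)
  (exists s : seq (pol K n -> Prop),
     [/\ ((size s)%:R : rat) = (2%:R ^+ n * (n.+1)%:R ^ (Posz n - 2%:Z))%R,
         forall i, (i < size s)%N ->
           in_H (nth (fun _ => False) s i) /\ monomial_ideal (nth (fun _ => False) s i),
         forall i j, (i < size s)%N -> (j < size s)%N -> i <> j ->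
           ~ same_ideal (nth (fun _ => False) s i) (nth (fun _ => False) s j) &
         forall I, in_H I -> monomial_ideal I -> exists2 i, (i < size s)%N & same_ideal I (nth (fun _ => False) s i)]) /\
  (* edges of the graph of H_{2,n} *)
  (forall e e' : dgraph n, is_tree e -> is_tree e' -> ~ tree_iso e e' ->
     (H_edge (I_T K e) (I_T K e') <->
      exists e'' : dgraph n, tree_move e e'' /\ tree_iso e'' e')).
Proof.
split; first by move=> e [_ conn]; rewrite I_T_sys_ideal; split;
  [apply: sys_ideal_in_H; exact: tsys_tree_sys | exact: sys_ideal_monomial].
split.
  move=> I IH Im; have [b C ->] := in_H_sys_ideal IH Im; have [e te eb] := exists_tree C.
  exists e; split=> //; rewrite I_T_sys_ideal; apply/same_idealP; apply: sys_ideal_eq => i j ij.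
  by rewrite eb.
split.
  move=> e e' [_ conn] [_ conn']; rewrite same_idealP !I_T_sys_ideal; split=> [h|h].
    by apply: tsys_iso => //; exact: sys_ideal_inj h.
  by apply: sys_ideal_eq => i j _; exact: iso_tsys.
split.
  have [s [sz s1 s2 s3]] := count_ideals K n; exists s; split=> //.
  (* The exponent n - 2 is negative for n < 2, hence the power in [rat]; the natural-number count
     carries the factor (n + 1)^2 on the other side. *)
  have n1 : ((n.+1)%:R : rat) != 0%R by rewrite Num.Theory.pnatr_eq0.
  have : ((size s)%:R * (n.+1)%:R ^+ 2 = 2%:R ^+ n * (n.+1)%:R ^+ n :> rat)%R.
    by rewrite -!natrX -!natrM sz.
  move/(canRL (mulfK (expf_neq0 2 n1))) => ->; rewrite -mulrA; congr (_ * _)%R.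
  by rewrite expfzDr.
move=> e e' [_ conn] [_ conn'] niso; rewrite !I_T_sys_ideal.
have C := tsys_tree_sys conn; have C' := tsys_tree_sys conn'.
split=> [/H_edge_related R | [e'' [mv iso]]].
  have [e'' mv eq] : exists2 e'' : dgraph n, tree_move e e'' &
      forall i j, i != j -> tsys e'' i j = tsys e' i j.
    by case: R => R; [exact: related_move | exact: related_swap].
  exists e''; split=> //; apply: tsys_iso => //.
  by have [] := tree_move_related conn mv.
have [conn'' R] := tree_move_related conn mv.
have -> : sys_ideal K (tsys e') = sys_ideal K (tsys e'').
  by apply: sys_ideal_eq => i j _; rewrite (iso_tsys conn'' conn' iso).
apply: related_H_edge => //; first exact: tsys_tree_sys.
move/sys_ideal_inj => h; apply: niso; apply: tsys_iso => // i j ij.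
by rewrite h // (iso_tsys conn'' conn' iso).
Qed.
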